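(* For an integer $n\ge1$ and real $1\le x\le n$, define $\widetilde R_B(n,x)$ by $$B(n,x)=\frac12\vartheta(x)\,n+\widetilde R_B(n,x),$$ where $B(n,x)=\sum_{p\le x}\frac{n-1}{p-1}d_p(n)\log p$ (sum over primes). Then for $n^{2/3}\le x\le n$, $$\widetilde R_B(n,x)=O\!\left(x^{5/4}n^{3/4}(\log n)^{7/2}+n^{5/3}\log n\right).$$
   Context: $\vartheta(x)=\sum_{p\le x}\log p$ is the first Chebyshev function. For a prime $p$, $d_p(n)$ is the sum of the base-$p$ digits of $n$. *)

(* Defs.v *)
From Stdlib Require Import Reals List.
From mathcomp Require Import ssreflect ssrbool ssrnat prime.
Open Scope R_scope.

Definition sumR (l : list R) : R := fold_right Rplus 0 l.

(* digit sum of n in base p (for p >= 2); fuel n suffices since n/p < n *)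
Fixpoint digsum_aux (fuel p n : nat) : nat :=
  match fuel with
  | O => O
  | S f => (Nat.modulo n p + digsum_aux f p (Nat.div n p))%nat
  end.
Definition digsum (p n : nat) : nat := digsum_aux n p n.

Definition primes_le (x : R) : list nat :=
  filter (fun p : nat => prime p && (if Rle_dec (INR p) x then true else false))
         (List.seq 0 (Z.to_nat (up x))).

Definition theta (x : R) : R := sumR (map (fun p => ln (INR p)) (primes_le x)).

Definition Bsum (n : nat) (x : R) : R :=
  sumR (map (fun p => INR (n - 1) / INR (p - 1) * INR (digsum p n) * ln (INR p))
            (primes_le x)).

Definition RB (n : nat) (x : R) : R := Bsum n x - / 2 * theta x * INR n.

(* Main.v *)
Require Import Defs.
From Stdlib Require Import Reals.
Open Scope R_scope.

(* For a prime [p] with [p^2 > n] the base-[p] digits of [n] are [n mod p] and [n div p], so up to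
   [O(n^(5/3) log n)] the error term is [n] times the sum of [log p * ({n/p} - 1/2)] over
   [n^(2/3) < p <= x]. The sawtooth is expanded in harmonics [cos (2 pi h n / p + al)], its
   remainder being dominated by an average of Fejer kernels. On a dyadic block [y < p <= 2y] the
   sums over primes of these harmonics are treated by Vaughan's identity: the phases
   [m |-> z / m] with [z = h n] have derivative at most 1/2 after differencing, so that the
   Kusmin-Landau inequality suffices for both the linear and the bilinear sums. All sums are kept
   real by carrying an arbitrary phase shift [al]. *)

(** On a block the truncation at [H] harmonics costs about [y / H]; with [H] of size [(n/y)^(1/4)]
    this is [y (y/n)^(1/4)], and the factor [n] together with the sum over blocks yields
    [x^(5/4) n^(3/4)]. To save a factor [H] by Cauchy-Schwarz in the bilinear part of Vaughan's
    identity, both variables must exceed about [H^2], and the part with coefficients supported up to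
    [U V] asks for [U V H^2 <= y]. So [H^6 <= y] would do, while [y^3 >= n^2] provides [H^8 <= y].
    The slack pays for most logarithms. Those that remain make up the exponent [7/2]: [3/2] from the
    mean square of the divisor function, [1] from the number of dyadic pieces in Vaughan's identity
    and [1] from summing [1/h] over the harmonics. If [n/y] is so small that the slack cannot absorb
    logarithms, the trivial bound for the block loses no more than the same power [7/2]. *)

(* The module confines the ssreflect notations, under which the [<=] on [nat] in the theorem
   would be read as a boolean. *)
Module Digit_sum_error.

From Stdlib Require Import ZArith Lra Lia Psatz.
From Coquelicot Require Import Coquelicot.
From HB Require Import structures.
From mathcomp Require Import all_boot.
From mathcomp Require Import zify_ssreflect.
Set Implicit Arguments.
Unset Strict Implicit.
Unset Printing Implicit Defensive.
Open Scope R_scope.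

(** * Finite sums of reals *)

HB.instance Definition _ := Monoid.isComLaw.Build R 0 Rplus
  (fun x y z => esym (Rplus_assoc x y z)) Rplus_comm Rplus_0_l.
HB.instance Definition _ := Monoid.isComLaw.Build R 1 Rmult
  (fun x y z => esym (Rmult_assoc x y z)) Rmult_comm Rmult_1_l.
HB.instance Definition _ := Monoid.isMulLaw.Build R 0 Rmult Rmult_0_l Rmult_0_r.
HB.instance Definition _ := Monoid.isAddLaw.Build R Rmult Rplus
  (fun x y z => Rmult_plus_distr_r x y z) (fun x y z => Rmult_plus_distr_l x y z).

Notation "\rsum_ ( m <= i < n ) F" := (\big[Rplus/0]_(m <= i < n) F)
  (at level 41, F at level 41, i, m, n at level 50,
   format "'[' \rsum_ ( m  <=  i  <  n ) '/  '  F ']'") : R_scope.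
Notation "\rsum_ ( m <= i < n | P ) F" := (\big[Rplus/0]_(m <= i < n | P%B) F)
  (at level 41, F at level 41, i, m, n at level 50,
   format "'[' \rsum_ ( m  <=  i  <  n  |  P ) '/  '  F ']'") : R_scope.

Lemma sum_le (F G : nat -> R) m n :
  (forall i, (m <= i < n)%N -> F i <= G i) ->
  \rsum_(m <= i < n) F i <= \rsum_(m <= i < n) G i.
Proof.
move=> H; rewrite big_nat [X in _ <= X]big_nat.
by apply: (big_ind2 Rle); [lra | move=> *; lra | exact: H].
Qed.

Lemma sum_ge0 (F : nat -> R) m n :
  (forall i, (m <= i < n)%N -> 0 <= F i) -> 0 <= \rsum_(m <= i < n) F i.
Proof. by move=> H; rewrite big_nat; apply: big_ind; [lra | move=> *; lra | exact: H]. Qed.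

Lemma sum_abs (F : nat -> R) m n :
  Rabs (\rsum_(m <= i < n) F i) <= \rsum_(m <= i < n) Rabs (F i).
Proof.
apply: (big_ind2 (fun x y => Rabs x <= y)) => [|x1 x2 y1 y2 *|i _]; [by rewrite Rabs_R0; lra | | by lra].
by have := Rabs_triang x1 y1; lra.
Qed.

Lemma sum_const (c : R) m n : \rsum_(m <= i < n) c = INR (n - m) * c.
Proof.
rewrite big_const_nat; elim: (n - m)%N => [|k IH]; first by rewrite /=; lra.
by rewrite iterS IH S_INR; lra.
Qed.

Lemma sum_opp (F : nat -> R) m n : \rsum_(m <= i < n) - F i = - \rsum_(m <= i < n) F i.
Proof. by elim/big_rec2: _ => [|i x y _ ->]; lra. Qed.

Lemma sum_sub (F G : nat -> R) m n :
  \rsum_(m <= i < n) (F i - G i) = \rsum_(m <= i < n) F i - \rsum_(m <= i < n) G i.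
Proof. by rewrite /Rminus -sum_opp -big_split. Qed.

Lemma sum_le_const (F : nat -> R) c m n :
  (forall i, (m <= i < n)%N -> F i <= c) -> \rsum_(m <= i < n) F i <= INR (n - m) * c.
Proof. by move=> H; rewrite -sum_const; apply: sum_le. Qed.

Lemma sum1_le_const (F : nat -> R) c n :
  (forall i, (1 <= i < n.+1)%N -> F i <= c) -> \rsum_(1 <= i < n.+1) F i <= INR n * c.
Proof. by move=> H; have := sum_le_const H; rewrite subSS subn0. Qed.

Lemma sum_single (F : nat -> R) (j m n : nat) :
  (m <= j < n)%N -> (forall i, (m <= i < n)%N -> i != j -> F i = 0) ->
  \rsum_(m <= i < n) F i = F j.
Proof.
move=> Hj H; rewrite (bigD1_seq j) ?iota_uniq ?mem_index_iota //= big_seq_cond big1 => [|i].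
  by rewrite Rplus_0_r.
by rewrite mem_index_iota => /andP[Hi Hij]; apply: H.
Qed.

Lemma sum_incl (F : nat -> R) m n m' n' :
  (m <= m')%N -> (n' <= n)%N -> (forall i, (m <= i < n)%N -> 0 <= F i) ->
  \rsum_(m' <= i < n') F i <= \rsum_(m <= i < n) F i.
Proof.
move=> Hm Hn H.
have [le|lt] := leqP m' n'; last by rewrite big_geq ?(ltnW lt) //; apply: sum_ge0.
have Hmn : (m' <= n)%N by lia.
rewrite (big_cat_nat Hm Hmn) (big_cat_nat le Hn) /=.
have H1 : 0 <= \rsum_(m <= i < m') F i by apply: sum_ge0 => i Hi; apply: H; lia.
have H2 : 0 <= \rsum_(n' <= i < n) F i by apply: sum_ge0 => i Hi; apply: H; lia.
lra.
Qed.

Lemma sum_ge_term (f : nat -> R) m n j : (m <= j < n)%N ->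
  (forall i, (m <= i < n)%N -> 0 <= f i) -> f j <= \rsum_(m <= i < n) f i.
Proof.
move=> Hj H; apply: (Rle_trans _ (\rsum_(m <= i < n) (if i == j then f i else 0))).
  rewrite (@sum_single _ j) ?eqxx //; first lra.
  by move=> i _ /negbTE ->.
by apply: sum_le => i Hi; case: ifP => _; [lra | apply: H].
Qed.

Lemma cauchy_schwarz (a b : nat -> R) m n :
  (\rsum_(m <= i < n) (a i * b i)) ^ 2 <=
  (\rsum_(m <= i < n) (a i ^ 2)) * (\rsum_(m <= i < n) (b i ^ 2)).
Proof.
suff gen (r : seq nat) : 0 <= \big[Rplus/0]_(i <- r) (a i ^ 2) /\
    0 <= \big[Rplus/0]_(i <- r) (b i ^ 2) /\
    (\big[Rplus/0]_(i <- r) (a i * b i)) ^ 2 <=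
    (\big[Rplus/0]_(i <- r) (a i ^ 2)) * (\big[Rplus/0]_(i <- r) (b i ^ 2)).
  by case: (gen (index_iota m n)) => _ [].
elim: r => [|i r]; first by rewrite !big_nil; nra.
rewrite !big_cons.
move: (\big[_/_]_(j <- r) (a j * b j)) => S.
move: (\big[_/_]_(j <- r) (a j ^ 2)) => A.
move: (\big[_/_]_(j <- r) (b j ^ 2)) => B [hA [hB hS]].
move: (a i) (b i) => x y.
(* By AM-GM the right side is at least [2 |x y| sqrt (A B)]; comparing squares avoids the root. *)
have key : 2 * (x * y * S) <= A * y ^ 2 + B * x ^ 2.
  apply: (Rle_trans _ (Rabs (2 * (x * y * S)))); first exact: Rle_abs.
  rewrite -(Rabs_pos_eq (A * y ^ 2 + B * x ^ 2)); last by nra.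
  apply: Rsqr_le_abs_0; rewrite /Rsqr.
  have H1 := pow2_ge_0 (A * y ^ 2 - B * x ^ 2).
  have H2 : (x * y) ^ 2 * S ^ 2 <= (x * y) ^ 2 * (A * B).
    by apply: Rmult_le_compat_l => //; apply: pow2_ge_0.
  nra.
by split; [nra | split; nra].
Qed.

Lemma sum_sq_le (a : nat -> R) (k : nat) :
  (\rsum_(0 <= i < k) a i) ^ 2 <= INR k * \rsum_(0 <= i < k) (a i ^ 2).
Proof.
have := cauchy_schwarz (fun=> 1) a 0 k; rewrite sum_const subn0.
have -> : \rsum_(0 <= i < k) (1 * a i) = \rsum_(0 <= i < k) a i.
  by apply: eq_bigr => i _; lra.
lra.
Qed.

Lemma INR_ge1 k : (0 < k)%N -> 1 <= INR k.
Proof. by move=> H; apply: (le_INR 1); apply/leP. Qed.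

Lemma leq_INR m k : (m <= k)%N -> INR m <= INR k.
Proof. by move=> H; apply: le_INR; apply/leP. Qed.

Lemma ln_le_sub1 x : 0 < x -> ln x <= x - 1.
Proof.
by move=> Hx; have := exp_ineq1_le (ln x); rewrite exp_ln //; lra.
Qed.

Lemma harmonic_le (n : nat) : (0 < n)%N -> \rsum_(1 <= i < n.+1) (/ INR i) <= 1 + ln (INR n).
Proof.
elim: n => // -[_ _|n IH _]; first by rewrite big_nat1 /= ln_1; lra.
rewrite big_nat_recr //=; have {}IH := IH isT.
have H1 := INR_ge1 (isT : (0 < n.+1)%N).
have := @ln_le_sub1 (INR n.+1 / INR n.+2) ltac:(by apply: Rdiv_lt_0_compat; rewrite ?S_INR; rewrite S_INR in H1; lra).
rewrite ln_div; [|lra|rewrite S_INR; lra].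
have -> : INR n.+1 / INR n.+2 - 1 = - / INR n.+2 by rewrite (S_INR n.+1); field; lra.
move=> H2; move: IH; rewrite -/(INR n.+2) -/(INR n.+1). lra.
Qed.

(** * Kusmin-Landau inequality *)

(** Summation by parts against increasing weights: the variation of [c] and its boundary values are
    governed by the last weight. Being stated with differences of [s], it serves both for the
    cotangent identity below and for sums, where [s] is minus the partial sum. *)
Lemma abel_monotone (c s : nat -> R) (Q : R) (A B : nat) :
  (forall m, (A <= m < B)%N -> 0 <= c m) ->
  (forall m, (A <= m)%N -> (m.+1 < B)%N -> c m <= c m.+1) ->
  (forall m, (A <= m <= B)%N -> Rabs (s m) <= Q) ->
  (A < B)%N ->
  Rabs (\rsum_(A <= m < B) (c m * (s m - s m.+1))) <= 2 * c B.-1 * Q.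
Proof.
move=> c0 cinc sQ ltAB.
(* With the boundary term added, the sum is [c A * s A] plus increments of [c] times values of [s];
   these nonnegative coefficients add up to [c (A + k)]. *)
suff main k : (A + k < B)%N ->
    Rabs (\rsum_(A <= m < (A + k).+1) (c m * (s m - s m.+1)) + c (A + k)%N * s (A + k).+1)
    <= c (A + k)%N * Q.
  have := main (B.-1 - A)%N; rewrite (_ : (A + (B.-1 - A) = B.-1)%N); last by lia.
  rewrite (_ : B.-1.+1 = B); last by lia.
  move=> /(_ ltac:(lia)) H.
  have cB : 0 <= c B.-1 by apply: c0; lia.
  have sB : Rabs (s B) <= Q by apply: sQ; lia.
  have H2 : Rabs (c B.-1 * s B) <= c B.-1 * Q.
    by rewrite Rabs_mult (Rabs_pos_eq (c _)) //; apply: Rmult_le_compat_l.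
  have -> : \rsum_(A <= m < B) (c m * (s m - s m.+1)) =
    (\rsum_(A <= m < B) (c m * (s m - s m.+1)) + c B.-1 * s B) + - (c B.-1 * s B) by lra.
  apply: Rle_trans (Rabs_triang _ _) _; rewrite Rabs_Ropp; lra.
elim: k => [|k IH] Hk.
  rewrite addn0 big_nat1 (_ : _ + _ = c A * s A); last by lra.
  rewrite Rabs_mult Rabs_pos_eq; last by apply: c0; lia.
  by apply: Rmult_le_compat_l; [apply: c0; lia | apply: sQ; lia].
rewrite addnS big_nat_recr /=; last by lia.
have {}IH := IH ltac:(lia).
have cc : 0 <= c (A + k).+1 - c (A + k)%N.
  by have := cinc (A + k)%N ltac:(lia) ltac:(lia); lra.
have H2 : Rabs ((c (A + k).+1 - c (A + k)%N) * s (A + k).+1) <=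
    (c (A + k).+1 - c (A + k)%N) * Q.
  rewrite Rabs_mult (Rabs_pos_eq (_ - _)) //.
  by apply: Rmult_le_compat_l => //; apply: sQ; lia.
set S := \rsum_(_ <= _ < _) _ in IH *.
rewrite (_ : _ + _ = (S + c (A + k)%N * s (A + k).+1) +
  (c (A + k).+1 - c (A + k)%N) * s (A + k).+1); last by lra.
apply: Rle_trans (Rabs_triang _ _) _; lra.
Qed.

Lemma x_cos_le_sin x : 0 <= x <= PI / 2 -> x * cos x <= sin x.
Proof.
move=> [x0 x1]; have [->|xn0] := Req_dec x 0; first by rewrite sin_0; lra.
have [c [H1 H2]] := MVT_cor2 (fun t => sin t - t * cos t) (fun t => t * sin t) 0 x ltac:(lra)
  ltac:(move=> t _; apply/is_derive_Reals; auto_derive => //; ring).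
have : 0 <= c * sin c by apply: Rmult_le_pos; [lra | apply: sin_ge_0; lra].
move: H1; rewrite sin_0; nra.
Qed.

Lemma cot_le_inv x : 0 < x <= PI / 2 -> cos x / sin x <= / x.
Proof.
move=> [x0 x1]; have s0 : 0 < sin x by apply: sin_gt_0; have := PI_RGT_0; lra.
have := x_cos_le_sin (conj (Rlt_le _ _ x0) x1) => H.
apply: (Rmult_le_reg_r (x * sin x)); first by nra.
by field_simplify; lra.
Qed.

Lemma cot_decr x y : 0 < x -> x <= y -> y <= PI / 2 -> cos y / sin y <= cos x / sin x.
Proof.
move=> x0 xy y1.
have P := PI_RGT_0.
have s0 : 0 < sin x by apply: sin_gt_0; lra.
have s1 : sin x <= sin y by apply: sin_incr_1; lra.
have c0 : 0 <= cos y by apply: cos_ge_0; lra.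
have c1 : cos y <= cos x by apply: cos_decr_1; lra.
apply: (Rmult_le_reg_r (sin x * sin y)); first by nra.
rewrite (_ : cos y / sin y * _ = cos y * sin x); last by field; lra.
rewrite (_ : cos x / sin x * _ = cos x * sin y); last by field; lra.
nra.
Qed.

(* Discrete Kusmin-Landau: with [delta = g m - g (m+1)],
   [cos (g m) = (cos (g m) - cos (g (m+1))) / 2 + cot (delta/2) (sin (g m) - sin (g (m+1))) / 2],
   and [cot (delta/2)] is monotone in [m]. *)
Lemma kusmin_landau (w al : R) (A B : nat) :
  0 < w -> (0 < A)%N -> w / (INR A * INR A) <= / 2 -> (A < B)%N ->
  Rabs (\rsum_(A <= m < B) cos (2 * PI * w / INR m + al)) <= 2 * INR B ^ 2 / w.
Proof.
move=> w0 A0 wA AB; have P := PI_RGT_0.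
pose g m := 2 * PI * w / INR m + al.
(* [d m] is half the decrement of the phase. The hypothesis on [w] keeps it at most [PI / 2], where
   the cotangent is nonnegative and decreasing. *)
pose d m := PI * w / (INR m * INR m.+1).
have Im m : (A <= m)%N -> 1 <= INR m by move=> H; apply: INR_ge1; lia.
have gd m : (A <= m)%N -> g m.+1 = g m - 2 * d m.
  by move=> /Im H; rewrite /g /d S_INR; field; lra.
have d0 m : (A <= m)%N -> 0 < d m.
  move=> /Im H; apply: Rdiv_lt_0_compat; first by nra.
  by rewrite S_INR; nra.
have dle m : (A <= m)%N -> d m <= PI / 2.
  move=> H; have mA := leq_INR H; have A1 := Im A (leqnn A).
  rewrite /d S_INR; apply: (Rle_trans _ (PI * (w / (INR A * INR A)))); last by nra.
  rewrite /Rdiv -Rmult_assoc; apply: Rmult_le_compat_l; first by nra.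
  by apply: Rinv_le_contravar; nra.
have ddec m : (A <= m)%N -> d m.+1 <= d m.
  move=> /Im H; rewrite /d !S_INR; apply: Rmult_le_compat_l; first by nra.
  by apply: Rinv_le_contravar; nra.
pose c m := cos (d m) / sin (d m).
have sd m : (A <= m)%N -> 0 < sin (d m).
  by move=> H; apply: sin_gt_0; [apply: d0 | have := dle m H; lra].
have gE m : (A <= m)%N -> cos (g m) = / 2 * (cos (g m) - cos (g m.+1)) +
    / 2 * (c m * (sin (g m) - sin (g m.+1))).
  move=> H; have Hs := sd m H; rewrite gd // /c.
  rewrite (_ : g m = (g m - d m) + d m); last by ring.
  rewrite (_ : g m - d m + d m - 2 * d m = (g m - d m) - d m); last by ring.
  move: (g m - d m) => t; rewrite cos_plus cos_minus sin_plus sin_minus.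
  by field; lra.
have c0 m : (A <= m)%N -> 0 <= c m.
  move=> H; apply: Rdiv_le_0_compat; last exact: sd.
  by apply: cos_ge_0; have := dle m H; have := d0 m H; lra.
rewrite (@eq_big_nat _ _ _ A B _ (fun m => / 2 * (cos (g m) - cos (g m.+1)) +
    / 2 * (c m * (sin (g m) - sin (g m.+1))))); last by move=> m /andP[H _]; apply: gE.
rewrite big_split -!big_distrr /=.
have H1 := @abel_monotone c (fun m => sin (g m)) 1 A B (fun m H => c0 m (proj1 (andP H)))
  (fun m H _ => cot_decr (d0 m.+1 (leqW H)) (ddec m H) (dle m H))
  (fun m _ => Rabs_le _ _ (SIN_bound _)) AB.
have H2 := @abel_monotone (fun=> 1) (fun m => cos (g m)) 1 A B (fun m H => Rle_0_1)
  (fun m H _ => Rle_refl 1)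
  (fun m _ => Rabs_le _ _ (COS_bound _)) AB.
move: H2; rewrite (eq_bigr (fun m => cos (g m) - cos (g m.+1))); last by move=> i _; ring.
move: H1; move: (\rsum_(_ <= _ < _) _) (\rsum_(_ <= _ < _) _) => S T H1 H2.
have Bp : (A <= B.-1)%N by lia.
have B1 := Im _ Bp.
have BS : INR B = INR B.-1 + 1 by rewrite -S_INR (_ : B.-1.+1 = B) //; lia.
have cB : c B.-1 <= INR B ^ 2 / w.
  apply: (Rle_trans _ (/ d B.-1)); first by apply: cot_le_inv; split; [exact: d0 | exact: dle].
  rewrite /d (_ : B.-1.+1 = B); last by lia.
  rewrite (_ : / (PI * w / (INR B.-1 * INR B)) = / PI * (INR B.-1 * INR B / w)); last first.
    by field; rewrite BS; repeat split; lra.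
  have PI1 : / PI <= 1 by rewrite -Rinv_1; apply: Rinv_le_contravar; have := PI2_1; lra.
  have : 0 <= INR B.-1 * INR B / w by apply: Rdiv_le_0_compat; nra.
  have : INR B.-1 * INR B / w <= INR B ^ 2 / w.
    apply: Rmult_le_compat_r; last by nra.
    by apply: Rlt_le; apply: Rinv_0_lt_compat.
  nra.
(* The telescoping cosine part contributes [1]; this absorbs it into the second copy of
   [B^2 / w]. *)
have wB : 1 <= INR B ^ 2 / w.
  apply: (Rmult_le_reg_r w) => //; rewrite (_ : INR B ^ 2 / w * w = INR B ^ 2); last by field; lra.
  have A1 := Im A (leqnn A).
  have AB' : INR A <= INR B by apply: leq_INR; lia.
  have : w <= INR A * INR A * / 2.
    apply: (Rmult_le_reg_r (/ (INR A * INR A))); first by apply: Rinv_0_lt_compat; nra.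
    by rewrite (_ : INR A * INR A * / 2 * _ = / 2); [exact: wA | field; lra].
  nra.
apply: Rle_trans (Rabs_triang _ _) _; rewrite !Rabs_mult (Rabs_pos_eq (/ 2)); last lra.
lra.
Qed.

Lemma ltn_INR m k : (m < k)%N -> INR m < INR k.
Proof. by move=> H; apply: lt_INR; apply/ltP. Qed.

Lemma INR_mul m k : INR (m * k)%N = INR m * INR k.
Proof. exact: mult_INR. Qed.

Lemma INR_add m k : INR (m + k)%N = INR m + INR k.
Proof. exact: plus_INR. Qed.

Lemma INR_expn a b : INR (a ^ b)%N = INR a ^ b.
Proof. by elim: b => [|b IH]; rewrite ?expn0 // expnS INR_mul IH. Qed.

(** The lower end [m > y / k1] supplies the derivative condition, the upper end [m <= N / k2] the
    size. Two multipliers occur because the conditions [y < m * k <= N] for [k = k1] and [k = k2]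
    intersect in this range. *)
Lemma kusmin_landau_window (w al : R) (k1 k2 y N M : nat) :
  0 < w -> (0 < k1 <= k2)%N -> w * INR k1 ^ 2 <= INR y ^ 2 / 2 ->
  Rabs (\rsum_(1 <= m < M.+1)
    (if (y < m * k1)%N && (m * k2 <= N)%N then cos (2 * PI * w / INR m + al) else 0)) <=
  8 * INR N ^ 2 / (w * INR k2 ^ 2).
Proof.
move=> w0 /andP[k10 k12] wy.
have k1p := INR_ge1 k10; have k2p := INR_ge1 (leq_trans k10 k12).
pose A := (y %/ k1).+1; pose B := (minn M (N %/ k2)).+1.
have rhs0 : 0 <= 8 * INR N ^ 2 / (w * INR k2 ^ 2).
  apply: Rdiv_le_0_compat; first by have := pow2_ge_0 (INR N); lra.
  by apply: Rmult_lt_0_compat => //; apply: pow_lt; lra.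
have -> : \rsum_(1 <= m < M.+1)
    (if (y < m * k1)%N && (m * k2 <= N)%N then cos (2 * PI * w / INR m + al) else 0) =
    \rsum_(A <= m < B) cos (2 * PI * w / INR m + al).
  rewrite -big_mkcond /= (@big_nat_widen _ _ _ A B M.+1); last by rewrite /B; lia.
  rewrite (@big_nat_widenl _ _ _ A 1 M.+1) //; apply: congr_big_nat => // m Hm.
  by rewrite /A /B ltnS leq_min -ltn_divLR // -leq_divRL ?(leq_trans k10) //; lia.
have [BA|AB] := leqP B A; first by rewrite big_geq // Rabs_R0.
have Ay : INR y <= INR A * INR k1.
  by rewrite -INR_mul; apply: leq_INR; apply: ltnW; rewrite -ltn_divLR.
have A1 : 1 <= INR A by apply: INR_ge1.
have y0 := pos_INR y.
apply: Rle_trans (kusmin_landau al w0 _ _ AB) _ => //.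
  apply: (Rmult_le_reg_r (INR A * INR A)); first by nra.
  rewrite (_ : w / _ * _ = w); last by field; lra.
  have H1 : INR y ^ 2 <= (INR A * INR k1) ^ 2 by apply: pow_incr.
  apply: (Rmult_le_reg_r (INR k1 ^ 2)); first by nra.
  by rewrite Rpow_mult_distr in H1; nra.
(* [B] is one more than the last index. The range being nonempty, [N %/ k2 >= 1], so the extra one
   at most doubles it; hence [8 = 2 * 2^2]. *)
have HB : INR B * INR k2 <= 2 * INR N.
  have : (B * k2 <= N + N)%N.
    have h1 : (N %/ k2 * k2 <= N)%N by apply: leq_divM.
    have h2 : (1 <= N %/ k2)%N.
      apply: leq_trans (leq_trans (AB : ((y %/ k1).+1 <= minn M (N %/ k2))%N) (geq_minr _ _)).
      by [].
    have h3 : (B <= (N %/ k2).+1)%N by rewrite /B ltnS geq_minr.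
    by clear -h1 h2 h3; move: h1 h2 h3; move: (N %/ k2)%N => q; nia.
  by move/leq_INR; rewrite INR_mul INR_add; lra.
have B0 := pos_INR B.
have HB2 : (INR B * INR k2) ^ 2 <= (2 * INR N) ^ 2 by apply: pow_incr; nra.
apply: (Rmult_le_reg_r (w * INR k2 ^ 2)).
  by apply: Rmult_lt_0_compat => //; apply: pow_lt; lra.
rewrite (_ : 2 * INR B ^ 2 / w * _ = 2 * (INR B * INR k2) ^ 2); last by field; lra.
rewrite (_ : 8 * _ / _ * _ = 8 * INR N ^ 2); last by field; lra.
nra.
Qed.

(** The window is part of the function, so that sums over products [m * k] can run over fixed
    ranges. *)
Definition osc (z al : R) (y N m : nat) : R :=
  if (y < m <= N)%N then cos (2 * PI * z / INR m + al) else 0.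

Lemma osc_out z al y N m : (N < m)%N -> osc z al y N m = 0.
Proof. by rewrite /osc => H; rewrite (leqNgt m) H andbF. Qed.

(** On multiples of [d] the phase is [(z / d) / m], and both multipliers of the window are [d]. *)
Lemma osc_line_sum z al (y N M d : nat) :
  0 < z -> (0 < d)%N -> z * INR d <= INR y ^ 2 / 2 ->
  Rabs (\rsum_(1 <= m < M.+1) osc z al y N (d * m)) <= 8 * INR N ^ 2 / (z * INR d).
Proof.
move=> z0 d0 zy; have d1 := INR_ge1 d0.
have := @kusmin_landau_window (z / INR d) al d d y N M
  (Rdiv_lt_0_compat _ _ z0 (Rlt_le_trans _ _ _ Rlt_0_1 d1)).
rewrite d0 leqnn (_ : z / INR d * INR d ^ 2 = z * INR d); last by field; lra.
move=> /(_ isT zy) H; apply: Rle_trans H; apply: Req_le; congr Rabs.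
apply: eq_big_nat => m /andP[m0 _]; rewrite /osc mulnC; case: ifP => // _.
congr (cos (_ + _)); rewrite INR_mul; have := INR_ge1 m0 => m1; field; lra.
Qed.

Lemma osc_line_log_sum z al (y N M d : nat) :
  0 < z -> (0 < d)%N -> z * INR d <= INR y ^ 2 / 2 -> (0 < M)%N ->
  Rabs (\rsum_(1 <= m < M.+1) (ln (INR m) * osc z al y N (d * m))) <=
  16 * ln (INR M) * INR N ^ 2 / (z * INR d).
Proof.
move=> z0 d0 zy M0.
pose s m := - \rsum_(1 <= i < m) osc z al y N (d * i).
pose Q := 8 * INR N ^ 2 / (z * INR d).
rewrite (@eq_big_nat _ _ _ 1 M.+1 _ (fun m => ln (INR m) * (s m - s m.+1))); last first.
  by move=> m /andP[m1 _]; rewrite /s big_nat_recr //=; congr (_ * _); lra.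
have H := @abel_monotone (fun m => ln (INR m)) s Q 1 M.+1.
apply: Rle_trans (H _ _ _ _) _ => //.
- by move=> m /andP[m1 _]; rewrite -ln_1; apply: ln_le; [lra | apply: INR_ge1].
- move=> m m1 _; apply: ln_le; first by have := INR_ge1 m1; lra.
  by apply: leq_INR.
- move=> [|m] // _; rewrite /s Rabs_Ropp; exact: osc_line_sum.
by rewrite /Q /= -/(INR M); apply: Req_le; field; have := INR_ge1 d0; lra.
Qed.

(** The copy shifted by a quarter period plays the part of the imaginary part: by the addition
    formula only the difference of the phases is left, and [al] cancels. *)
Lemma osc_pair (z al : R) (y N m k1 k2 : nat) :
  osc z al y N (m * k1) * osc z al y N (m * k2) +
  osc z (al - PI / 2) y N (m * k1) * osc z (al - PI / 2) y N (m * k2) =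
  if (y < m * k1 <= N)%N && (y < m * k2 <= N)%N
  then cos (2 * PI * z / INR (m * k1) - 2 * PI * z / INR (m * k2)) else 0.
Proof.
rewrite /osc; case: ifP => _ /=; last by lra.
case: ifP => _; last by lra.
have E t : cos (t + (al - PI / 2)) = sin (t + al).
  by rewrite (_ : t + (al - PI / 2) = - (PI / 2 - (t + al))) ?cos_neg ?cos_shift //; ring.
rewrite !E -[RHS](_ : cos ((2 * PI * z / INR (m * k1) + al) - (2 * PI * z / INR (m * k2) + al)) = _).
  by rewrite cos_minus.
by congr cos; ring.
Qed.

Definition pair_sum z y N M k1 k2 := \rsum_(1 <= m < M.+1)
  (if (y < m * k1 <= N)%N && (y < m * k2 <= N)%N
  then cos (2 * PI * z / INR (m * k1) - 2 * PI * z / INR (m * k2)) else 0).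

Lemma pair_sumC z y N M k1 k2 : pair_sum z y N M k1 k2 = pair_sum z y N M k2 k1.
Proof.
apply: eq_bigr => m _; rewrite andbC; case: ifP => // _.
by rewrite -cos_neg; congr cos; ring.
Qed.

Lemma pair_sum_le z y N M k1 k2 : Rabs (pair_sum z y N M k1 k2) <= INR M.
Proof.
apply: Rle_trans (sum_abs _ _ _) _.
rewrite -[X in _ <= X]Rmult_1_r; apply: sum1_le_const => m _.
case: ifP => _; last by rewrite Rabs_R0; lra.
by apply: Rabs_le; apply: COS_bound.
Qed.

(** The difference of the two phases is again of the form [w / m], with [w = z (k2 - k1) / (k1 k2)].
    Only the distance [k2 - k1] enters the derivative condition, which is what makes short blocks of
    [k] useful. *)
Lemma pair_sum_lt z y N M k1 k2 :
  0 < z -> (0 < k1 < k2)%N -> z * INR (k2 - k1) <= INR y ^ 2 / 2 ->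
  Rabs (pair_sum z y N M k1 k2) <= 8 * INR N ^ 2 / z / INR (k2 - k1).
Proof.
move=> z0 /andP[k10 k12] Hz.
have k1p := INR_ge1 k10; have k2p := INR_ge1 (ltn_trans k10 k12).
have Dp : 1 <= INR (k2 - k1) by apply: INR_ge1; lia.
have k12' : INR k1 < INR k2 by apply: ltn_INR.
pose w := z * INR (k2 - k1) / (INR k1 * INR k2).
have kk : 0 < INR k1 * INR k2 by nra.
have w0 : 0 < w by apply: Rdiv_lt_0_compat => //; nra.
have := @kusmin_landau_window w 0 k1 k2 y N M w0; rewrite k10 (ltnW k12) => /(_ isT) H.
have -> : pair_sum z y N M k1 k2 = \rsum_(1 <= m < M.+1)
    (if (y < m * k1)%N && (m * k2 <= N)%N then cos (2 * PI * w / INR m + 0) else 0).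
  apply: eq_big_nat => m /andP[m1 _].
  have -> : (y < m * k1 <= N)%N && (y < m * k2 <= N)%N = (y < m * k1)%N && (m * k2 <= N)%N by nia.
  case: ifP => // _; congr cos; have m1' := INR_ge1 m1.
  by rewrite /w !INR_mul minus_INR; [field; lra | apply/leP; apply: ltnW].
apply: Rle_trans (H _) _.
  have : w * INR k1 ^ 2 <= z * INR (k2 - k1).
    rewrite /w (_ : _ / _ * _ = z * INR (k2 - k1) * (INR k1 / INR k2)); last by field; lra.
    have : INR k1 / INR k2 <= 1 by apply Rle_div_l; lra.
    have : 0 < z * INR (k2 - k1) by nra.
    nra.
  lra.
rewrite (_ : 8 * INR N ^ 2 / (w * INR k2 ^ 2) =
  8 * INR N ^ 2 / z / INR (k2 - k1) * (INR k1 / INR k2)); last by rewrite /w; field; lra.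
have : INR k1 / INR k2 <= 1 by apply Rle_div_l; lra.
have : 0 <= 8 * INR N ^ 2 / z / INR (k2 - k1).
  by do 2 (apply: Rdiv_le_0_compat; last by lra); have := pow2_ge_0 (INR N); lra.
nra.
Qed.

(** * Bilinear sums *)

Lemma sum_shift_right (f : nat -> R) (k l : nat) :
  \rsum_(k.+1 <= i < l) f (i - k)%N = \rsum_(1 <= j < l - k) f j.
Proof.
rewrite -{1}(add1n k) big_addn; apply: eq_big_nat => i _.
by rewrite addnK.
Qed.

Lemma sum_shift_left (f : nat -> R) (k l : nat) :
  \rsum_(l <= i < k) f (k - i)%N = \rsum_(1 <= j < (k - l).+1) f j.
Proof.
have [lk|kl] := leqP k l; first by rewrite !big_geq //; lia.
rewrite big_nat_rev /= -{1}(add0n l) big_addn [RHS]big_add1 /=.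
by apply: eq_big_nat => i Hi; congr f; lia.
Qed.

(** The diagonal term is at most [M]. Every other [k'] lies within [D] of [k], and the bounds in
    [1 / |k - k'|] add up to a harmonic sum on each side. *)
Lemma pair_row_sum (z : R) (y N M k0 D k : nat) :
  0 < z -> (0 < k0)%N -> z * INR D <= INR y ^ 2 / 2 -> (k0 <= k < k0 + D)%N ->
  \rsum_(k0 <= k' < k0 + D) Rabs (pair_sum z y N M k k') <=
  INR M + 16 * INR N ^ 2 / z * (1 + ln (INR D)).
Proof.
move=> z0 k00 zD /andP[Hk1 Hk2].
pose X := 8 * INR N ^ 2 / z.
have X0 : 0 <= X by apply: Rdiv_le_0_compat => //; have := pow2_ge_0 (INR N); lra.
have half (l : nat) : (l <= D)%N -> \rsum_(1 <= j < l) (X / INR j) <= X * (1 + ln (INR D)).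
  move=> lD; rewrite -big_distrr /=; apply: Rmult_le_compat_l => //.
  apply: Rle_trans (@harmonic_le D _); last by lia.
  apply: sum_incl => //; first by lia.
  by move=> i /andP[i1 _]; apply: Rlt_le; apply: Rinv_0_lt_compat; have := INR_ge1 i1; lra.
have dist (i : nat) : (i <= D)%N -> z * INR i <= INR y ^ 2 / 2.
  by move/leq_INR => H; nra.
rewrite (big_cat_nat Hk1 (ltnW Hk2)) /= [X in _ + X]big_ltn //.
have H1 : \rsum_(k0 <= k' < k) Rabs (pair_sum z y N M k k') <= X * (1 + ln (INR D)).
  apply: (Rle_trans _ (\rsum_(k0 <= i < k) (X / INR (k - i)))).
    apply: sum_le => i /andP[i1 i2]; rewrite pair_sumC; apply: pair_sum_lt => //; first by lia.
    by apply: dist; lia.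
  by rewrite (sum_shift_left (fun j => X / INR j)); apply: half; lia.
have H2 : \rsum_(k.+1 <= k' < k0 + D) Rabs (pair_sum z y N M k k') <= X * (1 + ln (INR D)).
  apply: (Rle_trans _ (\rsum_(k.+1 <= i < k0 + D) (X / INR (i - k)))).
    apply: sum_le => i /andP[i1 i2]; apply: pair_sum_lt => //; first by lia.
    by apply: dist; lia.
  by rewrite (sum_shift_right (fun j => X / INR j)); apply: half; lia.
have H3 := pair_sum_le z y N M k k.
have -> : 16 * INR N ^ 2 / z = X + X by rewrite /X; field; lra.
move: H1 H2 H3; set a := \rsum_(_ <= _ < _) _; set b := \rsum_(_ <= _ < _) _; move=> H1 H2 H3.
lra.
Qed.

Lemma bilinear_block (z al : R) (y N M k0 D : nat) (b : nat -> R) :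
  0 < z -> (0 < k0)%N -> z * INR D <= INR y ^ 2 / 2 ->
  \rsum_(1 <= m < M.+1) ((\rsum_(k0 <= k < k0 + D) (b k * osc z al y N (m * k))) ^ 2) <=
  (\rsum_(k0 <= k < k0 + D) (b k ^ 2)) * (INR M + 16 * INR N ^ 2 / z * (1 + ln (INR D))).
Proof.
move=> z0 k00 zD.
set Q := INR M + _.
pose E k k' := pair_sum z y N M k k'.
apply: (Rle_trans _ (\rsum_(1 <= m < M.+1) (\rsum_(k0 <= k < k0 + D) \rsum_(k0 <= k' < k0 + D)
   (b k * b k' * (if (y < m * k <= N)%N && (y < m * k' <= N)%N
  then cos (2 * PI * z / INR (m * k) - 2 * PI * z / INR (m * k')) else 0))))).
  apply: sum_le => m _.
  set c := fun k => b k * osc z al y N (m * k).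
  set s := fun k => b k * osc z (al - PI / 2) y N (m * k).
  (* The square of the sine sum is added to make [osc_pair] applicable. *)
  apply: (Rle_trans _ ((\rsum_(k0 <= k < k0 + D) c k) ^ 2 + (\rsum_(k0 <= k < k0 + D) s k) ^ 2)).
    by rewrite -[X in X <= _]Rplus_0_r; apply: Rplus_le_compat_l; apply: pow2_ge_0.
  apply: Req_le; rewrite /= !Rmult_1_r !big_distrlr -big_split; apply: eq_bigr => k _.
  rewrite -big_split; apply: eq_bigr => k' _; rewrite -(osc_pair z al) /c /s /=; ring.
(* The inequality [|b k * b k'| <= (b k ^ 2 + b k' ^ 2) / 2] reduces the quadratic form to row sums
   of a symmetric matrix. *)
apply: (Rle_trans _ (\rsum_(k0 <= k < k0 + D) \rsum_(k0 <= k' < k0 + D)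
   ((b k ^ 2 + b k' ^ 2) / 2 * Rabs (E k k')))).
  rewrite exchange_big /=; apply: sum_le => k _; rewrite exchange_big /=; apply: sum_le => k' _.
  rewrite -big_distrr /= -/(pair_sum z y N M k k') -/(E k k').
  apply: Rle_trans (Rle_abs _) _; rewrite Rabs_mult; apply: Rmult_le_compat_r.
    exact: Rabs_pos.
  by apply: Rabs_le; have := pow2_ge_0 (b k - b k'); have := pow2_ge_0 (b k + b k'); split; nra.
have -> : \rsum_(k0 <= k < k0 + D) \rsum_(k0 <= k' < k0 + D)
   ((b k ^ 2 + b k' ^ 2) / 2 * Rabs (E k k')) =
   \rsum_(k0 <= k < k0 + D) (b k ^ 2 * \rsum_(k0 <= k' < k0 + D) Rabs (E k k')).
  transitivity (\rsum_(k0 <= k < k0 + D) \rsum_(k0 <= k' < k0 + D) (b k ^ 2 / 2 * Rabs (E k k'))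
    + \rsum_(k0 <= k < k0 + D) \rsum_(k0 <= k' < k0 + D) (b k' ^ 2 / 2 * Rabs (E k k'))).
    rewrite -big_split; apply: eq_bigr => k _; rewrite -big_split; apply: eq_bigr => k' _ /=.
    by field.
  rewrite [X in _ + X]exchange_big -big_split; apply: eq_bigr => k _ /=.
  rewrite [X in _ + X](eq_bigr (fun i => b k ^ 2 / 2 * Rabs (E k i))); last first.
    by move=> i _; rewrite /E pair_sumC.
  by rewrite -!big_distrr /=; field.
rewrite big_distrl /=; apply: sum_le => k Hk.
apply: Rmult_le_compat_l; first exact: pow2_ge_0.
exact: pair_row_sum.
Qed.

Lemma sum_blocks (f : nat -> R) (o J D : nat) :
  \rsum_(o <= k < o + J * D) f k =
  \rsum_(0 <= j < J) \rsum_(o + j * D <= k < o + j * D + D) f k.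
Proof.
elim: J => [|J IH]; first by rewrite mul0n addn0 !big_geq.
rewrite big_nat_recr //= -IH mulSn (addnC D) addnA.
by rewrite (big_cat_nat (n := o + J * D)) ?leq_addr.
Qed.

(* The [k]-range is cut into blocks of length [D], inside which two values of [k] are close enough
   for the Kusmin-Landau bound to apply to the inner sum over [m]. *)
Lemma bilinear_sum (z al : R) (y N M K D : nat) (a b : nat -> R) :
  0 < z -> (0 < D)%N -> z * INR D <= INR y ^ 2 / 2 ->
  (\rsum_(1 <= m < M.+1) \rsum_(K.+1 <= k < (2 * K).+1) (a m * b k * osc z al y N (m * k))) ^ 2 <=
  (\rsum_(1 <= m < M.+1) (a m ^ 2)) * (\rsum_(K.+1 <= k < (2 * K).+1) (b k ^ 2)) *
  (1 + INR K / INR D) * (INR M + 16 * INR N ^ 2 / z * (1 + ln (INR D))).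
Proof.
move=> z0 D0 zD.
set Q := INR M + _.
have D1 := INR_ge1 D0.
pose J := (K %/ D).+1.
have KJ : (K <= J * D)%N by rewrite /J; apply: ltnW; apply: ltn_ceil.
have JQ : INR J <= 1 + INR K / INR D.
  rewrite /J S_INR; have : INR (K %/ D) * INR D <= INR K.
    by rewrite -INR_mul; apply: leq_INR; apply: leq_divM.
  move=> H; have H' : INR (K %/ D) <= INR K / INR D by apply Rle_div_r; lra.
  lra.
(* The [J] blocks may run past [2 * K]; there the coefficients are set to [0]. *)
pose b' k := if (k <= 2 * K)%N then b k else 0.
have trunc (f : nat -> R) : \rsum_(K.+1 <= k < K.+1 + J * D) (if (k <= 2 * K)%N then f k else 0) =
    \rsum_(K.+1 <= k < (2 * K).+1) f k.
  rewrite -big_mkcond (@big_nat_widen _ _ _ K.+1 (2 * K).+1 (K.+1 + J * D)) //.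
  by lia.
have blocks (f : nat -> R) := sum_blocks f K.+1 J D.
pose V m j := \rsum_(K.+1 + j * D <= k < K.+1 + j * D + D) (b' k * osc z al y N (m * k)).
have -> : \rsum_(1 <= m < M.+1) \rsum_(K.+1 <= k < (2 * K).+1) (a m * b k * osc z al y N (m * k)) =
    \rsum_(1 <= m < M.+1) (a m * \rsum_(0 <= j < J) V m j).
  apply: eq_bigr => m _; rewrite -blocks big_distrr -trunc; apply: eq_bigr => k _ /=.
  by rewrite /b'; case: ifP => _; ring.
apply: Rle_trans (cauchy_schwarz _ _ _ _) _; rewrite !Rmult_assoc.
apply: Rmult_le_compat_l; first by apply: sum_ge0 => i _; apply: pow2_ge_0.
apply: (Rle_trans _ (INR J * \rsum_(1 <= m < M.+1) \rsum_(0 <= j < J) (V m j ^ 2))).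
  by rewrite big_distrr /=; apply: sum_le => m _; apply: sum_sq_le.
have S0 : 0 <= \rsum_(K.+1 <= k < (2 * K).+1) (b k ^ 2).
  by apply: sum_ge0 => i _; apply: pow2_ge_0.
have Q0 : 0 <= Q.
  rewrite /Q; have : 0 <= ln (INR D) by rewrite -ln_1; apply: ln_le; lra.
  have : 0 <= 16 * INR N ^ 2 / z.
    by apply: Rdiv_le_0_compat => //; have := pow2_ge_0 (INR N); lra.
  by have := pos_INR M; nra.
rewrite -Rmult_assoc (Rmult_comm _ (1 + _)) Rmult_assoc.
apply: Rmult_le_compat => //; first exact: pos_INR.
  by apply: sum_ge0 => m _; apply: sum_ge0 => j _; apply: pow2_ge_0.
rewrite exchange_big /= -trunc blocks big_distrl /=; apply: sum_le => j _.
apply: Rle_trans (@bilinear_block z al y N M _ D b' z0 _ zD) _; first by [].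
apply: Req_le; congr (_ * _); apply: eq_bigr => k _; rewrite /b'; case: ifP => // _.
by rewrite /=; ring.
Qed.

(** * Arithmetic functions *)

(** As [f] vanishes beyond [N], the quotient [r] may keep the full range [1..N]; later exchanges of
    summation then carry no side conditions. *)
Lemma sum_multiples (f : nat -> R) (b N : nat) :
  (0 < b)%N -> (forall k, (N < k)%N -> f k = 0) ->
  \rsum_(1 <= k < N.+1 | b %| k) f k = \rsum_(1 <= r < N.+1) f (b * r)%N.
Proof.
move=> b0 f0; rewrite big_mkcond /=.
transitivity (\rsum_(1 <= r < N.+1) \rsum_(1 <= k < N.+1) (if (k == b * r)%N then f k else 0)).
  rewrite exchange_big; apply: eq_big_nat => k /andP[k1 k2] /=.
  case: ifP => [/dvdnP[r kE]|bk]; last first.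
    rewrite big1 // => r _; case: eqP => // kE.
    by move: bk; rewrite kE dvdn_mulr.
  rewrite (@sum_single _ r) ?kE ?(mulnC r b) ?eqxx //; first by nia.
  by move=> i _ ir; rewrite eqn_pmul2l // eq_sym (negbTE ir).
apply: eq_big_nat => r /andP[r1 r2].
have [le|gt] := leqP (b * r) N.
  rewrite (@sum_single _ (b * r)%N) ?eqxx //; first by nia.
  by move=> i _ /negbTE ->.
rewrite f0 // big_nat big1 // => k Hk; case: eqP => // kE; move: Hk; lia.
Qed.

Lemma ln_ge0 x : 1 <= x -> 0 <= ln x.
Proof. by move=> H; rewrite -ln_1; apply: ln_le; lra. Qed.

Lemma ln_INR_le m n : (0 < m <= n)%N -> ln (INR m) <= ln (INR n).
Proof.
by move=> /andP[m0 mn]; apply: ln_le; [have := INR_ge1 m0; lra | apply: leq_INR].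
Qed.

Lemma ln_INR_ge0 m : 0 <= ln (INR m).
Proof.
case: m => [|m]; last by apply: ln_ge0; apply: INR_ge1.
by rewrite /ln; case: Rlt_dec => [H|_]; [case: (Rlt_irrefl 0 H) | lra].
Qed.

Lemma ln_INR_expn p e : (0 < p)%N -> ln (INR (p ^ e)) = INR e * ln (INR p).
Proof.
move=> p0; elim: e => [|e IH]; first by rewrite expn0 /= ln_1; ring.
rewrite expnS INR_mul ln_mult; first by rewrite IH (S_INR e); ring.
  by have := INR_ge1 p0; lra.
by apply: lt_0_INR; apply/ltP; rewrite expn_gt0 p0.
Qed.

Lemma ln_logn (m N : nat) : (0 < m <= N)%N ->
  ln (INR m) = \rsum_(1 <= p < N.+1 | prime p) (INR (logn p m) * ln (INR p)).
Proof.
move=> /andP[m0 mN].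
have main n : ln (INR (\prod_(1 <= p < n.+1) if prime p then p ^ logn p m else 1)%N) =
    \rsum_(1 <= p < n.+1) (if prime p then INR (logn p m) * ln (INR p) else 0) /\
    (0 < \prod_(1 <= p < n.+1) if prime p then p ^ logn p m else 1)%N.
  elim: n => [|n [IH1 IH2]]; first by rewrite big_geq // big_geq //= ln_1.
  rewrite (big_nat_recr n.+1) //= (big_nat_recr n.+1) //=; case: ifP => pp; last first.
    by rewrite muln1 Rplus_0_r.
  have pg : (0 < n.+1 ^ logn n.+1 m)%N by rewrite expn_gt0.
  split; last by rewrite muln_gt0 IH2 pg.
  rewrite INR_mul ln_mult; [| have := INR_ge1 IH2; lra | have := INR_ge1 pg; lra].
  by rewrite IH1 ln_INR_expn.
rewrite [RHS]big_mkcond -(proj1 (main N)); congr (ln (INR _)).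
rewrite -{1}(partnT m0) /partn.
have l0 : logn 0 m = 0%N by rewrite lognE.
rewrite big_ltn_cond // l0 expn0 mul1n (@big_nat_widen _ _ _ 1 m.+1 N.+1) //=.
rewrite [in LHS]big_mkcond; apply: eq_big_nat => p /andP[p1 _] /=.
rewrite ltnS; case: (leqP p m) => pm; case: ifP => pp //.
- by rewrite (lognE p m) pp.
- by rewrite ltn_log0.
Qed.

(** At most one pair satisfies [p ^ k = m]. As a sum over all pairs, the divisor sum is computed by
    exchanging sums, without having to recognise prime powers. *)
Definition mangoldt (m : nat) : R :=
  \rsum_(1 <= p < m.+1 | prime p) \rsum_(1 <= k < m.+1) (if (p ^ k == m)%N then ln (INR p) else 0).

Lemma mangoldt_widen m B : (0 < m <= B)%N -> mangoldt m =
  \rsum_(1 <= p < B.+1 | prime p) \rsum_(1 <= k < B.+1) (if (p ^ k == m)%N then ln (INR p) else 0).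
Proof.
move=> /andP[m0 mB]; rewrite /mangoldt (@big_nat_widen _ _ _ 1 m.+1 B.+1) //.
rewrite [in LHS]big_mkcond [in RHS]big_mkcond; apply: eq_big_nat => p /andP[p1 _] /=.
rewrite ltnS; case: (boolP (prime p)) => pp //=.
have pk k : (0 < k)%N -> (p ^ k)%N == m -> (p <= m)%N /\ (k <= m)%N.
  move=> k0 /eqP <-; split; last by apply: ltnW; apply: ltn_expl; apply: prime_gt1.
  by rewrite -{1}(expn1 p) leq_exp2l // prime_gt1.
case: ifP => pm; last first.
  by rewrite big_nat big1 // => k /andP[k1 _]; case: eqP => // /eqP /(pk k k1)[]; rewrite pm.
rewrite (@big_nat_widen _ _ _ 1 m.+1 B.+1) // big_mkcond; apply: eq_big_nat => k /andP[k1 _] /=.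
by rewrite ltnS; case: leqP => // km; case: eqP => // /eqP /(pk k k1)[_]; rewrite leqNgt km.
Qed.

Lemma mangoldt_ge0 m : 0 <= mangoldt m.
Proof.
rewrite /mangoldt big_mkcond; apply: sum_ge0 => p _; case: ifP => _; last lra.
by apply: sum_ge0 => k _; case: ifP => _; [exact: ln_INR_ge0 | lra].
Qed.

(** For a fixed prime [p], the exponents [k >= 1] with [p ^ k] dividing [m] number [logn p m], which
    leads back to the factorisation of [m]. *)
Lemma sum_mangoldt_dvd (m N : nat) : (0 < m <= N)%N ->
  \rsum_(1 <= d < N.+1 | d %| m) mangoldt d = ln (INR m).
Proof.
move=> mN; have /andP[m0 mN'] := mN; rewrite (ln_logn mN) big_mkcond /=.
transitivity (\rsum_(1 <= d < N.+1) \rsum_(1 <= p < N.+1 | prime p) \rsum_(1 <= k < N.+1)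
    (if (p ^ k == d)%N && (d %| m) then ln (INR p) else 0)).
  apply: eq_big_nat => d /andP[d1 d2]; rewrite (@mangoldt_widen d N) ?d1 //.
  case: ifP => dm; first by apply: eq_bigr => p _; apply: eq_bigr => k _; rewrite andbT.
  by rewrite big1 // => p _; rewrite big1 // => k _; rewrite andbF.
rewrite exchange_big; apply: eq_bigr => p pp /=; rewrite exchange_big /=.
transitivity (\rsum_(1 <= k < N.+1) (INR (p ^ k %| m)%N * ln (INR p))).
  apply: eq_big_nat => k /andP[k1 k2].
  have p1 := prime_gt1 pp.
  case: (boolP (p ^ k %| m)%N) => [pk|pk].
    rewrite (@sum_single _ (p ^ k)%N) ?eqxx ?pk /=; first by lra.
      by rewrite expn_gt0 (ltnW p1) ltnS (leq_trans _ mN') // dvdn_leq.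
    by move=> i _ /negbTE; rewrite eq_sym => ->.
  rewrite big1 /=; first by lra.
  by move=> d _; case: eqP => //= <-; rewrite (negbTE pk).
rewrite -big_distrl /=; congr (_ * _).
rewrite logn_count_dvd // (@big_cat_nat _ _ _ m) //=.
rewrite [X in _ + X](_ : _ = 0); last first.
  rewrite big_nat big1 // => k /andP[k1 _]; rewrite gtnNdvd //.
  by apply: leq_ltn_trans k1 _; apply: ltn_expl; apply: prime_gt1.
by rewrite Rplus_0_r; elim/big_rec2: _ => // i x y _ ->; rewrite plus_INR.
lia.
Qed.

Lemma mangoldt_le_ln m : mangoldt m <= ln (INR m).
Proof.
case: m => [|m]; first by rewrite /mangoldt big_geq //; apply: ln_INR_ge0.
rewrite -(@sum_mangoldt_dvd m.+1 m.+1) ?leqnn // big_mkcond big_nat_recr //= dvdnn.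
have : 0 <= \rsum_(1 <= i < m.+1) (if (i %| m.+1)%N then mangoldt i else 0).
  by apply: sum_ge0 => i _; case: ifP => _; [exact: mangoldt_ge0 | lra].
lra.
Qed.

(** * The Moebius function *)

Definition mobius_factor (e : nat) : R := match e with 0 => 1 | 1 => -1 | _ => 0 end.

Definition mobius (m : nat) : R :=
  \big[Rmult/1]_(1 <= q < m.+1 | prime q) mobius_factor (logn q m).

Lemma mobius_widen m B : (m <= B)%N ->
  mobius m = \big[Rmult/1]_(1 <= q < B.+1 | prime q) mobius_factor (logn q m).
Proof.
move=> mB; rewrite /mobius (@big_nat_widen _ _ _ 1 m.+1 B.+1) //.
rewrite [in LHS]big_mkcond [in RHS]big_mkcond; apply: eq_bigr => q _ /=.
by rewrite ltnS; case: (prime q) => //=; case: (leqP q m) => // qm; rewrite ltn_log0.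
Qed.

Lemma mobius1 : mobius 1 = 1.
Proof. by rewrite /mobius big_mkcond big_nat1. Qed.

Lemma mobius_abs m : Rabs (mobius m) <= 1.
Proof.
rewrite /mobius; apply: (big_ind (fun x => Rabs x <= 1)).
- by rewrite Rabs_R1; lra.
- move=> x y hx hy; rewrite Rabs_mult; have := Rabs_pos x; have := Rabs_pos y; nra.
- move=> q _; case: (logn q m) => [|[|e]] /=; rewrite ?Rabs_R1 ?Rabs_R0 ?Rabs_Ropp ?Rabs_R1; try lra.
Qed.

Lemma mobius_prime_mul p e : prime p -> (0 < e)%N ->
  mobius (p * e) = if (p %| e)%N then 0 else - mobius e.
Proof.
move=> pp e0; have p0 := prime_gt0 pp.
have eB : (e <= p * e)%N by rewrite leq_pmull.
rewrite (mobius_widen eB) /mobius.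
have pin : p \in index_iota 1 (p * e).+1 by rewrite mem_index_iota p0 ltnS leq_pmulr.
have uq : uniq (index_iota 1 (p * e).+1) by apply: iota_uniq.
rewrite big_mkcond [in RHS]big_mkcond (bigD1_seq p) //= [in RHS](bigD1_seq p) //= pp lognM // logn_prime // eqxx add1n.
rewrite (eq_bigr (fun q => if prime q then mobius_factor (logn q e) else 1)); last first.
  by move=> q qp; rewrite lognM // logn_prime // (negbTE qp).
case: ifP => pe.
  have : (0 < logn p e)%N by rewrite logn_gt0 mem_primes pp e0.
  by case: (logn p e) => // k _; rewrite /=; ring.
rewrite (_ : logn p e = 0%N) /=; first by ring.
by apply/eqP; rewrite eqn0Ngt logn_gt0 mem_primes pe !andbF.
Qed.

(** For the least prime factor [p] of [m], each divisor [d] prime to [p] cancels against [p * d],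
    and [mobius (p * d) = 0] when [p] divides [d]. *)
Lemma sum_mobius_dvd m N : (1 < m <= N)%N -> \rsum_(1 <= d < N.+1 | d %| m) mobius d = 0.
Proof.
move=> /andP[m1 mN]; pose p := pdiv m.
have pp : prime p by apply: pdiv_prime.
pose F d := if (d %| m)%N then mobius d else 0.
have F0 k : (N < k)%N -> F k = 0.
  by move=> Nk; rewrite /F gtnNdvd //; lia.
have := sum_multiples (prime_gt0 pp) F0; rewrite big_mkcond /= => H.
rewrite big_mkcond -/F.
transitivity (\rsum_(1 <= d < N.+1) (if (p %| d)%N then F d else 0) +
              \rsum_(1 <= d < N.+1) (if (p %| d)%N then 0 else F d)).
  by rewrite -big_split; apply: eq_bigr => d _ /=; rewrite /F; case: (p %| d)%N; case: (d %| m)%N; try lra.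
rewrite H -big_split /= big_nat big1 // => d /andP[d1 _].
rewrite {1}/F mobius_prime_mul //; case: (boolP (p %| d)%N) => pd.
  by case: ifP => _; lra.
rewrite /F Gauss_dvd; last by rewrite prime_coprime.
by rewrite pdiv_dvd /=; case: ifP => _; lra.
Qed.

(** * The divisor function and its mean square *)

Definition tau (m : nat) : R := \rsum_(1 <= d < m.+1 | d %| m) 1.

Lemma tau_widen m N : (0 < m <= N)%N -> tau m = \rsum_(1 <= d < N.+1) (if (d %| m)%N then 1 else 0).
Proof.
move=> /andP[m0 mN]; rewrite /tau (@big_nat_widen _ _ _ 1 m.+1 N.+1) // big_mkcond.
apply: eq_bigr => d _; rewrite ltnS; case: (leqP d m) => dm; first by rewrite andbT.
by rewrite gtnNdvd.
Qed.

Lemma tau_ge0 m : 0 <= tau m.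
Proof. by rewrite /tau big_mkcond; apply: sum_ge0 => d _; case: ifP => _; lra. Qed.

(** A divisor [c] of [d * r] is the product of [gcdn c d], which divides [d], and [c %/ gcdn c d],
    which divides [r]. *)
Lemma tau_mul_le d r : (0 < d)%N -> (0 < r)%N -> tau (d * r) <= tau d * tau r.
Proof.
move=> d0 r0; set N := (d * r)%N.
have dN : (0 < d <= N)%N by rewrite d0 leq_pmulr.
have rN : (0 < r <= N)%N by rewrite r0 leq_pmull.
rewrite (tau_widen dN) (tau_widen rN) (@tau_widen N N); last by rewrite leqnn muln_gt0 d0 r0.
rewrite big_distrlr /=.
pose P a b := (if (a %| d)%N then 1 else 0) * (if (b %| r)%N then 1 else 0).
have P0 a b : 0 <= P a b by rewrite /P; do 2 case: ifP => _; lra.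
apply: (Rle_trans _ (\rsum_(1 <= c < N.+1) \rsum_(1 <= a < N.+1) \rsum_(1 <= b < N.+1)
   (if (a * b == c)%N then P a b else 0))).
  apply: sum_le => c /andP[c1 c2].
  have h0 a b : 0 <= (if (a * b == c)%N then P a b else 0) by case: ifP => _; [exact: P0 | lra].
  case: ifP => cN; last by apply: sum_ge0 => a _; apply: sum_ge0 => b _.
  pose g := gcdn c d; pose h := (c %/ g)%N.
  have g0 : (0 < g)%N by rewrite gcdn_gt0 c1.
  have gh : (g * h = c)%N by rewrite mulnC divnK // dvdn_gcdl.
  have h0' : (0 < h)%N by move: c1; rewrite -gh muln_gt0 => /andP[].
  have hr : (h %| r)%N.
    pose d' := (d %/ g)%N.
    have gd' : (g * d' = d)%N by rewrite mulnC divnK // dvdn_gcdr.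
    have cop : coprime h d'.
      by rewrite /coprime -(eqn_pmul2l g0) muln1 muln_gcdr gh gd'.
    by move: cN; rewrite /N -gh -gd' -mulnA dvdn_pmul2l // Gauss_dvdr.
  have gd : (g %| d)%N by apply: dvdn_gcdr.
  have Hg : (1 <= g < N.+1)%N by rewrite g0 ltnS (leq_trans (dvdn_leq d0 gd)) //; case/andP: dN.
  have Hh : (1 <= h < N.+1)%N by rewrite h0' ltnS (leq_trans (dvdn_leq r0 hr)) //; case/andP: rN.
  apply: Rle_trans (sum_ge_term Hg _); last by move=> a _; apply: sum_ge0 => b _.
  apply: Rle_trans (sum_ge_term Hh _); last by move=> b _.
  by rewrite gh eqxx /P gd hr; lra.
rewrite exchange_big; apply: sum_le => a _; rewrite exchange_big; apply: sum_le => b _ /=.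
rewrite -/(P a b).
case: (boolP ((0 < a * b)%N && (a * b <= N)%N)) => ab.
  rewrite (@sum_single _ (a * b)%N) ?eqxx //; first by lra.
  by move=> i _; rewrite eq_sym => /negbTE ->.
rewrite big_nat big1 // => c /andP[c1 c2]; case: eqP => // E; move: ab.
by rewrite E c1 -ltnS c2.
Qed.

(** The logarithm is taken at a fixed [N], so that one bound serves all [X = N %/ d]. *)
Lemma sum_tau_le N X : (0 < N)%N -> (X <= N)%N ->
  \rsum_(1 <= k < X.+1) tau k <= INR X * (1 + ln (INR N)).
Proof.
move=> N0 XN.
rewrite (@eq_big_nat _ _ _ _ _ _ (fun k => \rsum_(1 <= d < X.+1) (if (d %| k)%N then 1 else 0)));
  last by move=> k /andP[k1 k2]; apply: tau_widen; rewrite k1.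
rewrite exchange_big /=.
apply: (Rle_trans _ (\rsum_(1 <= d < X.+1) (INR X * / INR d))).
  apply: sum_le => d /andP[d1 d2]; have d1' := INR_ge1 d1.
  have := @sum_multiples (fun k => if (k <= X)%N then 1 else 0) d X d1.
  move=> /(_ ltac:(by move=> k; rewrite ltnNge => /negbTE ->)).
  rewrite big_mkcond (@eq_big_nat _ _ _ _ _ _ (fun k => if (d %| k)%N then 1 else 0)); last first.
    by move=> k /andP[_ k2]; rewrite -ltnS k2.
  move=> ->; rewrite (@big_cat_nat _ _ _ (X %/ d).+1) //=; last by rewrite ltnS leq_div.
  rewrite [X in _ + X](_ : _ = 0); last first.
    by rewrite big_nat big1 // => r /andP[r1 _]; rewrite mulnC -leq_divRL // leqNgt r1.
  rewrite Rplus_0_r; apply: (Rle_trans _ (INR (X %/ d))).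
    rewrite -[X in _ <= X]Rmult_1_r.
    by apply: sum1_le_const => i _; case: ifP => _; lra.
  have : INR (X %/ d) * INR d <= INR X by rewrite -INR_mul; apply: leq_INR; apply: leq_divM.
  move=> H; apply: (Rmult_le_reg_r (INR d)); first lra.
  by rewrite Rmult_assoc Rinv_l; lra.
rewrite -big_distrr /=; apply: Rmult_le_compat_l; first exact: pos_INR.
apply: Rle_trans (harmonic_le N0); apply: sum_incl => // i /andP[i1 _].
by apply: Rlt_le; apply: Rinv_0_lt_compat; have := INR_ge1 i1; lra.
Qed.

(** [tau k ^ 2] is the sum of [tau (d * r)] over the factorisations [k = d * r], and
    [tau (d * r) <= tau d * tau r]. The sum over [r] costs one logarithm, and the sum of [tau d / d]
    is at most the square of the harmonic sum. *)
Lemma sum_tau_sq_le N : (0 < N)%N ->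
  \rsum_(1 <= k < N.+1) (tau k ^ 2) <= INR N * (1 + ln (INR N)) ^ 3.
Proof.
move=> N0; set H := 1 + ln (INR N).
have H0 : 1 <= H by rewrite /H; have := ln_INR_ge0 N; lra.
have div_le d X : (0 < d)%N -> INR (X %/ d) <= INR X * / INR d.
  move=> d0; have d1 := INR_ge1 d0.
  have Hd : INR (X %/ d) * INR d <= INR X by rewrite -INR_mul; apply: leq_INR; apply: leq_divM.
  apply: (Rmult_le_reg_r (INR d)); first lra.
  by rewrite Rmult_assoc Rinv_l; lra.
apply: (Rle_trans _ (\rsum_(1 <= d < N.+1) \rsum_(1 <= r < N.+1)
    (if (d * r <= N)%N then tau (d * r) else 0))).
  apply: Req_le.
  transitivity (\rsum_(1 <= k < N.+1) \rsum_(1 <= d < N.+1) (if (d %| k)%N then tau k else 0)).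
    apply: eq_big_nat => k /andP[k1 k2]; rewrite /= Rmult_1_r {1}(@tau_widen k N) ?k1 // big_distrl.
    by apply: eq_bigr => d _ /=; case: ifP => _; ring.
  rewrite exchange_big; apply: eq_big_nat => d /andP[d1 _] /=.
  rewrite -(@sum_multiples (fun k => if (k <= N)%N then tau k else 0)) //; last first.
    by move=> k; rewrite ltnNge => /negbTE ->.
  by rewrite [in RHS]big_mkcond; apply: eq_big_nat => k /andP[_ k2]; rewrite -ltnS k2.
apply: (Rle_trans _ (\rsum_(1 <= d < N.+1) (tau d * / INR d * (INR N * H)))).
  apply: sum_le => d /andP[d1 d2]; have d1' := INR_ge1 d1.
  rewrite (@big_cat_nat _ _ _ (N %/ d).+1) //=; last by rewrite ltnS leq_div.
  rewrite [X in _ + X](_ : _ = 0); last first.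
    by rewrite big_nat big1 // => r /andP[r1 _]; rewrite mulnC -leq_divRL // leqNgt r1.
  rewrite Rplus_0_r; apply: (Rle_trans _ (\rsum_(1 <= r < (N %/ d).+1) (tau d * tau r))).
    apply: sum_le => r /andP[r1 r2]; case: ifP => _; first exact: tau_mul_le.
    by apply: Rmult_le_pos; apply: tau_ge0.
  rewrite -big_distrr /= Rmult_assoc; apply: Rmult_le_compat_l; first exact: tau_ge0.
  apply: Rle_trans (@sum_tau_le N _ N0 _) _; first by apply: leq_div.
  rewrite -/H -Rmult_assoc (Rmult_comm (/ _)); apply: Rmult_le_compat_r; first lra.
  exact: div_le.
rewrite -big_distrl /= (_ : INR N * (H * (H * (H * 1))) = H ^ 2 * (INR N * H)); last by ring.
apply: Rmult_le_compat_r; first by have := pos_INR N; nra.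
apply: (Rle_trans _ (\rsum_(1 <= d < N.+1) \rsum_(1 <= e < N.+1) (/ INR d * / INR e))).
  apply: (Rle_trans _ (\rsum_(1 <= d < N.+1) \rsum_(1 <= e < N.+1) (if (e %| d)%N then / INR d else 0))).
    apply: Req_le; apply: eq_big_nat => d /andP[d1 d2].
    rewrite (@tau_widen d N) ?d1 // big_distrl; apply: eq_bigr => e _ /=; case: ifP => _; ring.
  rewrite exchange_big /=; apply: sum_le => e /andP[e1 _].
  have e1' := INR_ge1 e1.
  pose f k := if (k <= N)%N then / INR k else 0.
  have := @sum_multiples f e N e1.
  move=> /(_ ltac:(by move=> k; rewrite /f ltnNge => /negbTE ->)).
  rewrite big_mkcond (@eq_big_nat _ _ _ _ _ _ (fun k => if (e %| k)%N then / INR k else 0)); last first.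
    by move=> k /andP[_ k2]; rewrite /f -ltnS k2.
  move=> ->; apply: sum_le => r /andP[r1 _]; have r1' := INR_ge1 r1.
  rewrite /f; case: ifP => _; first by rewrite INR_mul Rinv_mult; lra.
  by apply: Rmult_le_pos; apply: Rlt_le; apply: Rinv_0_lt_compat; lra.
rewrite -big_distrlr /=.
have := harmonic_le N0; rewrite -/H.
have : 0 <= \rsum_(1 <= i < N.+1) / INR i.
  by apply: sum_ge0 => i /andP[i1 _]; apply: Rlt_le; apply: Rinv_0_lt_compat; have := INR_ge1 i1; lra.
by nra.
Qed.

(** * Vaughan's identity *)

Definition mobius_upto (U b : nat) : R := if (b <= U)%N then mobius b else 0.
Definition mangoldt_above (V l : nat) : R := if (V < l)%N then mangoldt l else 0.
Definition mangoldt_upto (V l : nat) : R := if (l <= V)%N then mangoldt l else 0.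

(** The convolution of the truncated Moebius function with [1]: it is [1] at [1] and vanishes on
    [1 < k <= U], where the truncation is not felt. *)
Definition vaughan_beta (U N k : nat) : R :=
  \rsum_(1 <= b < N.+1 | b %| k) mobius_upto U b.

Definition vaughan_coef (U V N d : nat) : R :=
  \rsum_(1 <= b < N.+1) \rsum_(1 <= l < N.+1)
    (if (b * l == d)%N then mobius_upto U b * mangoldt_upto V l else 0).

Lemma mobius_upto_abs U b : Rabs (mobius_upto U b) <= 1.
Proof. by rewrite /mobius_upto; case: ifP => _; [exact: mobius_abs | rewrite Rabs_R0; lra]. Qed.

Lemma vaughan_beta_abs U N k : (0 < k <= N)%N -> Rabs (vaughan_beta U N k) <= tau k.
Proof.
move=> kN; rewrite (tau_widen kN) /vaughan_beta big_mkcond.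
apply: Rle_trans (sum_abs _ _ _) _; apply: sum_le => b _.
by case: ifP => _; [exact: mobius_upto_abs | rewrite Rabs_R0; lra].
Qed.

Lemma vaughan_beta_one U N : (0 < U)%N -> (0 < N)%N -> vaughan_beta U N 1 = 1.
Proof.
move=> U0 N0; rewrite /vaughan_beta big_mkcond (@sum_single _ 1) //=.
  by rewrite /mobius_upto U0 mobius1.
by move=> b _; rewrite dvdn1 => /negbTE ->.
Qed.

Lemma vaughan_beta_small U N k : (1 < k <= U)%N -> (k <= N)%N -> vaughan_beta U N k = 0.
Proof.
move=> /andP[k1 kU] kN; rewrite -(@sum_mobius_dvd k N) ?k1 // /vaughan_beta.
rewrite [in LHS]big_mkcond [in RHS]big_mkcond; apply: eq_bigr => b _ /=.
case: ifP => // bk; rewrite /mobius_upto (leq_trans _ kU) // dvdn_leq //; lia.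
Qed.

(** Bounding the Moebius factor by [1] leaves at most the sum of [mangoldt l] over the divisors [l]
    of [d]. *)
Lemma vaughan_coef_abs U V N d : (0 < d <= N)%N -> Rabs (vaughan_coef U V N d) <= ln (INR d).
Proof.
move=> dN; rewrite -(sum_mangoldt_dvd dN) big_mkcond /vaughan_coef exchange_big /=.
apply: Rle_trans (sum_abs _ _ _) _; apply: sum_le => l /andP[l1 _].
apply: Rle_trans (sum_abs _ _ _) _.
have M0 := mangoldt_ge0 l.
case: ifP => [/dvdnP[b dE]|ld]; last first.
  rewrite big1; first lra.
  by move=> b _; case: eqP => [E|_]; [move: ld; rewrite -E dvdn_mull | rewrite Rabs_R0].
have bN : (1 <= b < N.+1)%N by move: dN; rewrite dE; nia.
rewrite (@sum_single _ b) //.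
  rewrite dE eqxx Rabs_mult /mangoldt_upto.
  have := mobius_upto_abs U b; have := Rabs_pos (mobius_upto U b).
  by case: ifP => _; [rewrite (Rabs_pos_eq (mangoldt l)) // | rewrite Rabs_R0]; nra.
by move=> i _ ib; rewrite dE eqn_pmul2r // (negbTE ib) Rabs_R0.
Qed.

Lemma vaughan_coef_large U V N d : (U * V < d)%N -> vaughan_coef U V N d = 0.
Proof.
move=> UVd; rewrite /vaughan_coef big1 // => b _; rewrite big1 // => l _.
case: eqP => // E; rewrite /mobius_upto /mangoldt_upto.
case: (leqP b U) => bU; case: (leqP l V) => lV; try lra.
by move: UVd; rewrite -E ltnNge leq_mul.
Qed.

(** All terms are evaluations of one triple sum over [b * r * l] with [b <= U], after splitting
    [mangoldt] at [V]. Since [F] vanishes up to [V], the usual term with the primes up to [V] is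
    absent. *)
Lemma vaughan_identity (F : nat -> R) (U V N : nat) :
  (0 < U)%N -> (0 < N)%N ->
  (forall m, (N < m)%N -> F m = 0) -> (forall m, (m <= V)%N -> F m = 0) ->
  \rsum_(1 <= l < N.+1) (mangoldt l * F l) =
  \rsum_(1 <= b < N.+1) (mobius_upto U b * \rsum_(1 <= s < N.+1) (ln (INR s) * F (b * s)%N))
  - \rsum_(1 <= d < N.+1) (vaughan_coef U V N d * \rsum_(1 <= r < N.+1) F (d * r)%N)
  - \rsum_(U.+1 <= k < N.+1) \rsum_(1 <= l < N.+1)
      (mangoldt_above V l * vaughan_beta U N k * F (l * k)%N).
Proof.
move=> U0 N0 FN FV.
have FN' b c m : (0 < b)%N -> (0 < c)%N -> (N < m)%N -> F (b * m * c)%N = 0.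
  by move=> b0 c0 mN; apply: FN; rewrite (leq_trans mN) // -mulnA mulnCA leq_pmulr // muln_gt0 b0.
pose W b l := \rsum_(1 <= r < N.+1) F (b * r * l)%N.
(* Collecting [k = b * r] produces [vaughan_beta]: [k = 1] returns the sum over prime powers, as [F]
   vanishes up to [V], and [1 < k <= U] contributes nothing. *)
have total : \rsum_(1 <= l < N.+1) (mangoldt l * F l) +
    \rsum_(U.+1 <= k < N.+1) \rsum_(1 <= l < N.+1)
      (mangoldt_above V l * vaughan_beta U N k * F (l * k)%N) =
    \rsum_(1 <= b < N.+1) \rsum_(1 <= l < N.+1) (mobius_upto U b * mangoldt_above V l * W b l).
  transitivity (\rsum_(1 <= k < N.+1) \rsum_(1 <= l < N.+1)
      (mangoldt_above V l * vaughan_beta U N k * F (l * k)%N)).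
    have head1 : \rsum_(1 <= l < N.+1) (mangoldt l * F l) =
        \rsum_(1 <= l < N.+1) (mangoldt_above V l * vaughan_beta U N 1 * F (l * 1)%N).
      apply: eq_bigr => l _; rewrite vaughan_beta_one // muln1 /mangoldt_above.
      by case: leqP => [lV|_]; [rewrite FV //; lra | lra].
    rewrite head1 [in RHS](@big_ltn _ _ _ 1) //=; congr (_ + _).
    have [UN|NU] := leqP U N; last first.
      rewrite big_geq ?(leqW NU) // big_nat big1 // => k /andP[k1 k2]; rewrite big1 // => l _.
      by rewrite vaughan_beta_small; [lra | lia | lia].
    rewrite [RHS](@big_cat_nat _ _ _ U.+1) //= [X in _ = X + _](_ : _ = 0); first by lra.
    rewrite big_nat big1 // => k /andP[k1 k2]; rewrite big1 // => l _.
    by rewrite vaughan_beta_small; [lra | lia | lia].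
  rewrite exchange_big [RHS]exchange_big; apply: eq_big_nat => l /andP[l1 l2] /=.
  transitivity (mangoldt_above V l * \rsum_(1 <= b < N.+1) (mobius_upto U b * W b l)); last first.
    by rewrite big_distrr; apply: eq_bigr => b _ /=; ring.
  transitivity (mangoldt_above V l * \rsum_(1 <= k < N.+1) (vaughan_beta U N k * F (l * k)%N)).
    by rewrite big_distrr; apply: eq_bigr => b _ /=; ring.
  congr (_ * _).
  transitivity (\rsum_(1 <= k < N.+1) \rsum_(1 <= b < N.+1)
      (if (b %| k)%N then mobius_upto U b * F (l * k)%N else 0)).
    apply: eq_bigr => k _; rewrite /vaughan_beta big_mkcond big_distrl.
    by apply: eq_bigr => b _ /=; case: ifP => _; ring.
  rewrite exchange_big; apply: eq_big_nat => b /andP[b1 b2] /=.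
  rewrite -big_mkcond /= (@sum_multiples (fun k => mobius_upto U b * F (l * k)%N)) //.
    by rewrite -big_distrr /=; congr (_ * _); apply: eq_bigr => r _; rewrite mulnC.
  by move=> k kN; rewrite FN; [ring | rewrite (leq_trans kN) // leq_pmull].
(* Collecting [s = r * l] turns the divisor sum of [mangoldt] into [ln s]. *)
have full : \rsum_(1 <= b < N.+1) (mobius_upto U b * \rsum_(1 <= s < N.+1) (ln (INR s) * F (b * s)%N))
    = \rsum_(1 <= b < N.+1) \rsum_(1 <= l < N.+1) (mobius_upto U b * mangoldt l * W b l).
  apply: eq_big_nat => b /andP[b1 _].
  transitivity (mobius_upto U b * \rsum_(1 <= l < N.+1) (mangoldt l * W b l)); last first.
    by rewrite big_distrr; apply: eq_bigr => l _ /=; ring.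
  congr (_ * _).
  transitivity (\rsum_(1 <= s < N.+1) \rsum_(1 <= l < N.+1)
     (if (l %| s)%N then mangoldt l * F (b * s)%N else 0)).
    apply: eq_big_nat => s /andP[s1 s2]; rewrite -(@sum_mangoldt_dvd s N) ?s1 //.
    by rewrite big_mkcond big_distrl; apply: eq_bigr => l _ /=; case: ifP => _; ring.
  rewrite exchange_big; apply: eq_big_nat => l /andP[l1 l2] /=.
  rewrite -big_mkcond /= (@sum_multiples (fun s => mangoldt l * F (b * s)%N)) //.
    rewrite -big_distrr /=; congr (_ * _); apply: eq_bigr => r _.
    by rewrite (mulnC l) mulnA.
  by move=> k kN; rewrite FN; [ring | rewrite (leq_trans kN) // leq_pmull].
have coef : \rsum_(1 <= d < N.+1) (vaughan_coef U V N d * \rsum_(1 <= r < N.+1) F (d * r)%N)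
    = \rsum_(1 <= b < N.+1) \rsum_(1 <= l < N.+1) (mobius_upto U b * mangoldt_upto V l * W b l).
  transitivity (\rsum_(1 <= d < N.+1) \rsum_(1 <= b < N.+1) \rsum_(1 <= l < N.+1)
     (if (b * l == d)%N then mobius_upto U b * mangoldt_upto V l *
       \rsum_(1 <= r < N.+1) F (d * r)%N else 0)).
    apply: eq_bigr => d _; rewrite /vaughan_coef big_distrl; apply: eq_bigr => b _ /=.
    rewrite big_distrl; apply: eq_bigr => l _ /=; case: ifP => _; ring.
  rewrite exchange_big; apply: eq_big_nat => b /andP[b1 b2] /=.
  rewrite exchange_big; apply: eq_big_nat => l /andP[l1 l2] /=.
  have WE : W b l = \rsum_(1 <= r < N.+1) F (b * l * r)%N.
    by apply: eq_bigr => r _; rewrite mulnAC.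
  have [le|gt] := leqP (b * l) N.
    rewrite (@sum_single _ (b * l)%N) ?eqxx ?WE //; first by rewrite muln_gt0 b1 l1.
    by move=> i _; rewrite eq_sym => /negbTE ->.
  rewrite big_nat big1; last first.
    by move=> d /andP[d1 d2]; case: eqP => // E; move: gt; rewrite E; lia.
  rewrite WE big_nat big1; first by ring.
  by move=> r /andP[r1 _]; apply: FN; rewrite (leq_trans gt) // leq_pmulr.
have split : \rsum_(1 <= b < N.+1) \rsum_(1 <= l < N.+1) (mobius_upto U b * mangoldt l * W b l) =
    \rsum_(1 <= b < N.+1) \rsum_(1 <= l < N.+1) (mobius_upto U b * mangoldt_upto V l * W b l) +
    \rsum_(1 <= b < N.+1) \rsum_(1 <= l < N.+1) (mobius_upto U b * mangoldt_above V l * W b l).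
  rewrite -big_split; apply: eq_bigr => b _; rewrite -big_split; apply: eq_bigr => l _ /=.
  by rewrite /mangoldt_above /mangoldt_upto leqNgt; case: ltnP => _ /=; ring.
rewrite full coef split -total; lra.
Qed.

(** * Exponential sums over primes *)

(** One dyadic range of [k], with block length [D] of order [y^2 / z]. Up to constants, the last
    factor is the product [(1 + K/D) (y/K + y^2 el / z)] multiplied out and divided by [y]. *)
Lemma bilinear_piece (z al el : R) (y N K D : nat) (a b : nat -> R) (alpha beta : R) :
  0 < z -> (0 < D)%N -> (0 < K)%N -> (0 < y)%N -> (N <= 2 * y)%N -> 1 <= el ->
  z * INR D <= INR y ^ 2 / 2 -> INR y ^ 2 <= 4 * z * INR D -> 1 + ln (INR D) <= el ->
  (forall m, (0 < m <= N)%N -> a m ^ 2 <= alpha) ->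
  0 <= alpha -> 0 <= beta ->
  \rsum_(K.+1 <= k < (2 * K).+1) (b k ^ 2) <= INR K * beta ->
  (\rsum_(K.+1 <= k < (2 * K).+1) \rsum_(1 <= m < N.+1) (a m * b k * osc z al y N (m * k))) ^ 2 <=
  512 * INR y ^ 2 * (alpha * beta) *
    (/ INR K + z / INR y ^ 2 + INR y * el / z + INR K * el / INR y).
Proof.
move=> z0 D0 K0 y0 Ny el1 zD yD lnD Ha al0 be0 Hb.
have D1 := INR_ge1 D0; have K1 := INR_ge1 K0; have y1 := INR_ge1 y0.
have Ny' : INR N <= 2 * INR y by have := leq_INR Ny; rewrite INR_mul.
have N0 := pos_INR N.
pose M := (N %/ K)%N.
have MN : INR M <= INR N / INR K.
  have H : INR M * INR K <= INR N by rewrite -INR_mul; apply: leq_INR; apply: leq_divM.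
  by apply Rle_div_r; lra.
(* For [k > K] and [m > N %/ K] the product exceeds [N], so [m] may be cut at [M]. *)
have -> : \rsum_(K.+1 <= k < (2 * K).+1) \rsum_(1 <= m < N.+1) (a m * b k * osc z al y N (m * k)) =
   \rsum_(1 <= m < M.+1) \rsum_(K.+1 <= k < (2 * K).+1) (a m * b k * osc z al y N (m * k)).
  rewrite exchange_big /= (@big_cat_nat _ _ _ M.+1) //=; last by rewrite ltnS leq_div.
  rewrite [X in _ + X](_ : _ = 0); first by lra.
  rewrite big_nat big1 // => m /andP[m1 _]; rewrite big_nat big1 // => k /andP[k1 _].
  rewrite osc_out; first by lra.
  have : (N < m * K)%N by rewrite -ltn_divLR.
  by move=> H; apply: (ltn_trans H); rewrite ltn_mul2l k1 andbT; lia.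
apply: Rle_trans (@bilinear_sum z al y N M K D a b z0 D0 zD) _.
set A2 := \rsum_(1 <= m < M.+1) _; set B2 := \rsum_(K.+1 <= k < _) _ in Hb *.
have A2le : A2 <= INR N / INR K * alpha.
  apply: (Rle_trans _ (INR M * alpha)); last by apply: Rmult_le_compat_r.
  apply: sum1_le_const => m /andP[m1 m2]; apply: Ha.
  by rewrite m1 (leq_trans _ (leq_div N K)).
have A20 : 0 <= A2 by apply: sum_ge0 => i _; apply: pow2_ge_0.
have B20 : 0 <= B2 by apply: sum_ge0 => i _; apply: pow2_ge_0.
have AB : A2 * B2 <= INR N * (alpha * beta).
  apply: (Rle_trans _ (INR N / INR K * alpha * (INR K * beta))); first by apply: Rmult_le_compat.
  by apply: Req_le; field; lra.
have M0 := pos_INR M.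
have NN : INR N ^ 2 <= 4 * INR y ^ 2 by nra.
have kd0 : 0 <= INR K / INR D by apply: Rdiv_le_0_compat; lra.
have nz0 : 0 <= INR N ^ 2 / z by apply: Rdiv_le_0_compat => //; apply: pow2_ge_0.
have ab0 : 0 <= alpha * beta by apply: Rmult_le_pos.
have P0 : 0 <= (1 + INR K / INR D) * (INR M + 16 * INR N ^ 2 / z * (1 + ln (INR D))).
  have := @ln_ge0 (INR D) D1 => lD0; apply: Rmult_le_pos; first lra.
  have : 0 <= 16 * INR N ^ 2 / z by rewrite /Rdiv Rmult_assoc; apply: Rmult_le_pos => //; lra.
  nra.
rewrite Rmult_assoc; apply: (Rle_trans _ (INR N * (alpha * beta) *
   ((1 + INR K / INR D) * (INR N / INR K + 16 * (INR N ^ 2 / z) * el)))).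
  apply: Rmult_le_compat => //; first by apply: Rmult_le_pos.
  apply: Rmult_le_compat_l; first lra.
  apply: Rplus_le_compat => //.
  rewrite (_ : 16 * INR N ^ 2 / z = 16 * (INR N ^ 2 / z)); last by field; lra.
  by apply: Rmult_le_compat_l => //; lra.
have y2 : 0 < INR y ^ 2 by nra.
have iD : / INR D <= 4 * z / INR y ^ 2.
  apply: (Rmult_le_reg_r (INR D * INR y ^ 2)); first by nra.
  rewrite (_ : / INR D * _ = INR y ^ 2); last by field; lra.
  by rewrite (_ : 4 * z / _ * _ = 4 * z * INR D); [lra | field; lra].
have e1 : INR N / INR K <= 2 * INR y * / INR K.
  by apply: Rmult_le_compat_r => //; apply: Rlt_le; apply: Rinv_0_lt_compat; lra.
have e2 : INR N / INR D <= 8 * (z / INR y).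
  apply: (Rle_trans _ (2 * INR y * (4 * z / INR y ^ 2))).
    apply: Rmult_le_compat => //; apply: Rlt_le; apply: Rinv_0_lt_compat; lra.
  by apply: Req_le; field; lra.
have e3 : INR N ^ 2 / z <= 4 * (INR y ^ 2 / z).
  rewrite /Rdiv -Rmult_assoc; apply: Rmult_le_compat_r => //.
  by apply: Rlt_le; apply: Rinv_0_lt_compat.
(* [D] and [N^2 / z] are both of order [y^2 / z], so the dependence on [z] cancels. *)
have e4 : INR K / INR D * (INR N ^ 2 / z) <= 16 * INR K.
  apply: (Rle_trans _ (INR K * (4 * z / INR y ^ 2) * (4 * (INR y ^ 2 / z)))).
    apply: Rmult_le_compat => //; apply: Rmult_le_compat_l => //; lra.
  by apply: Req_le; field; lra.
have -> : (1 + INR K / INR D) * (INR N / INR K + 16 * (INR N ^ 2 / z) * el) =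
   INR N / INR K + INR N / INR D + 16 * el * (INR N ^ 2 / z) +
   16 * el * (INR K / INR D * (INR N ^ 2 / z)) by field; lra.
apply: (Rle_trans _ (2 * INR y * (alpha * beta) * (2 * INR y * / INR K + 8 * (z / INR y) +
   16 * el * (4 * (INR y ^ 2 / z)) + 16 * el * (16 * INR K)))).
  apply: Rmult_le_compat; first by apply: Rmult_le_pos.
  - have : 0 <= INR N / INR K by apply: Rdiv_le_0_compat; lra.
    have : 0 <= INR N / INR D by apply: Rdiv_le_0_compat; lra.
    have : 0 <= INR K / INR D * (INR N ^ 2 / z) by apply: Rmult_le_pos.
    move=> h1 h2 h3; have : 0 <= 16 * el * (INR N ^ 2 / z) by apply: Rmult_le_pos => //; lra.
    have : 0 <= 16 * el * (INR K / INR D * (INR N ^ 2 / z)) by apply: Rmult_le_pos => //; lra.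
    by lra.
  - by apply: Rmult_le_compat_r.
  - have : 16 * el * (INR N ^ 2 / z) <= 16 * el * (4 * (INR y ^ 2 / z)).
      by apply: Rmult_le_compat_l => //; lra.
    have : 16 * el * (INR K / INR D * (INR N ^ 2 / z)) <= 16 * el * (16 * INR K).
      by apply: Rmult_le_compat_l => //; lra.
    by lra.
have -> : 2 * INR y * (alpha * beta) * (2 * INR y * / INR K + 8 * (z / INR y) +
   16 * el * (4 * (INR y ^ 2 / z)) + 16 * el * (16 * INR K)) =
   INR y ^ 2 * (alpha * beta) * (4 * / INR K + 16 * (z / INR y ^ 2) + 128 * (INR y * el / z)
     + 512 * (INR K * el / INR y)) by field; lra.
rewrite (_ : 512 * INR y ^ 2 * (alpha * beta) = INR y ^ 2 * (alpha * beta) * 512); last by ring.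
rewrite [X in _ <= X]Rmult_assoc.
apply: Rmult_le_compat_l; first by apply: Rmult_le_pos => //; lra.
have : 0 <= / INR K by apply: Rlt_le; apply: Rinv_0_lt_compat; lra.
have : 0 <= z / INR y ^ 2 by apply: Rdiv_le_0_compat; lra.
have : 0 <= INR y * el / z by apply: Rdiv_le_0_compat => //; nra.
lra.
Qed.

(** * Dyadic decomposition and the choice of parameters *)

Lemma sum_dyadic (f : nat -> R) (K0 J N : nat) :
  (N <= K0 * 2 ^ J)%N -> (forall k, (N < k)%N -> f k = 0) ->
  \rsum_(K0.+1 <= k < N.+1) f k =
  \rsum_(0 <= j < J) \rsum_((K0 * 2 ^ j).+1 <= k < (2 * (K0 * 2 ^ j)).+1) f k.
Proof.
move=> NJ f0.
have -> : \rsum_(K0.+1 <= k < N.+1) f k = \rsum_(K0.+1 <= k < (K0 * 2 ^ J).+1) f k.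
  have [KN|NK] := leqP K0 N.
    rewrite [RHS](@big_cat_nat _ _ _ N.+1) //= [X in _ = _ + X](_ : _ = 0); first lra.
    by rewrite big_nat big1 // => k /andP[k1 _]; apply: f0.
  rewrite big_geq ?(leqW NK) // big_nat big1 // => k /andP[k1 _]; apply: f0; lia.
elim: J {NJ} => [|J IH]; first by rewrite expn0 muln1 !big_geq.
rewrite [RHS]big_nat_recr // -IH.
rewrite [LHS](@big_cat_nat _ _ _ (K0 * 2 ^ J).+1) //=.
- by rewrite expnS mulnCA.
- by rewrite ltnS leq_pmulr // expn_gt0.
- by rewrite ltnS leq_mul2l leq_exp2l // leqnSn orbT.
Qed.

Lemma abs_sum_dyadic_le (f : nat -> R) (K0 J N : nat) (B : R) :
  (N <= K0 * 2 ^ J)%N -> (forall k, (N < k)%N -> f k = 0) ->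
  (forall j, (j < J)%N ->
    Rabs (\rsum_((K0 * 2 ^ j).+1 <= k < (2 * (K0 * 2 ^ j)).+1) f k) <= B) ->
  Rabs (\rsum_(K0.+1 <= k < N.+1) f k) <= INR J * B.
Proof.
move=> NJ f0 H; rewrite (sum_dyadic NJ f0).
apply: Rle_trans (sum_abs _ _ _) _.
by rewrite -[J in INR J](subn0 J); apply: sum_le_const => j /andP[_ Hj]; apply: H.
Qed.

Lemma dyadic_exponent (N : nat) : (0 < N)%N ->
  exists J, (N <= 2 ^ J)%N /\ INR J <= 2 * (1 + ln (INR N)).
Proof.
move=> N0; exists (up_log 2 N); split; first exact: up_logP.
have [->|N1] := eqVneq N 1%N; first by rewrite up_log1 /= ln_1; lra.
have N2 : (1 < N)%N by lia.
have /andP[H _] := up_log_bounds (isT : (1 < 2)%N) N2.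
set J := up_log 2 N in H *.
have J0 : (0 < J)%N by rewrite up_log_gt0 //.
have h1 : ln (INR (2 ^ J.-1)) <= ln (INR N) by apply: ln_INR_le; rewrite expn_gt0 /= ltnW.
move: h1; rewrite ln_INR_expn // => h1.
have h2 : INR J = INR J.-1 + 1 by rewrite -S_INR prednK.
have h3 : / 2 <= ln (INR 2) by rewrite (_ : INR 2 = 2) //; have := ln_lt_2; lra.
have := pos_INR J.-1; nra.
Qed.

Lemma abs_le_of_sq x b : 0 <= b -> x ^ 2 <= b ^ 2 -> Rabs x <= b.
Proof.
move=> b0 H; rewrite -(Rabs_pos_eq b) //; apply: Rsqr_le_abs_0; rewrite /Rsqr; lra.
Qed.

Lemma inv_le_inv_pow w i j : 1 <= w -> (i <= j)%N -> / w ^ j <= / w ^ i.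
Proof.
move=> w1 ij; apply: Rinv_le_contravar; first by apply: pow_lt; lra.
by apply: Rle_pow => //; apply/leP.
Qed.

(* [u] is essentially [(n / 2y)^(1/40)]; Vaughan's parameters are then [U = u^28] and [V = u^32]
   and Fourier frequencies up to [u^10] are needed. The powers are tuned so that each power of [el]
   is absorbed by [el <= u^4]; beyond that range the trivial bound is good enough. *)
Record regime (n y N u : nat) (el : R) : Prop := Regime {
  regime_u : (0 < u)%N;
  regime_yN : (y < N <= 2 * y)%N;
  regime_Nn : (N <= n)%N;
  regime_y : INR n ^ 2 <= INR y ^ 3;
  regime_n : 2 * INR u ^ 40 * INR y <= INR n;
  regime_log : 1 + ln (INR n) <= el;
  regime_el : el <= INR u ^ 4 }.

Section Regime_bounds.
Variables (n y N u : nat) (el : R).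
Hypothesis rg : regime n y N u el.

Let w := INR u.

Lemma regime_y0 : (0 < y)%N. Proof. by have /andP[] := regime_yN rg; lia. Qed.
Lemma regime_N0 : (0 < N)%N. Proof. by have /andP[] := regime_yN rg; lia. Qed.
Lemma regime_n0 : (0 < n)%N. Proof. by have := regime_Nn rg; have := regime_N0; lia. Qed.
Lemma regime_w1 : 1 <= w. Proof. exact: INR_ge1 (regime_u rg). Qed.
Lemma regime_el1 : 1 <= el.
Proof. by have := regime_log rg; have := ln_INR_ge0 n; lra. Qed.

Lemma regime_lnN m : (0 < m <= N)%N -> 1 + ln (INR m) <= el.
Proof.
move=> mN; apply: Rle_trans (regime_log rg).
have : ln (INR m) <= ln (INR n) by apply: ln_INR_le; have := regime_Nn rg; lia.
lra.
Qed.

(** Here [y >= n^(2/3)] enters: [4 w^80 y^2 <= n^2 <= y^3]. The exponent [80] is just enough for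
    [U V = u^60] together with a saving of [w^20] in the squared sums. *)
Lemma regime_wy : 4 * w ^ 80 <= INR y.
Proof.
have y1 := INR_ge1 regime_y0; have w1 := regime_w1.
have H1 := regime_n rg; have H2 := regime_y rg.
have w40 : 1 <= w ^ 40 by apply: pow_R1_Rle.
have H3 : (2 * w ^ 40 * INR y) ^ 2 <= INR n ^ 2.
  by apply: pow_incr; split => //; apply: Rmult_le_pos; [nra | lra].
apply: (Rmult_le_reg_r (INR y ^ 2)); first by nra.
rewrite (_ : 4 * w ^ 80 * INR y ^ 2 = (2 * w ^ 40 * INR y) ^ 2); first by lra.
ring.
Qed.

Lemma regime_yn : 2 * w ^ 40 * INR n <= INR y ^ 2.
Proof.
have y1 := INR_ge1 regime_y0; have n1 := INR_ge1 regime_n0.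
have H1 := regime_n rg; have H2 := regime_y rg.
apply: (Rmult_le_reg_r (INR y * INR n)); first by nra.
have : 2 * w ^ 40 * INR y * INR n ^ 2 <= INR n * INR y ^ 3.
  by apply: Rmult_le_compat => //; [apply: Rmult_le_pos; [have : 0 <= w ^ 40 by apply: pow_le; have := regime_w1; lra | lra] | nra]; lra.
by nra.
Qed.

Variables (h : nat) (al : R).
Hypothesis h_range : (0 < h <= u ^ 10)%N.

Let z := INR h * INR n.
(** The longest block with [z D <= y^2 / 2], the condition under which differenced phases have
    derivative at most [1/2]. It is also the largest [d] for which [osc_line_sum] applies to the
    multiples of [d]. *)
Let D := (y ^ 2 %/ (2 * h * n))%N.

Lemma freq_hw : 1 <= INR h <= w ^ 10.
Proof.
have /andP[h0 hu] := h_range; split; first exact: INR_ge1.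
by rewrite -INR_expn; apply: leq_INR.
Qed.

Lemma freq_z0 : 0 < z.
Proof. by have [h1 _] := freq_hw; have := INR_ge1 regime_n0; rewrite /z; nra. Qed.

Lemma freq_z_ge : 2 * w ^ 40 * INR y <= z.
Proof.
have [h1 _] := freq_hw; have n1 := INR_ge1 regime_n0; apply: Rle_trans (regime_n rg) _.
by rewrite /z; nra.
Qed.

(** Of the factor [w^40] in [regime_yn], the frequency [h <= w^10] uses up [w^10]. *)
Lemma freq_z_le : 2 * w ^ 30 * z <= INR y ^ 2.
Proof.
have [h1 h2] := freq_hw; have n1 := INR_ge1 regime_n0; have w1 := regime_w1.
apply: Rle_trans regime_yn; rewrite /z.
rewrite (_ : 2 * w ^ 30 * (INR h * INR n) = INR h * (2 * w ^ 30 * INR n)); last by ring.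
rewrite (_ : 2 * w ^ 40 * INR n = w ^ 10 * (2 * w ^ 30 * INR n)); last by ring.
apply: Rmult_le_compat_r => //; apply: Rmult_le_pos; last lra.
have : 0 <= w ^ 30 by apply: pow_le; lra.
lra.
Qed.

Lemma freq_D_le : z * INR D <= INR y ^ 2 / 2.
Proof.
have : (D * (2 * h * n) <= y ^ 2)%N by apply: leq_divM.
by move/leq_INR; rewrite INR_expn !INR_mul /z (_ : INR 2 = 2) //; lra.
Qed.

Lemma freq_D_ge : (u ^ 30 <= D)%N.
Proof.
have /andP[h0 _] := h_range.
rewrite leq_divRL; last by rewrite !muln_gt0 h0 regime_n0.
apply/leP; apply: INR_le; rewrite (INR_mul (u ^ 30)) !INR_expn !INR_mul (_ : INR 2 = 2) //.
by have := freq_z_le; rewrite /z /w; lra.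
Qed.

Lemma freq_D0 : (0 < D)%N.
Proof. by apply: leq_trans freq_D_ge; rewrite expn_gt0 (regime_u rg). Qed.

Lemma freq_D_gt : INR y ^ 2 <= 4 * z * INR D.
Proof.
have /andP[h0 _] := h_range.
have : (y ^ 2 <= D.+1 * (2 * h * n))%N.
  by apply: ltnW; apply: ltn_ceil; rewrite !muln_gt0 h0 regime_n0.
move/leq_INR; rewrite INR_expn !INR_mul S_INR (_ : INR 2 = 2) // => H.
have D1 := INR_ge1 freq_D0; have := freq_z0; rewrite /z in H *; nra.
Qed.

Lemma freq_D_le_y : (D <= y)%N.
Proof.
have /andP[h0 _] := h_range; have y0 := regime_y0.
have yn : (y <= n)%N by have := regime_yN rg; have := regime_Nn rg; lia.
apply: (@leq_trans (y ^ 2 %/ y)); last by rewrite expnS expn1 mulKn.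
by apply: leq_div2l => //; nia.
Qed.
End Regime_bounds.

Section Exponential_sum.
Variables (n y N u : nat) (el : R).
Hypothesis rg : regime n y N u el.
Variables (h : nat) (al : R).
Hypothesis h_range : (0 < h <= u ^ 10)%N.

Let w := INR u.
Let z := INR h * INR n.
Let D := (y ^ 2 %/ (2 * h * n))%N.
(** The bound sought for one dyadic piece: a saving of [w^10], with [el^(3/2)] coming from the mean
    square of [tau]. *)
Let T := INR y / w ^ 10 * (el * sqrt el).

Let y1 : 1 <= INR y := INR_ge1 (regime_y0 rg).
Let w1 : 1 <= w := regime_w1 rg.
Let el1 : 1 <= el := regime_el1 rg.
Let z0 : 0 < z := freq_z0 rg h_range.

Let zD : z * INR D <= INR y ^ 2 / 2 := freq_D_le n y h.

Lemma scale_pow_gt0 k : 0 < w ^ k.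
Proof. by apply: pow_lt; have := w1; lra. Qed.

Lemma target_ge0 : 0 <= T.
Proof.
apply: Rmult_le_pos.
  by apply: Rdiv_le_0_compat; [have := y1; lra | exact: scale_pow_gt0].
by apply: Rmult_le_pos; [have := el1; lra | exact: sqrt_pos].
Qed.

Lemma target_sq : T ^ 2 = INR y ^ 2 * el ^ 3 * / w ^ 20.
Proof.
have e := el1; have s : sqrt el ^ 2 = el by rewrite /= Rmult_1_r sqrt_sqrt //; lra.
rewrite /T /Rdiv !Rpow_mult_distr s pow_inv -pow_mult.
rewrite (_ : (10 * 2)%coq_nat = 20%N) //; ring.
Qed.

Lemma target_lower : INR y / w ^ 10 <= T.
Proof.
rewrite /T -[X in X <= _]Rmult_1_r; apply: Rmult_le_compat_l.
  by apply: Rdiv_le_0_compat; [have := y1; lra | exact: scale_pow_gt0].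
have e := el1; have : 1 <= sqrt el by rewrite -sqrt_1; apply: sqrt_le_1_alt.
nra.
Qed.

Lemma line_error : 8 * INR N ^ 2 / z * el <= 16 * T.
Proof.
have Ny : INR N <= 2 * INR y.
  by have /andP[_ /leq_INR] := regime_yN rg; rewrite INR_mul.
have N0 := pos_INR N; have y1' := y1; have e := el1; have w1' := w1.
have w40 := scale_pow_gt0 40; have w10 := scale_pow_gt0 10.
have zg := freq_z_ge rg h_range; rewrite -/w -/z in zg.
have H1 : INR N ^ 2 / z <= 2 * INR y / w ^ 40.
  apply Rle_div_l; first exact: z0.
  apply: (Rle_trans _ (4 * INR y ^ 2)); first by nra.
  have : 2 * INR y / w ^ 40 * (2 * w ^ 40 * INR y) <= 2 * INR y / w ^ 40 * z.
    by apply: Rmult_le_compat_l => //; apply: Rdiv_le_0_compat; lra.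
  by rewrite (_ : 2 * INR y / w ^ 40 * (2 * w ^ 40 * INR y) = 4 * INR y ^ 2) //; field; lra.
have H2 : el * / w ^ 40 <= / w ^ 36.
  rewrite (_ : / w ^ 36 = w ^ 4 * / w ^ 40); last by field; lra.
  apply: Rmult_le_compat_r; last exact: regime_el rg.
  by apply: Rlt_le; apply: Rinv_0_lt_compat.
have H3 : / w ^ 36 <= / w ^ 10 by apply: inv_le_inv_pow.
apply: (Rle_trans _ (16 * (INR y * (el * / w ^ 40)))).
  apply: (Rle_trans _ (8 * (2 * INR y / w ^ 40) * el)); last by apply: Req_le; field; lra.
  apply: Rmult_le_compat_r; first lra.
  rewrite /Rdiv Rmult_assoc; apply: Rmult_le_compat_l; [lra | exact: H1].
apply: Rmult_le_compat_l; first lra.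
apply: Rle_trans target_lower; apply: Rmult_le_compat_l; lra.
Qed.

Lemma sum_inv_le_el m : (m <= N)%N -> \rsum_(1 <= d < m.+1) (/ INR d) <= el.
Proof.
move=> mN; apply: Rle_trans (regime_lnN rg (_ : (0 < N <= N)%N)); last by rewrite (regime_N0 rg) leqnn.
apply: Rle_trans (harmonic_le (regime_N0 rg)); apply: sum_incl => // i /andP[i1 _].
by apply: Rlt_le; apply: Rinv_0_lt_compat; have := INR_ge1 i1; lra.
Qed.

(** As [U <= D], the Kusmin-Landau bound is available for each [b]; the sum of [1 / b] costs one
    factor [el]. *)
Lemma type_one_log U : (U <= D)%N ->
  Rabs (\rsum_(1 <= b < N.+1) (mobius_upto U b *
    \rsum_(1 <= s < N.+1) (ln (INR s) * osc z al y N (b * s)))) <= 32 * el * T.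
Proof.
move=> UD; have y1' := y1; have e := el1; have z0' := z0.
apply: Rle_trans (sum_abs _ _ _) _.
apply: (Rle_trans _ (\rsum_(1 <= b < N.+1) (16 * el * INR N ^ 2 / z * / INR b))).
  apply: sum_le => b /andP[b1 b2]; have b1' := INR_ge1 b1.
  have P0 : 0 <= 16 * el * INR N ^ 2 / z * / INR b.
    apply: Rmult_le_pos; last by apply: Rlt_le; apply: Rinv_0_lt_compat; lra.
    by apply: Rdiv_le_0_compat => //; have := pow2_ge_0 (INR N); nra.
  rewrite Rabs_mult /mobius_upto; case: leqP => bU; last by rewrite Rabs_R0; lra.
  have zb : z * INR b <= INR y ^ 2 / 2.
    apply: Rle_trans zD; apply: Rmult_le_compat_l; first lra.
    by apply: leq_INR; apply: leq_trans UD.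
  have H := osc_line_log_sum al N z0 b1 zb (regime_N0 rg).
  have lN : ln (INR N) <= el.
    by have := regime_lnN rg (_ : (0 < N <= N)%N); rewrite (regime_N0 rg) leqnn => /(_ isT); lra.
  rewrite -[X in _ <= X]Rmult_1_l; apply: Rmult_le_compat; try exact: Rabs_pos.
    exact: mobius_abs.
  apply: Rle_trans H _; have zb0 : 0 < z * INR b by apply: Rmult_lt_0_compat; lra.
  rewrite (_ : 16 * ln (INR N) * INR N ^ 2 / (z * INR b) = ln (INR N) * (16 * INR N ^ 2 / (z * INR b)));
    last by field; lra.
  rewrite (_ : 16 * el * INR N ^ 2 / z * / INR b = el * (16 * INR N ^ 2 / (z * INR b)));
    last by field; lra.
  apply: Rmult_le_compat_r => //; apply: Rdiv_le_0_compat => //.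
  by have := pow2_ge_0 (INR N); lra.
rewrite -big_distrr /=.
have H1 := sum_inv_le_el (leqnn N); have H2 := line_error.
have P0 : 0 <= 16 * el * INR N ^ 2 / z.
  by apply: Rdiv_le_0_compat => //; have := pow2_ge_0 (INR N); nra.
apply: (Rle_trans _ (16 * el * INR N ^ 2 / z * el)); first by apply: Rmult_le_compat_l.
rewrite (_ : 16 * el * INR N ^ 2 / z * el = 2 * el * (8 * INR N ^ 2 / z * el)); last by field; lra.
by rewrite (_ : 32 * el * T = 2 * el * (16 * T)); [apply: Rmult_le_compat_l; lra | ring].
Qed.

Lemma type_one_small (c : nat -> R) :
  (forall d, (0 < d <= N)%N -> Rabs (c d) <= el) ->
  Rabs (\rsum_(1 <= d < D.+1) (c d * \rsum_(1 <= r < N.+1) osc z al y N (d * r))) <= 16 * el * T.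
Proof.
move=> cle; have y1' := y1; have e := el1; have z0' := z0.
have DN : (D <= N)%N.
  by have := freq_D_le_y rg h_range; have /andP[] := regime_yN rg; rewrite -/D; lia.
apply: Rle_trans (sum_abs _ _ _) _.
apply: (Rle_trans _ (\rsum_(1 <= d < D.+1) (8 * el * INR N ^ 2 / z * / INR d))).
  apply: sum_le => b /andP[b1 b2]; have b1' := INR_ge1 b1.
  have zb : z * INR b <= INR y ^ 2 / 2.
    apply: Rle_trans zD; apply: Rmult_le_compat_l; first lra.
    exact: leq_INR.
  have H := osc_line_sum al N N z0 b1 zb.
  rewrite Rabs_mult (_ : 8 * el * INR N ^ 2 / z * / INR b = el * (8 * INR N ^ 2 / (z * INR b))).
    by apply: Rmult_le_compat => //; try exact: Rabs_pos; apply: cle; lia.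
  by field; lra.
rewrite -big_distrr /=.
have H1 := sum_inv_le_el DN; have H2 := line_error.
have P0 : 0 <= 8 * el * INR N ^ 2 / z.
  by apply: Rdiv_le_0_compat => //; have := pow2_ge_0 (INR N); nra.
apply: (Rle_trans _ (8 * el * INR N ^ 2 / z * el)); first by apply: Rmult_le_compat_l.
rewrite (_ : 8 * el * INR N ^ 2 / z * el = el * (8 * INR N ^ 2 / z * el)); last by field; lra.
by rewrite (_ : 16 * el * T = el * (16 * T)); [apply: Rmult_le_compat_l; lra | ring].
Qed.

Lemma freq_quot : z / INR y ^ 2 <= / (2 * w ^ 30).
Proof.
have w30 := scale_pow_gt0 30; have y1' := y1.
apply Rle_div_l; first by nra.
have H := freq_z_le rg h_range; rewrite -/w -/z in H.
apply: (Rmult_le_reg_l (2 * w ^ 30)); first lra.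
by rewrite (_ : 2 * w ^ 30 * (/ (2 * w ^ 30) * INR y ^ 2) = INR y ^ 2); [lra | field; lra].
Qed.

Lemma freq_quot_inv : INR y * el / z <= el / (2 * w ^ 40).
Proof.
have w40 := scale_pow_gt0 40; have y1' := y1; have e := el1.
apply Rle_div_l; first exact: z0.
have H := freq_z_ge rg h_range; rewrite -/w -/z in H.
apply: (Rmult_le_reg_l (2 * w ^ 40)); first lra.
rewrite (_ : 2 * w ^ 40 * (el / (2 * w ^ 40) * z) = el * z); last by field; lra.
rewrite (_ : 2 * w ^ 40 * (INR y * el) = el * (2 * w ^ 40 * INR y)); last by ring.
by apply: Rmult_le_compat_l; lra.
Qed.

(** There are at most [2 el] dyadic pieces. The hypothesis is on squares because Cauchy-Schwarz
    delivers squares. *)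
Lemma dyadic_total (f : nat -> R) (K0 : nat) (c : R) :
  (0 < K0)%N -> (forall k, (N < k)%N -> f k = 0) -> 0 <= c ->
  (forall K, (K0 <= K)%N -> (\rsum_(K.+1 <= k < (2 * K).+1) f k) ^ 2 <= c ^ 2 * T ^ 2) ->
  Rabs (\rsum_(K0.+1 <= k < N.+1) f k) <= 2 * c * el * T.
Proof.
move=> K00 f0 c0 H.
have [J [NJ JB]] := dyadic_exponent (regime_N0 rg).
have NJ' : (N <= K0 * 2 ^ J)%N by apply: leq_trans NJ _; rewrite leq_pmull.
have cT : 0 <= c * T by apply: Rmult_le_pos => //; exact: target_ge0.
apply: Rle_trans (@abs_sum_dyadic_le f K0 J N (c * T) NJ' f0 _) _.
  move=> j _; apply: abs_le_of_sq => //; rewrite Rpow_mult_distr; apply: H.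
  by rewrite leq_pmulr // expn_gt0.
have lN : 1 + ln (INR N) <= el by apply: (regime_lnN rg); rewrite (regime_N0 rg) leqnn.
by nra.
Qed.

(** For [d > D] the Kusmin-Landau condition fails for a single [d], so the sum is treated as
    bilinear with coefficient [1] on [r]. The support of [c] up to [u^60 = U V] keeps the range of
    [d] short enough. *)
Lemma type_one_large (c : nat -> R) :
  (forall d, (0 < d <= N)%N -> Rabs (c d) <= el) ->
  (forall d, (u ^ 60 < d)%N -> c d = 0) ->
  Rabs (\rsum_(D.+1 <= d < N.+1) (c d * \rsum_(1 <= r < N.+1) osc z al y N (d * r))) <= 92 * el * T.
Proof.
move=> cle c0; have y1' := y1; have e := el1; have z0' := z0; have w1' := w1.
have D0 := freq_D0 rg h_range.
pose b d := if (d <= N)%N then c d else 0.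
have -> : \rsum_(D.+1 <= d < N.+1) (c d * \rsum_(1 <= r < N.+1) osc z al y N (d * r)) =
    \rsum_(D.+1 <= d < N.+1) \rsum_(1 <= r < N.+1) (1 * b d * osc z al y N (r * d)).
  apply: eq_big_nat => d /andP[d1 d2]; rewrite big_distrr; apply: eq_bigr => r _ /=.
  by rewrite /b -ltnS d2 mulnC; ring.
(* [46^2 = 2116] exceeds [512 * 4], the constant of the four terms below. *)
rewrite (_ : 92 * el * T = 2 * 46 * el * T); last by ring.
apply: dyadic_total => //; [|lra|].
  by move=> k Nk; rewrite big1 // => r _; rewrite /b leqNgt Nk /=; ring.
move=> K DK; have K0 : (0 < K)%N by apply: leq_trans DK.
have K1 := INR_ge1 K0.
have [Ku|uK] := leqP (u ^ 60) K.
  rewrite big_nat big1; first by rewrite /= !Rmult_0_l; have := pow2_ge_0 T; lra.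
  move=> k /andP[k1 _]; rewrite big1 // => r _.
  by rewrite /b c0 ?if_same; [ring | apply: leq_ltn_trans k1].
apply: Rle_trans (@bilinear_piece z al el y N K D (fun=> 1) b 1 (el ^ 2) z0 D0 K0 (regime_y0 rg)
   (proj2 (andP (regime_yN rg))) el1 zD (freq_D_gt rg h_range) _ _ Rle_0_1 _ _) _.
- apply: (regime_lnN rg); rewrite D0 /=.
  by have := freq_D_le_y rg h_range; have /andP[] := regime_yN rg; rewrite -/D; lia.
- by move=> m _; lra.
- exact: pow2_ge_0.
- rewrite (_ : INR K = INR ((2 * K).+1 - K.+1)); last by congr INR; lia.
  apply: sum_le_const => k /andP[k1 _]; rewrite /b; case: ifP => kN; last first.
    by have := pow2_ge_0 el; rewrite /= Rmult_0_l.
  have := cle k ltac:(lia); have := Rabs_pos (c k); rewrite -(pow2_abs (c k)); nra.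
rewrite target_sq Rmult_1_l.
have ww20 := scale_pow_gt0 20.
have H30 : / w ^ 30 <= / w ^ 20 by apply: inv_le_inv_pow.
have h1 : / INR K <= / w ^ 20.
  apply: Rle_trans H30; apply: Rinv_le_contravar; first exact: scale_pow_gt0.
  by rewrite -INR_expn; apply: leq_INR; apply: leq_trans (freq_D_ge rg h_range) DK.
have h2 : z / INR y ^ 2 <= / w ^ 20.
  apply: Rle_trans freq_quot _; rewrite Rinv_mult.
  have : 0 < / w ^ 30 by apply: Rinv_0_lt_compat; exact: scale_pow_gt0.
  lra.
have h3 : INR y * el / z <= el * / w ^ 20.
  apply: Rle_trans freq_quot_inv _; apply: Rmult_le_compat_l; first lra.
  rewrite Rinv_mult; have : / w ^ 40 <= / w ^ 20 by apply: inv_le_inv_pow.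
  have : 0 < / w ^ 40 by apply: Rinv_0_lt_compat; exact: scale_pow_gt0.
  lra.
(* Here [K < u^60], and [60 + 20 = 80] is the exponent of [regime_wy]. *)
have h4 : INR K * el / INR y <= el * / w ^ 20.
  apply Rle_div_l; first lra.
  rewrite (_ : el * / w ^ 20 * INR y = INR y * / w ^ 20 * el); last by ring.
  apply: Rmult_le_compat_r; first lra.
  apply: (Rle_trans _ (w ^ 60)); first by rewrite -INR_expn; apply: leq_INR; apply: ltnW.
  apply: (Rmult_le_reg_r (w ^ 20)) => //; rewrite (_ : INR y * / w ^ 20 * w ^ 20 = INR y); last by field; lra.
  have := regime_wy rg; rewrite -/w (_ : w ^ 60 * w ^ 20 = w ^ 80); last by ring.
  have := scale_pow_gt0 80; lra.
have yy : 0 <= INR y ^ 2 * el ^ 2 by apply: Rmult_le_pos; apply: pow2_ge_0.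
apply: (Rle_trans _ (512 * (INR y ^ 2 * el ^ 2) * (4 * (el * / w ^ 20)))).
  rewrite (_ : 512 * INR y ^ 2 * el ^ 2 = 512 * (INR y ^ 2 * el ^ 2)); last by ring.
  apply: Rmult_le_compat_l; first lra.
  have : 0 < / w ^ 20 by apply: Rinv_0_lt_compat.
  nra.
have : 0 <= INR y ^ 2 * el ^ 2 * (el * / w ^ 20).
  apply: Rmult_le_pos => //; apply: Rmult_le_pos; first lra.
  by apply: Rlt_le; apply: Rinv_0_lt_compat.
nra.
Qed.

Lemma type_two :
  Rabs (\rsum_((u ^ 28).+1 <= k < N.+1) \rsum_(1 <= l < N.+1)
    (mangoldt_above (u ^ 32) l * vaughan_beta (u ^ 28) N k * osc z al y N (l * k))) <=
  406 * el * T.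
Proof.
have y1' := y1; have e := el1; have z0' := z0; have w1' := w1.
have D0 := freq_D0 rg h_range.
have u0 : (0 < u)%N := regime_u rg.
pose b k := if (k <= N)%N then vaughan_beta (u ^ 28) N k else 0.
rewrite (@eq_big_nat _ _ _ _ _ _ (fun k => \rsum_(1 <= l < N.+1)
    (mangoldt_above (u ^ 32) l * b k * osc z al y N (l * k)))); last first.
  by move=> k /andP[_ k2]; apply: eq_bigr => l _; rewrite /b -ltnS k2.
(* [203^2 = 41209] exceeds [8192 * 5], the constant found below, where [8192 = 512 * 16]. *)
rewrite (_ : 406 * el * T = 2 * 203 * el * T); last by ring.
apply: dyadic_total; [by rewrite expn_gt0 u0 | | lra | ].
  by move=> k Nk; rewrite big1 // => r _; rewrite /b leqNgt Nk /=; ring.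
move=> K UK; have K0 : (0 < K)%N by apply: leq_trans UK; rewrite expn_gt0 u0.
have K1 := INR_ge1 K0.
(* If [K u^32 > N], then [l > u^32] pushes [l * k] beyond [N] and the piece vanishes. *)
have [KN|NK] := leqP (K * u ^ 32) N; last first.
  rewrite big_nat big1; first by rewrite /= !Rmult_0_l; have := pow2_ge_0 T; lra.
  move=> k /andP[k1 _]; rewrite big1 // => l _; rewrite /mangoldt_above; case: leqP => lV; first by ring.
  rewrite osc_out; first by ring.
  by apply: leq_trans NK _; rewrite mulnC; apply: leq_mul; apply: ltnW.
have KleN : (K <= N)%N by apply: leq_trans KN; rewrite leq_pmulr // expn_gt0 u0.
apply: Rle_trans (@bilinear_piece z al el y N K D (mangoldt_above (u ^ 32)) b (el ^ 2) (16 * el ^ 3)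
   z0 D0 K0 (regime_y0 rg)
   (proj2 (andP (regime_yN rg))) el1 zD (freq_D_gt rg h_range) _ _ _ _ _) _.
- apply: (regime_lnN rg); rewrite D0 /=.
  by have := freq_D_le_y rg h_range; have /andP[] := regime_yN rg; rewrite -/D; lia.
- move=> m mN; rewrite /mangoldt_above; case: ifP => _; last by have := pow2_ge_0 el; rewrite /= Rmult_0_l.
  apply: pow_incr; split; first exact: mangoldt_ge0.
  by have := mangoldt_le_ln m; have := regime_lnN rg mN; lra.
- exact: pow2_ge_0.
- by have := pow_le el 3 ltac:(lra); lra.
- have K2 : (0 < 2 * K)%N by rewrite muln_gt0.
  apply: (Rle_trans _ (\rsum_(1 <= k < (2 * K).+1) (tau k ^ 2))).
    apply: (Rle_trans _ (\rsum_(K.+1 <= k < (2 * K).+1) (tau k ^ 2))).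
      apply: sum_le => k /andP[k1 k2]; rewrite -(pow2_abs (b k)); apply: pow_incr; split.
        exact: Rabs_pos.
      rewrite /b; case: ifP => kN; last by rewrite Rabs_R0; exact: tau_ge0.
      by apply: vaughan_beta_abs; rewrite kN; lia.
    by apply: sum_incl => // k _; exact: pow2_ge_0.
  apply: Rle_trans (sum_tau_sq_le K2) _.
  (* The cube of [2 el] and the factor [2 K] make up the [16] in the mean square bound. *)
  have lK : 1 + ln (INR (2 * K)) <= 2 * el.
    rewrite INR_mul ln_mult; [|by rewrite (_ : INR 2 = 2) //; lra|lra].
    have := regime_lnN rg (_ : (0 < K <= N)%N); rewrite K0 KleN => /(_ isT).
    have : ln (INR 2) <= 1.
      rewrite (_ : INR 2 = 2) //; have := @ln_le_sub1 2; lra.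
    lra.
  have lK0 : 0 <= 1 + ln (INR (2 * K)) by have := ln_INR_ge0 (2 * K); lra.
  apply: (Rle_trans _ (INR (2 * K) * (2 * el) ^ 3)).
    by apply: Rmult_le_compat_l; [exact: pos_INR | apply: pow_incr].
  by rewrite INR_mul (_ : INR 2 = 2) //; apply: Req_le; ring.
rewrite target_sq.
have ww20 := scale_pow_gt0 20.
have iw20 : 0 < / w ^ 20 by apply: Rinv_0_lt_compat.
have el8 : el ^ 2 <= w ^ 8.
  rewrite (_ : w ^ 8 = (w ^ 4) ^ 2); last by ring.
  by apply: pow_incr; split; [lra | exact: regime_el rg].
have el12 : el ^ 3 <= w ^ 12.
  rewrite (_ : w ^ 12 = (w ^ 4) ^ 3); last by ring.
  by apply: pow_incr; split; [lra | exact: regime_el rg].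
(* Each factor [el] is paid for with [w^4], and [w^20] must remain: [8 + 20] accounts for [U = u^28]
   (in [h1]) and [12 + 20] for [V = u^32] (in [h4]). *)
have cut i j : (i + 20 <= j)%N -> w ^ i * / w ^ j <= / w ^ 20.
  move=> ij; rewrite -(subnKC (leq_trans (leq_addr 20 i) ij)) pow_add.
  rewrite Rinv_mult -Rmult_assoc Rinv_r; last by have := scale_pow_gt0 i; lra.
  by rewrite Rmult_1_l; apply: inv_le_inv_pow => //; lia.
have iw k : 0 < / w ^ k by apply: Rinv_0_lt_compat; exact: scale_pow_gt0.
have e20 : 0 <= el ^ 2 by apply: pow2_ge_0.
have h1 : el ^ 2 * / INR K <= / w ^ 20.
  apply: (Rle_trans _ _ _ _ (cut 8%N 28%N isT)); apply: Rmult_le_compat => //.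
    by apply: Rlt_le; apply: Rinv_0_lt_compat; lra.
  apply: Rinv_le_contravar; first exact: scale_pow_gt0.
  by rewrite -INR_expn; apply: leq_INR.
have h2 : el ^ 2 * (z / INR y ^ 2) <= / w ^ 20.
  apply: (Rle_trans _ _ _ _ (cut 8%N 30%N isT)); apply: Rmult_le_compat => //.
    by apply: Rdiv_le_0_compat; nra.
  by apply: Rle_trans freq_quot _; rewrite Rinv_mult; have := iw 30%N; lra.
have h3 : el ^ 2 * (INR y * el / z) <= / w ^ 20.
  apply: (Rle_trans _ _ _ _ (cut 12%N 40%N isT)).
  apply: (Rle_trans _ (el ^ 2 * (el / (2 * w ^ 40)))).
    by apply: Rmult_le_compat_l => //; exact: freq_quot_inv.
  rewrite (_ : el ^ 2 * (el / (2 * w ^ 40)) = el ^ 3 * (/ 2 * / w ^ 40)); last first.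
    by field; have := scale_pow_gt0 40; lra.
  apply: Rmult_le_compat => //; first by apply: pow_le; lra.
    by have := iw 40%N; lra.
  by have := iw 40%N; lra.
have h4 : el ^ 2 * (INR K * el / INR y) <= 2 * / w ^ 20.
  apply: (Rle_trans _ (2 * (w ^ 12 * / w ^ 32))); last by have := cut 12%N 32%N isT; lra.
  rewrite (_ : el ^ 2 * (INR K * el / INR y) = el ^ 3 * (INR K / INR y)); last by field; lra.
  rewrite (_ : 2 * (w ^ 12 * / w ^ 32) = w ^ 12 * (2 * / w ^ 32)); last by ring.
  apply: Rmult_le_compat => //; first by apply: pow_le; lra.
    by apply: Rdiv_le_0_compat; lra.
  apply Rle_div_l; first lra.
  apply: (Rmult_le_reg_r (w ^ 32)); first exact: scale_pow_gt0.
  rewrite (_ : 2 * / w ^ 32 * INR y * w ^ 32 = 2 * INR y); last first.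
    by field; have := scale_pow_gt0 32; lra.
  have /andP[_ N2y] := regime_yN rg.
  by have := leq_INR (leq_trans KN N2y); rewrite (INR_mul K) INR_expn (INR_mul 2) (_ : INR 2 = 2).
set a1 := / INR K in h1 *; set a2 := z / _ in h2 *; set a3 := INR y * el / z in h3 *.
set a4 := INR K * el / INR y in h4 *.
have ye : 0 <= INR y ^ 2 * el ^ 3 by apply: Rmult_le_pos; [exact: pow2_ge_0 | apply: pow_le; lra].
rewrite (_ : 512 * INR y ^ 2 * (el ^ 2 * (16 * el ^ 3)) * (a1 + a2 + a3 + a4) =
  8192 * (INR y ^ 2 * el ^ 3) * (el ^ 2 * a1 + el ^ 2 * a2 + el ^ 2 * a3 + el ^ 2 * a4)); last by ring.
apply: (Rle_trans _ (8192 * (INR y ^ 2 * el ^ 3) * (5 * / w ^ 20))).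
  apply: Rmult_le_compat_l; lra.
have := Rmult_le_pos _ _ ye (Rlt_le _ _ iw20).
by lra.
Qed.

Lemma mangoldt_osc_sum : Rabs (\rsum_(1 <= l < N.+1) (mangoldt l * osc z al y N l)) <= 546 * el * T.
Proof.
have u0 : (0 < u)%N := regime_u rg; have N0 := regime_N0 rg.
have y1' := y1; have e := el1; have w1' := w1.
have Vy : (u ^ 32 <= y)%N.
  apply/leP; apply: INR_le; rewrite INR_expn.
  have := regime_wy rg; rewrite -/w; have : w ^ 32 <= w ^ 80 by apply: Rle_pow => //; apply/leP.
  have := scale_pow_gt0 80; lra.
have UD : (u ^ 28 <= D)%N by apply: leq_trans (freq_D_ge rg h_range); rewrite leq_pexp2l.
have DN : (D <= N)%N.
  by have := freq_D_le_y rg h_range; have /andP[] := regime_yN rg; rewrite -/D; lia.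
rewrite (@vaughan_identity (osc z al y N) (u ^ 28) (u ^ 32) N) ?expn_gt0 ?u0 //; first last.
- by move=> m mV; rewrite /osc ltnNge (leq_trans mV Vy).
- by move=> m; exact: osc_out.
pose c := vaughan_coef (u ^ 28) (u ^ 32) N.
have cle d : (0 < d <= N)%N -> Rabs (c d) <= el.
  move=> dN; have := vaughan_coef_abs (u ^ 28) (u ^ 32) dN; rewrite -/c.
  by have := regime_lnN rg dN; lra.
have c0 d : (u ^ 60 < d)%N -> c d = 0.
  by move=> H; apply: vaughan_coef_large; rewrite -expnD.
have B1 := type_one_log UD.
have B2 := type_one_small cle.
have B3 := type_one_large cle c0.
have B4 := type_two.
(* The convolution term is cut at [D], beyond which single values of [d] cannot be handled;
   [546 = 32 + 16 + 92 + 406]. *)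
rewrite [X in _ - X - _](@big_cat_nat _ _ _ D.+1) //= -/c.
move: B1 B2 B3 B4; set S1 := \rsum_(1 <= b < N.+1) _; set S2 := \rsum_(1 <= d < D.+1) _.
set S3 := \rsum_(D.+1 <= d < N.+1) _; set S4 := \rsum_((u ^ 28).+1 <= k < N.+1) _.
move=> /Rabs_le_between B1 /Rabs_le_between B2 /Rabs_le_between B3 /Rabs_le_between B4.
by apply: Rabs_le; lra.
Qed.

End Exponential_sum.

(** * The sawtooth function *)

(** By the double angle formulas and [x_cos_le_sin] at [x / 2], [sin x >= x (cos (x/2))^2 = x (1 +
    cos x) / 2]. *)
Lemma half_x_le_sin x : 0 <= x <= PI / 2 -> x / 2 <= sin x.
Proof.
move=> [x0 x1]; have P := PI_RGT_0.
have c0 : 0 <= cos x by apply: cos_ge_0; lra.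
have H := @x_cos_le_sin (x / 2) ltac:(lra).
have hc : 0 <= cos (x / 2) by apply: cos_ge_0; lra.
have E1 : sin x = 2 * sin (x / 2) * cos (x / 2) by rewrite -sin_2a; congr sin; field.
have E2 : cos x = 2 * cos (x / 2) * cos (x / 2) - 1 by rewrite -cos_2a_cos; congr cos; field.
have := Rmult_le_compat_r _ _ _ hc H; nra.
Qed.

(** On [0 < t < 1] the Fourier series of [t - 1/2] is minus the sum of [sin (2 PI h t) / (PI h)];
    this is the error of truncating it at [H]. *)
Definition saw_remainder (H : nat) (t : R) : R :=
  t - / 2 + \rsum_(1 <= h < H.+1) (sin (2 * PI * INR h * t) / (PI * INR h)).

Lemma dirichlet_kernel (H : nat) (t : R) :
  (1 + \rsum_(1 <= h < H.+1) (2 * cos (2 * PI * INR h * t))) * sin (PI * t) =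
  sin ((2 * INR H + 1) * PI * t).
Proof.
elim: H => [|H IH]; first by rewrite big_geq //= !Rplus_0_r Rmult_1_l; congr sin; ring.
rewrite big_nat_recr // -Rplus_assoc Rmult_plus_distr_r IH.
rewrite S_INR; set a := 2 * PI * (INR H + 1) * t; set b := PI * t.
rewrite (_ : (2 * INR H + 1) * PI * t = a - b); last by rewrite /a /b; ring.
rewrite (_ : (2 * (INR H + 1) + 1) * PI * t = a + b); last by rewrite /a /b; ring.
rewrite sin_minus sin_plus; ring.
Qed.

Lemma saw_remainder_derive (H : nat) (t : R) :
  is_derive (saw_remainder H) t (1 + \rsum_(1 <= h < H.+1) (2 * cos (2 * PI * INR h * t))).
Proof.
rewrite /saw_remainder; apply: (is_derive_plus (fun t => t - / 2)).
  by auto_derive => //; ring.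
elim: H => [|H IH].
  apply: (is_derive_ext (fun=> 0)); first by move=> s; rewrite big_geq.
  by rewrite big_geq //; apply: is_derive_const.
rewrite big_nat_recr //.
apply: (is_derive_ext (fun s => \rsum_(1 <= h < H.+1) (sin (2 * PI * INR h * s) / (PI * INR h)) +
   sin (2 * PI * INR H.+1 * s) / (PI * INR H.+1))); first by move=> s; rewrite [RHS]big_nat_recr.
apply: is_derive_plus => //.
have := INR_ge1 (ltn0Sn H); have P := PI_RGT_0; move: (INR H.+1) => x x1.
by auto_derive => //; field; lra.
Qed.

Lemma saw_remainder_half (H : nat) : saw_remainder H (/ 2) = 0.
Proof.
rewrite /saw_remainder big1; first by lra.
move=> h _; rewrite (_ : 2 * PI * INR h * / 2 = 0 + INR h * PI); last by field.
have -> : sin (0 + INR h * PI) = 0.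
  by apply: sin_eq_0_1; exists (Z.of_nat h); rewrite -INR_IZR_INZ; ring.
by rewrite /Rdiv Rmult_0_l.
Qed.

(* [R' = sin ((2H+1) pi t) / sin (pi t)]; one integration by parts gives the
   boundary term [G - R] below, and what remains is dominated by [k / sin (pi t)]. *)
Lemma saw_remainder_far (H : nat) (f : R) : 0 < f <= / 2 ->
  Rabs (saw_remainder H f) <= 2 / ((2 * INR H + 1) * PI * sin (PI * f)).
Proof.
move=> [f0 f1]; have P := PI_RGT_0; have H0 := pos_INR H.
pose c := 2 * INR H + 1; have c1 : 1 <= c by rewrite /c; lra.
pose k := / (c * PI).
have k0 : 0 < k by apply: Rinv_0_lt_compat; nra.
have s0 t : f <= t <= / 2 -> 0 < sin (PI * t) by move=> Ht; apply: sin_gt_0; nra.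
pose G t := saw_remainder H t + k * (cos (c * PI * t) / sin (PI * t)).
have GE (e : R) t : f <= t <= / 2 -> is_derive (fun t => G t + e * (k / sin (PI * t))) t
    (- (cos (PI * t) / (c * sin (PI * t) ^ 2)) * (cos (c * PI * t) + e)).
  move=> Ht; have st := s0 t Ht.
  have D1 : is_derive (fun t => k * (cos (c * PI * t) / sin (PI * t)) + e * (k / sin (PI * t))) t
     (- (sin (c * PI * t) / sin (PI * t)) -
     (cos (PI * t) / (c * sin (PI * t) ^ 2)) * (cos (c * PI * t) + e)).
    auto_derive; first by repeat split; lra.
    by rewrite /k; field; lra.
  apply: (is_derive_ext (fun t => saw_remainder H t +
     (k * (cos (c * PI * t) / sin (PI * t)) + e * (k / sin (PI * t))))).
    move=> s; have ext (a b c' d : R) : a + (b * c' + d) = a + b * c' + d by ring.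
    exact: ext.
  have D2 := is_derive_plus _ _ _ _ _ (saw_remainder_derive H t) D1.
  move: D2; rewrite /plus /= (_ : 1 + _ = sin (c * PI * t) / sin (PI * t)).
    rewrite (_ : sin (c * PI * t) / sin (PI * t) + _ =
       - (cos (PI * t) / (c * sin (PI * t) ^ 2)) * (cos (c * PI * t) + e)) //.
    by rewrite /=; ring.
  by rewrite /c -dirichlet_kernel; field; lra.
have Ghalf : G (/ 2) = 0.
  rewrite /G saw_remainder_half (_ : c * PI * / 2 = PI / 2 + INR H * PI); last by rewrite /c; field.
  have -> : cos (PI / 2 + INR H * PI) = 0.
    by apply: cos_eq_0_1; exists (Z.of_nat H); rewrite -INR_IZR_INZ; ring.
  by rewrite /Rdiv; ring.
have shalf : sin (PI * / 2) = 1 by rewrite -sin_PI2; congr sin.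
have sf := s0 f ltac:(lra).
(* For either sign [e] the function [G - e * k / sin] is monotone on [[f, 1/2]], because
   [cos (c PI t) - e] does not change sign; it is compared with its value at [1/2], where [G]
   vanishes. *)
have key (e : R) : e = 1 \/ e = -1 -> e * (G f) <= k / sin (PI * f).
  move=> He; have [->|fne] := Req_dec f (/ 2); first by rewrite Ghalf shalf; lra.
  have [x [Hx1 Hx2]] := @MVT_cor2 (fun t => G t - e * (k / sin (PI * t))) 
    (fun t => - (cos (PI * t) / (c * sin (PI * t) ^ 2)) * (cos (c * PI * t) - e)) f (/ 2) ltac:(lra)
    ltac:(move=> t Ht; apply/is_derive_Reals;
      apply: (is_derive_ext (fun t => G t + (- e) * (k / sin (PI * t)))); [move=> s /=; have ext (a b q : R) : a + - b * q = a - b * q by ring | exact: (GE (- e))]; exact: ext).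
  move: Hx1; rewrite Ghalf shalf.
  have sx := s0 x ltac:(lra).
  have q0 : 0 <= cos (PI * x) / (c * sin (PI * x) ^ 2).
    apply: Rdiv_le_0_compat; first by apply: cos_ge_0; nra.
    by apply: Rmult_lt_0_compat; [lra | nra].
  have [b1 b2] := COS_bound (c * PI * x).
  have ge0 : 0 <= cos (PI * x) / (c * sin (PI * x) ^ 2) * (/ 2 - f) by apply: Rmult_le_pos; lra.
  move: q0 ge0; set q := cos (PI * x) / _; move=> q0 ge0.
  case: He => -> Hx1.
    have : 0 <= q * (/ 2 - f) * (1 - cos (c * PI * x)) by apply: Rmult_le_pos; lra.
    by nra.
  have : 0 <= q * (/ 2 - f) * (1 + cos (c * PI * x)) by apply: Rmult_le_pos; lra.
  by nra.
have Gb : Rabs (G f) <= k / sin (PI * f).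
  by apply: Rabs_le; have := key 1 (or_introl erefl); have := key (-1) (or_intror erefl); lra.
have -> : saw_remainder H f = G f + - (k * (cos (c * PI * f) / sin (PI * f))) by rewrite /G; ring.
apply: Rle_trans (Rabs_triang _ _) _; rewrite Rabs_Ropp.
have : Rabs (k * (cos (c * PI * f) / sin (PI * f))) <= k / sin (PI * f).
  rewrite /Rdiv -Rmult_assoc Rabs_mult (Rabs_pos_eq (/ _)); last by apply: Rlt_le; apply: Rinv_0_lt_compat.
  apply: Rmult_le_compat_r; first by apply: Rlt_le; apply: Rinv_0_lt_compat.
  rewrite Rabs_mult (Rabs_pos_eq k); last lra.
  have : Rabs (cos (c * PI * f)) <= 1 by apply: Rabs_le; apply: COS_bound.
  nra.
rewrite (_ : 2 / (c * PI * sin (PI * f)) = 2 * (k / sin (PI * f))); last by rewrite /k; field; lra.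
lra.
Qed.

Lemma abs_sin_le x : Rabs (sin x) <= Rabs x.
Proof.
have pos t : 0 <= t -> Rabs (sin t) <= t.
  move=> t0; have [->|tn0] := Req_dec t 0; first by rewrite sin_0 Rabs_R0; lra.
  have [t1|t1] := Rle_lt_dec t 1.
    rewrite Rabs_pos_eq; last by apply: sin_ge_0 => //; have := PI2_1; lra.
    by apply: Rlt_le; apply: sin_lt_x; lra.
  by apply: Rle_trans (_ : _ <= 1) _; [apply: Rabs_le; apply: SIN_bound | lra].
have [x0|x0] := Rle_lt_dec 0 x; first by rewrite (Rabs_pos_eq x) //; exact: pos.
by rewrite (Rabs_left x) // -(Rabs_Ropp (sin x)) -sin_neg; apply: pos; lra.
Qed.

Lemma saw_remainder_near (H : nat) (f : R) : 0 <= f <= / 2 ->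
  Rabs (saw_remainder H f) <= / 2 + 2 * INR H * f.
Proof.
move=> [f0 f1]; rewrite /saw_remainder; have P := PI_RGT_0.
apply: Rle_trans (Rabs_triang _ _) _; apply: Rplus_le_compat.
  by apply: Rabs_le; lra.
apply: Rle_trans (sum_abs _ _ _) _.
apply: Rle_trans (@sum1_le_const _ (2 * f) _ _) _; last by apply: Req_le; ring.
move=> h /andP[h1 _]; have h1' := INR_ge1 h1.
have Ph : 0 < PI * INR h by nra.
rewrite /Rdiv Rabs_mult (Rabs_pos_eq (/ _)); last by apply: Rlt_le; apply: Rinv_0_lt_compat.
apply: (Rmult_le_reg_r (PI * INR h)) => //; rewrite Rmult_assoc Rinv_l ?Rmult_1_r; last lra.
apply: Rle_trans (abs_sin_le _) _; rewrite Rabs_pos_eq; first by nra.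
by apply: Rmult_le_pos => //; nra.
Qed.

(** The squared modulus of a geometric sum of exponentials, normalised so that the peaks at the
    integers have height [1]. *)
Definition fejer (M : nat) (f : R) : R :=
  ((\rsum_(0 <= i < M) cos (2 * PI * INR i * f)) ^ 2 +
   (\rsum_(0 <= i < M) sin (2 * PI * INR i * f)) ^ 2) / INR M ^ 2.

Lemma fejer_ge0 M f : (0 < M)%N -> 0 <= fejer M f.
Proof.
move=> /INR_ge1 M1; apply: Rdiv_le_0_compat; last by nra.
by apply: Rplus_le_le_0_compat; apply: pow2_ge_0.
Qed.

Lemma cos_INR_sym i f : cos (2 * PI * INR i * (1 - f)) = cos (2 * PI * INR i * f).
Proof.
rewrite (_ : 2 * PI * INR i * (1 - f) = - (2 * PI * INR i * f) + 2 * INR i * PI); last by ring.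
by rewrite cos_period cos_neg.
Qed.

Lemma sin_INR_sym i f : sin (2 * PI * INR i * (1 - f)) = - sin (2 * PI * INR i * f).
Proof.
rewrite (_ : 2 * PI * INR i * (1 - f) = - (2 * PI * INR i * f) + 2 * INR i * PI); last by ring.
by rewrite sin_period sin_neg.
Qed.

Lemma fejer_sym M f : fejer M (1 - f) = fejer M f.
Proof.
rewrite /fejer; congr (_ / _); congr (_ + _).
  by congr (_ ^ _); apply: eq_bigr => i _; rewrite cos_INR_sym.
rewrite (eq_bigr (fun i => - sin (2 * PI * INR i * f))); last by move=> i _; rewrite sin_INR_sym.
by rewrite sum_opp; ring.
Qed.

Lemma saw_remainder_sym H f : saw_remainder H (1 - f) = - saw_remainder H f.
Proof.
rewrite /saw_remainder (eq_bigr (fun h => - (sin (2 * PI * INR h * f) / (PI * INR h)))).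
  by rewrite sum_opp; lra.
by move=> h _; rewrite sin_INR_sym /Rdiv; ring.
Qed.

(** All angles stay below [PI / 3], so each cosine is at least [1/2]. *)
Lemma fejer_small M f : (0 < M)%N -> 0 <= f -> INR M * f <= / 6 -> / 4 <= fejer M f.
Proof.
move=> M0 f0 Mf; have M1 := INR_ge1 M0; have P := PI_RGT_0.
have H : INR M * / 2 <= \rsum_(0 <= i < M) cos (2 * PI * INR i * f).
  rewrite -[M in INR M](subn0 M) -sum_const; apply: sum_le => i /andP[_ iM].
  have i0 := pos_INR i; have iM' := leq_INR (ltnW iM).
  have if6 : 0 <= INR i * f <= / 6 by split; nra.
  rewrite (_ : / 2 = cos (PI / 3)); last by rewrite cos_PI3; field.
  by apply: cos_decr_1; nra.
have S0 := pow2_ge_0 (\rsum_(0 <= i < M) sin (2 * PI * INR i * f)).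
rewrite /fejer; apply Rle_div_r; first by nra.
by nra.
Qed.

(** The average of [fejer M f] over [M <= H] is at least of order [min 1 (1 / (H f))], since each
    [M] with [M f <= 1/6] contributes [1/4]. The remainder is at most of that order, trivially near
    [0] and by [saw_remainder_far] elsewhere. *)
Lemma saw_remainder_le_fejer_half (H : nat) (f : R) : (0 < H)%N -> 0 <= f <= / 2 ->
  Rabs (saw_remainder H f) <= 12 / INR H * \rsum_(1 <= M < H.+1) fejer M f.
Proof.
move=> H0 [f0 f1]; have H1 := INR_ge1 H0; have P := PI_RGT_0.
have near := saw_remainder_near H (conj f0 f1).
have count (m : nat) : (m <= H)%N -> INR m * f <= / 6 ->
    INR m * / 4 <= \rsum_(1 <= M < H.+1) fejer M f.
  move=> mH mf; apply: (Rle_trans _ (\rsum_(1 <= M < m.+1) fejer M f)).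
    have <- : \rsum_(1 <= M < m.+1) (/ 4) = INR m * / 4 by rewrite sum_const subSS subn0.
    apply: sum_le => M /andP[M1 M2].
    apply: fejer_small => //; apply: Rle_trans mf; apply: Rmult_le_compat_r => //.
    exact: leq_INR.
  by apply: sum_incl => // M /andP[M1 _]; apply: fejer_ge0.
have [Hf|Hf] := Rle_lt_dec (INR H * f) (/ 6).
  have := count H (leqnn H) Hf; set S := \rsum_(_ <= _ < _) _; move=> HS.
  rewrite (_ : 12 / INR H * S = 12 * (S / INR H)); last by field; lra.
  have : / 4 <= S / INR H by apply Rle_div_r; lra.
  by nra.
have fp : 0 < f by nra.
have far := saw_remainder_far H (conj fp f1).
have sf : PI * f / 2 <= sin (PI * f) by apply: half_x_le_sin; nra.
(* This combines [sin (PI f) >= PI f / 2] with [PI^2 >= 8], which follows from [PI > 3]. *)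
have far' : Rabs (saw_remainder H f) <= / (4 * INR H * f).
  apply: Rle_trans far _; have HP := PI2_3_2.
  rewrite (_ : / (4 * INR H * f) = 2 / (8 * INR H * f)); last by field; lra.
  apply: Rmult_le_compat_l; first lra.
  apply: Rinv_le_contravar; first by nra.
  have h1 : PI * (PI * f / 2) <= PI * sin (PI * f) by apply: Rmult_le_compat_l; lra.
  have h2 : 4 * f <= PI * (PI * f / 2).
    have : 9 * f <= PI * PI * f by apply: Rmult_le_compat_r; [lra | nra].
    lra.
  have h3 : (2 * INR H + 1) * (4 * f) <= (2 * INR H + 1) * (PI * sin (PI * f)).
    by apply: Rmult_le_compat_l; lra.
  nra.
(* the number of [M <= H] with [6 M f <= 1] is at least [1 / (12 f)] when [f <= 1/6] *)
suff HS : / (48 * f) <= \rsum_(1 <= M < H.+1) fejer M f.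
  apply: Rle_trans far' _; rewrite (_ : / (4 * INR H * f) = 12 / INR H * / (48 * f)); last by field; lra.
  apply: Rmult_le_compat_l => //; apply: Rdiv_le_0_compat; lra.
(* For [f > 1/6] no [M] is counted, but [fejer 1] is identically [1]. *)
have [f6|f6] := Rle_lt_dec f (/ 6); last first.
  apply: (Rle_trans _ 1).
    by rewrite -Rinv_1; apply: Rinv_le_contravar; lra.
  apply: (Rle_trans _ (fejer 1 f)).
    by rewrite /fejer !big_nat1 /= !Rmult_0_r !Rmult_0_l cos_0 sin_0; lra.
  apply: (@sum_ge_term (fun M => fejer M f) 1 H.+1 1%N) => // M /andP[M1 _]; exact: fejer_ge0.
have f6p : 0 <= / (6 * f) by apply: Rlt_le; apply: Rinv_0_lt_compat; lra.
have [m [m1 m2]] := nfloor_ex _ f6p.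
have mf : INR m * f <= / 6.
  have : INR m * f <= / (6 * f) * f by apply: Rmult_le_compat_r.
  by rewrite (_ : / (6 * f) * f = / 6) //; field; lra.
have mH : (m <= H)%N.
  apply/leP; apply: INR_le; apply: (Rmult_le_reg_r f) => //; lra.
have f6' : 1 <= / (6 * f) by rewrite -Rinv_1; apply: Rinv_le_contravar; lra.
have m0 : 1 <= INR m.
  by apply: (le_INR 1); apply: INR_lt; rewrite /=; lra.
apply: Rle_trans (count m mH mf); rewrite (_ : / (48 * f) = / (6 * f) * / 8); last by field; lra.
lra.
Qed.

Lemma saw_remainder_le_fejer (H : nat) (f : R) : (0 < H)%N -> 0 <= f <= 1 ->
  Rabs (saw_remainder H f) <= 12 / INR H * \rsum_(1 <= M < H.+1) fejer M f.
Proof.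
move=> H0 [f0 f1]; have [h|h] := Rle_lt_dec f (/ 2).
  by apply: saw_remainder_le_fejer_half.
rewrite -(Rabs_Ropp (saw_remainder H f)) -saw_remainder_sym.
rewrite (eq_bigr (fun M => fejer M (1 - f))); last by move=> M _; rewrite fejer_sym.
by apply: saw_remainder_le_fejer_half => //; lra.
Qed.

Definition saw (n m : nat) : R := INR (n %% m) / INR m - / 2.

Lemma saw_abs n m : (0 < m)%N -> Rabs (saw n m) <= / 2.
Proof.
move=> m0; have m1 := INR_ge1 m0; have := ltn_INR (ltn_pmod n m0); have := pos_INR (n %% m).
move=> h1 h2; have : INR (n %% m) / INR m <= 1 by apply Rle_div_l; lra.
have : 0 <= INR (n %% m) / INR m by apply: Rdiv_le_0_compat; lra.
by move=> *; apply: Rabs_le; rewrite /saw; lra.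
Qed.

Lemma trig_mod (g : R -> R) (n m h : nat) : (forall x k, g (x + 2 * INR k * PI) = g x) ->
  (0 < m)%N ->
  g (2 * PI * INR h * (INR (n %% m) / INR m)) = g (2 * PI * (INR h * INR n) / INR m).
Proof.
move=> per m0; have m1 := INR_ge1 m0.
rewrite -(per _ (h * (n %/ m))%N); congr g.
have E : INR n = INR (n %/ m) * INR m + INR (n %% m) by rewrite -INR_mul -INR_add -divn_eq.
by rewrite E INR_mul; field; lra.
Qed.

(* A weighted Erdos-Turan inequality: the truncated Fourier series of the sawtooth leaves a
   remainder dominated by an average of Fejer kernels, whose coefficients are again harmonics. *)
Lemma weighted_saw_sum (w : nat -> R) (n y N H : nat) (B W : R) :
  (0 < H)%N -> (forall m, 0 <= w m) ->
  (forall h al, (0 < h <= H)%N ->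
    Rabs (\rsum_(1 <= m < N.+1) (w m * osc (INR h * INR n) al y N m)) <= B) ->
  \rsum_(1 <= m < N.+1) (if (y < m)%N then w m else 0) <= W ->
  Rabs (\rsum_(1 <= m < N.+1) (if (y < m)%N then w m * saw n m else 0)) <=
    (1 + ln (INR H)) * B + 12 * (B + W * (1 + ln (INR H)) / INR H).
Proof.
move=> H0 w0 HB HW; have H1 := INR_ge1 H0; have P := PI_RGT_0.
have B0 : 0 <= B by apply: Rle_trans (HB 1%N 0 _); [exact: Rabs_pos | rewrite H0].
have P2 : / PI <= 1 by rewrite -Rinv_1; apply: Rinv_le_contravar; have := PI2_1; lra.
pose fr m := INR (n %% m) / INR m.
have fr01 m : (0 < m)%N -> 0 <= fr m <= 1.
  move=> m0; have := saw_abs n m0; rewrite /saw -/(fr m) => /Rabs_le_between; lra.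
have oscE h al m : (0 < m < N.+1)%N -> osc (INR h * INR n) al y N m =
    if (y < m)%N then cos (2 * PI * (INR h * INR n) / INR m + al) else 0.
  by move=> /andP[_ mN]; rewrite /osc -(ltnS m N) mN andbT.
pose v m := if (y < m)%N then w m else 0.
have v0 m : 0 <= v m by rewrite /v; case: ifP => _; [exact: w0 | lra].
have cosv h : (0 < h <= H)%N -> Rabs (\rsum_(1 <= m < N.+1) (v m * cos (2 * PI * INR h * fr m))) <= B.
  move=> hH; apply: Rle_trans (HB h 0 hH); apply: Req_le; congr Rabs.
  apply: eq_big_nat => m /andP[m1 m2]; rewrite oscE ?m1 // /v (trig_mod _ _ cos_period) // Rplus_0_r.
  by case: ifP => _; ring.
(* The sine is the cosine with phase shift [- PI / 2]; this is one use of the free phase [al]. *)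
have sinv h : (0 < h <= H)%N -> Rabs (\rsum_(1 <= m < N.+1) (v m * sin (2 * PI * INR h * fr m))) <= B.
  move=> hH; apply: Rle_trans (HB h (- (PI / 2)) hH); apply: Req_le; congr Rabs.
  apply: eq_big_nat => m /andP[m1 m2]; rewrite oscE ?m1 // /v (trig_mod _ _ sin_period) //.
  rewrite -cos_shift -cos_neg; set a := 2 * PI * _ / _.
  by rewrite (_ : - (PI / 2 - a) = a + - (PI / 2)); [case: ifP => _; ring | ring].
have -> : \rsum_(1 <= m < N.+1) (if (y < m)%N then w m * saw n m else 0) =
    \rsum_(1 <= m < N.+1) (v m * saw_remainder H (fr m)) -
    \rsum_(1 <= h < H.+1) (/ (PI * INR h) * \rsum_(1 <= m < N.+1) (v m * sin (2 * PI * INR h * fr m))).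
  rewrite [X in _ - X](eq_bigr (fun h => \rsum_(1 <= m < N.+1) (/ (PI * INR h) * (v m * sin (2 * PI * INR h * fr m)))));
    last by move=> h _; rewrite big_distrr.
  rewrite exchange_big -sum_sub; apply: eq_bigr => m _ /=.
  rewrite (eq_bigr (fun h => v m * (sin (2 * PI * INR h * fr m) / (PI * INR h)))); last first.
    by move=> h _; rewrite /Rdiv; ring.
  rewrite -big_distrr /= /saw_remainder /saw -/(fr m) /v; case: ifP => _; ring.
apply: Rle_trans (Rabs_triang _ _) _; rewrite Rabs_Ropp Rplus_comm; apply: Rplus_le_compat.
  apply: Rle_trans (sum_abs _ _ _) _.
  apply: (Rle_trans _ (\rsum_(1 <= h < H.+1) (/ INR h * B))).
    apply: sum_le => h /andP[h1 h2]; have h1' := INR_ge1 h1.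
    have ih : 0 < / INR h by apply: Rinv_0_lt_compat; lra.
    have iP : 0 < / PI by apply: Rinv_0_lt_compat.
    rewrite Rabs_mult Rinv_mult Rabs_pos_eq; last by nra.
    by apply: Rmult_le_compat; [nra | exact: Rabs_pos | nra | apply: sinv; rewrite h1].
  by rewrite -big_distrl /=; apply: Rmult_le_compat_r => //; exact: harmonic_le.
apply: Rle_trans (sum_abs _ _ _) _.
apply: (Rle_trans _ (\rsum_(1 <= m < N.+1) \rsum_(1 <= M < H.+1) (v m * (12 / INR H * fejer M (fr m))))).
  apply: sum_le => m /andP[m1 _]; rewrite Rabs_mult (Rabs_pos_eq (v m)) // -big_distrr /= -big_distrr /=.
  by apply: Rmult_le_compat_l => //; apply: saw_remainder_le_fejer => //; exact: fr01.
rewrite exchange_big /=.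
have fejer_sum M : (0 < M <= H)%N -> \rsum_(1 <= m < N.+1) (v m * fejer M (fr m)) <= W * / INR M + B.
  move=> /andP[M0 MH]; have M1 := INR_ge1 M0.
  (* Truncated subtraction is harmless: the cosine is even, and [E] is used with the larger index
     first. *)
  pose E i j := \rsum_(1 <= m < N.+1) (v m * cos (2 * PI * INR (i - j) * fr m)).
  have -> : \rsum_(1 <= m < N.+1) (v m * fejer M (fr m)) =
      / INR M ^ 2 * \rsum_(0 <= i < M) \rsum_(0 <= j < M) (if (j <= i)%N then E i j else E j i).
    transitivity (/ INR M ^ 2 * \rsum_(0 <= i < M) \rsum_(0 <= j < M) \rsum_(1 <= m < N.+1)
      (v m * cos (2 * PI * INR i * fr m - 2 * PI * INR j * fr m))); last first.
      congr (_ * _); apply: eq_bigr => i _; apply: eq_bigr => j _.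
      case: leqP => ij; apply: eq_bigr => m _; congr (_ * _).
        by rewrite minus_INR; [congr cos; ring | apply/leP].
      by rewrite minus_INR; [rewrite -cos_neg; congr cos; ring | apply/leP; apply: ltnW].
    transitivity (/ INR M ^ 2 * \rsum_(1 <= m < N.+1) \rsum_(0 <= i < M) \rsum_(0 <= j < M)
      (v m * cos (2 * PI * INR i * fr m - 2 * PI * INR j * fr m))); last first.
      congr (_ * _); rewrite exchange_big; apply: eq_bigr => i _ /=; rewrite exchange_big.
      by apply: eq_bigr.
    rewrite big_distrr; apply: eq_bigr => m _ /=; rewrite /fejer.
    rewrite (_ : v m * (_ / _) = / INR M ^ 2 * (v m *
      ((\rsum_(0 <= i < M) cos (2 * PI * INR i * fr m)) ^ 2 +
       (\rsum_(0 <= i < M) sin (2 * PI * INR i * fr m)) ^ 2))); last by rewrite /Rdiv; ring.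
    congr (_ * _); rewrite /= !Rmult_1_r !big_distrlr -big_split big_distrr.
    apply: eq_bigr => i _; rewrite -big_split big_distrr; apply: eq_bigr => j _ /=.
    by rewrite cos_minus.
  have M2 : 0 < INR M ^ 2 by nra.
  apply: (Rle_trans _ (/ INR M ^ 2 * \rsum_(0 <= i < M) (W + INR M * B))); last first.
    by rewrite sum_const subn0; apply: Req_le; field; lra.
  apply: Rmult_le_compat_l; first by apply: Rlt_le; apply: Rinv_0_lt_compat.
  apply: sum_le => i /andP[_ iM].
  (* The diagonal is bounded by [W]; off it the frequency [|i - j|] lies between [1] and [H], where
     [B] applies. *)
  apply: (Rle_trans _ (\rsum_(0 <= j < M) ((if j == i then W else 0) + B))).
    apply: sum_le => j /andP[_ jM]; case: eqP => [->|/eqP ij].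
      rewrite leqnn /E subnn; apply: Rle_trans (_ : _ <= W) _; last lra.
      apply: Rle_trans HW; apply: Req_le; apply: eq_bigr => m _.
      by rewrite /= Rmult_0_r Rmult_0_l cos_0 /v; ring.
    rewrite Rplus_0_l; case: leqP => ij'; apply: Rle_trans (Rle_abs _) _; apply: cosv; lia.
  rewrite big_split sum_const subn0 /=; apply: Rplus_le_compat_r.
  rewrite (@sum_single _ i) ?eqxx //; first lra.
  by move=> j _ /negbTE ->.
apply: (Rle_trans _ (\rsum_(1 <= M < H.+1) (12 / INR H * (W * / INR M + B)))).
  apply: sum_le => M /andP[M1 M2].
  rewrite (eq_bigr (fun m => 12 / INR H * (v m * fejer M (fr m)))); last by move=> m _; ring.
  rewrite -big_distrr /=; apply: Rmult_le_compat_l; first by apply: Rdiv_le_0_compat; lra.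
  by apply: fejer_sum; rewrite M1.
rewrite -big_distrr big_split /= -big_distrr /= sum_const subSS subn0.
have W0 : 0 <= W by apply: Rle_trans HW; apply: sum_ge0 => m _; exact: v0.
have Hh := Rmult_le_compat_l _ _ _ W0 (harmonic_le H0).
rewrite (_ : 12 * (B + W * (1 + ln (INR H)) / INR H) =
   12 / INR H * (W * (1 + ln (INR H)) + INR H * B)); last by field; lra.
by apply: Rmult_le_compat_l; [apply: Rdiv_le_0_compat; lra | lra].
Qed.

(** * The sawtooth over primes *)

Definition prime_log (p : nat) : R := if prime p then ln (INR p) else 0.

Lemma prime_log_ge0 p : 0 <= prime_log p.
Proof. by rewrite /prime_log; case: ifP => _; [exact: ln_INR_ge0 | lra]. Qed.

Lemma prime_log_le p : prime_log p <= ln (INR p).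
Proof. by rewrite /prime_log; case: ifP => _; [lra | exact: ln_INR_ge0]. Qed.

Lemma mangoldt_split m N : (0 < m <= N)%N ->
  mangoldt m = prime_log m + \rsum_(1 <= p < N.+1 | prime p) \rsum_(2 <= k < N.+1)
    (if (p ^ k == m)%N then ln (INR p) else 0).
Proof.
move=> mN; have /andP[m0 mN'] := mN; rewrite (mangoldt_widen mN).
rewrite (eq_bigr (fun p => (if p == m then ln (INR p) else 0) +
   \rsum_(2 <= k < N.+1) (if (p ^ k == m)%N then ln (INR p) else 0))); last first.
  by move=> p _; rewrite big_ltn //; lia.
rewrite big_split /= big_mkcond; congr (_ + _).
rewrite (@sum_single _ m); [by rewrite eqxx | lia |].
by move=> i _ /negbTE ->; rewrite if_same.
Qed.

(** Here [s] bounds the square root of [N]. A power [p ^ k <= N] with [k >= 2] has [p <= s], at most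
    [2 el] values of [k] occur, and each weighs [ln p <= el]. *)
Lemma prime_power_sum_le (N : nat) (s el : R) : (0 < N)%N -> 1 + ln (INR N) <= el ->
  0 <= s -> INR N <= s ^ 2 ->
  \rsum_(1 <= m < N.+1) (mangoldt m - prime_log m) <= 2 * s * el ^ 2.
Proof.
move=> N0 lN s0 sN; have N1 := INR_ge1 N0; have lN0 := ln_INR_ge0 N.
have [J [NJ JB]] := dyadic_exponent N0.
rewrite (@eq_big_nat _ _ _ _ _ _ (fun m => \rsum_(1 <= p < N.+1 | prime p) \rsum_(2 <= k < N.+1)
    (if (p ^ k == m)%N then ln (INR p) else 0))); last first.
  by move=> m /andP[m1 m2]; rewrite (@mangoldt_split m N) ?m1 //; lra.
rewrite exchange_big /=.
apply: (Rle_trans _ (\rsum_(1 <= p < N.+1) ((if (p ^ 2 <= N)%N then 1 else 0) * (INR J * el)))).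
  rewrite big_mkcond; apply: sum_le => p /andP[p1 p2].
  have Je : 0 <= INR J * el by apply: Rmult_le_pos; [exact: pos_INR | lra].
  case: ifP => pp; last by case: ifP => _; lra.
  have pg := prime_gt1 pp.
  have term k : (2 <= k)%N -> \rsum_(1 <= m < N.+1) (if (p ^ k == m)%N then ln (INR p) else 0) <=
      if (p ^ 2 <= N)%N && (k < J.+1)%N then el else 0.
    move=> k2; have [pkN|Npk] := leqP (p ^ k) N; last first.
      rewrite big_nat big1; first by case: ifP => _; lra.
      by move=> m /andP[m1 m2]; case: eqP => // E; move: Npk; rewrite E; lia.
    rewrite (@sum_single _ (p ^ k)%N) ?eqxx; first last.
    - by move=> i _; rewrite eq_sym => /negbTE ->.
    - by rewrite expn_gt0 (ltnW pg).
    have -> : (p ^ 2 <= N)%N by apply: leq_trans pkN; rewrite leq_exp2l.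
    have -> /= : (k < J.+1)%N.
      rewrite ltnS -(leq_exp2l (m := 2)) //; apply: leq_trans NJ; apply: leq_trans pkN.
      by rewrite leq_exp2r //; lia.
    have : ln (INR p) <= ln (INR N) by apply: ln_INR_le; lia.
    lra.
  rewrite exchange_big /=.
  apply: (Rle_trans _ (\rsum_(2 <= k < N.+1) (if (p ^ 2 <= N)%N && (k < J.+1)%N then el else 0))).
    by apply: sum_le => k /andP[k2 _]; exact: term.
  case: ifP => _ /=; last by rewrite big1 //; lra.
  rewrite Rmult_1_l -big_mkcond.
  apply: (Rle_trans _ (\rsum_(1 <= k < J.+1) el)); last by rewrite sum_const subSS subn0; lra.
  rewrite big_mkcond; apply: (Rle_trans _ (\rsum_(1 <= k < N.+1) (if (k < J.+1)%N then el else 0))).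
    by apply: sum_incl => // k _; case: ifP => _; lra.
  have [JN|NJ'] := leqP J N.
    by rewrite [X in _ <= X](@big_nat_widen _ _ _ 1 J.+1 N.+1) // [X in _ <= X]big_mkcond /=; lra.
  apply: (Rle_trans _ (\rsum_(1 <= k < N.+1) el)).
    by apply: sum_le => k _; case: ifP => _; lra.
  by apply: sum_incl => //; [lia | move=> *; lra].
rewrite -big_distrl /=.
have cnt : \rsum_(1 <= p < N.+1) (if (p ^ 2 <= N)%N then 1 else 0) <= s.
  have [q [q1 q2]] := nfloor_ex s s0.
  apply: (Rle_trans _ (INR q)) => //.
  have qN : (N < q.+1 ^ 2)%N.
    apply/ltP; apply: INR_lt; rewrite INR_expn S_INR.
    have : s ^ 2 < (INR q + 1) ^ 2 by nra.
    lra.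
  have sm p : (p ^ 2 <= N)%N -> (p < q.+1)%N.
    move=> pN; rewrite -(ltn_exp2r _ _ (isT : (0 < 2)%N)).
    exact: leq_ltn_trans qN.
  apply: (Rle_trans _ (\rsum_(1 <= p < N.+1) (if (p < q.+1)%N then 1 else 0))).
    apply: sum_le => p _; case: ifP => H; last by case: ifP => _; lra.
    by rewrite (sm p H); lra.
  have [qN'|Nq] := leqP q N.
    have : \rsum_(1 <= p < q.+1) 1 = INR q by rewrite sum_const subSS subn0; lra.
    by rewrite (@big_nat_widen _ _ _ 1 q.+1 N.+1) // big_mkcond /= => ->; lra.
  apply: (Rle_trans _ (INR N * 1)); last by have := leq_INR (ltnW Nq); lra.
  by apply: sum1_le_const => k _; case: ifP => _; lra.
have Je : INR J * el <= 2 * el * el by apply: Rmult_le_compat_r; lra.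
have Je0 : 0 <= INR J * el by apply: Rmult_le_pos; [exact: pos_INR | lra].
rewrite (_ : 2 * s * el ^ 2 = s * (2 * el * el)); last by ring.
apply: Rmult_le_compat => //.
by apply: sum_ge0 => p _; case: ifP => _; lra.
Qed.

Lemma block_saw_sum (n y N u : nat) (el : R) : regime n y N u el ->
  Rabs (\rsum_(1 <= p < N.+1) (if (y < p)%N then prime_log p * saw n p else 0)) <=
  7112 * INR y / INR u ^ 10 * (el ^ 3 * sqrt el).
Proof.
move=> rg; have u0 := regime_u rg; have e := regime_el1 rg; have w1 := regime_w1 rg.
have y1 := INR_ge1 (regime_y0 rg); have N0 := regime_N0 rg.
set T := INR y / INR u ^ 10 * (el * sqrt el).
have w10 : 0 < INR u ^ 10 by apply: pow_lt; lra.
have T0 : INR y / INR u ^ 10 <= T := target_lower rg.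
have Tp : 0 <= INR y / INR u ^ 10 by apply: Rdiv_le_0_compat; lra.
have lN : 1 + ln (INR N) <= el by apply: (regime_lnN rg); rewrite N0 leqnn.
have /andP[yN N2y] := regime_yN rg.
have un : (0 < u ^ 10 <= n)%N.
  rewrite expn_gt0 u0 /=; apply/leP; apply: INR_le; rewrite INR_expn.
  apply: Rle_trans (regime_n rg).
  have : INR u ^ 10 <= INR u ^ 40 by apply: Rle_pow => //; apply/leP.
  by nra.
have lH : 1 + ln (INR (u ^ 10)) <= el.
  by have := ln_INR_le un; have := regime_log rg; lra.
have lH0 : 1 <= 1 + ln (INR (u ^ 10)) by have := ln_INR_ge0 (u ^ 10); lra.
have HW : \rsum_(1 <= m < N.+1) (if (y < m)%N then mangoldt m else 0) <= INR y * el.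
  apply: (Rle_trans _ (\rsum_(y.+1 <= m < N.+1) el)).
    rewrite -big_mkcond (@big_nat_widenl _ _ _ y.+1 1 N.+1) //.
    rewrite [X in _ <= X]big_mkcond [X in X <= _]big_mkcond; apply: sum_le => m /andP[m1 m2] /=.
    case: ifP => _; last lra.
    have mN : (0 < m <= N)%N by rewrite m1.
    by have := mangoldt_le_ln m; have := regime_lnN rg mN; lra.
  rewrite sum_const; apply: Rmult_le_compat_r; first lra.
  by apply: leq_INR; lia.
have main := @weighted_saw_sum mangoldt n y N (u ^ 10) (546 * el * T) (INR y * el)
  (proj1 (andP un)) mangoldt_ge0 (fun h al hh => mangoldt_osc_sum rg al hh) HW.
have s0 : 0 <= sqrt (2 * INR y) by exact: sqrt_pos.
have s2 : sqrt (2 * INR y) ^ 2 = 2 * INR y by rewrite /= Rmult_1_r sqrt_sqrt //; lra.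
have pp : \rsum_(1 <= m < N.+1) (mangoldt m - prime_log m) <= 2 * sqrt (2 * INR y) * el ^ 2.
  apply: prime_power_sum_le => //; rewrite s2.
  by have := leq_INR N2y; rewrite INR_mul.
(* [2 y <= (y / w^10)^2] because [y >= 4 w^80]; the proper prime powers thus stay below the
   target. *)
have sT : sqrt (2 * INR y) <= T.
  apply: Rle_trans T0; apply: Rsqr_incr_0_var => //; rewrite /Rsqr.
  rewrite (_ : sqrt (2 * INR y) * sqrt (2 * INR y) = 2 * INR y); last by rewrite -[RHS]s2; ring.
  have H := regime_wy rg.
  have w80 : INR u ^ 20 <= INR u ^ 80 by apply: Rle_pow => //; apply/leP.
  have w20 : 0 < INR u ^ 20 by apply: pow_lt; lra.
  rewrite (_ : INR y / INR u ^ 10 * (INR y / INR u ^ 10) = INR y * INR y / INR u ^ 20); last by field; lra.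
  apply: (proj1 (Rle_div_r _ _ _ w20)).
  rewrite (_ : 2 * INR y * INR u ^ 20 = INR y * (2 * INR u ^ 20)); last by ring.
  by apply: Rmult_le_compat_l; lra.
have diff : Rabs (\rsum_(1 <= m < N.+1) (if (y < m)%N then prime_log m * saw n m else 0) -
   \rsum_(1 <= m < N.+1) (if (y < m)%N then mangoldt m * saw n m else 0)) <=
   \rsum_(1 <= m < N.+1) (mangoldt m - prime_log m).
  rewrite -sum_sub; apply: Rle_trans (sum_abs _ _ _) _; apply: sum_le => m /andP[m1 m2].
  have d0 : 0 <= mangoldt m - prime_log m.
    rewrite (@mangoldt_split m N) ?m1 // (_ : forall a b, a + b - a = b); last by move=> *; ring.
    rewrite big_mkcond; apply: sum_ge0 => p _; case: ifP => _; last lra.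
    by apply: sum_ge0 => k _; case: ifP => _; [exact: ln_INR_ge0 | lra].
  case: ifP => _; last by rewrite Rminus_0_r Rabs_R0.
  rewrite (_ : prime_log m * saw n m - mangoldt m * saw n m = - (mangoldt m - prime_log m) * saw n m);
    last by ring.
  rewrite Rabs_mult Rabs_Ropp Rabs_pos_eq //.
  by have := saw_abs n m1; have := Rabs_pos (saw n m); nra.
move: main diff; set S1 := \rsum_(_ <= _ < _) _; set S2 := \rsum_(_ <= _ < _) _ => main diff.
have -> : S2 = (S2 - S1) + S1 by ring.
apply: Rle_trans (Rabs_triang _ _) _.
(* [7112 = 546 + 12 * (546 + 1) + 2]: the harmonics, the Fejer average with its diagonal term, and
   the prime powers. *)
have eT : 7112 * INR y / INR u ^ 10 * (el ^ 3 * sqrt el) = 7112 * (el ^ 2 * T) by rewrite /T; field; lra.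
rewrite eT.
have T00 : 0 <= T by lra.
have e2 : el <= el ^ 2 by nra.
have e2T : el * T <= el ^ 2 * T by apply: Rmult_le_compat_r.
have b1 : (1 + ln (INR (u ^ 10))) * (546 * el * T) <= 546 * (el ^ 2 * T).
  rewrite (_ : 546 * (el ^ 2 * T) = el * (546 * el * T)); last by ring.
  by apply: Rmult_le_compat_r => //; nra.
have b2 : INR y * el * (1 + ln (INR (u ^ 10))) / INR (u ^ 10) <= el ^ 2 * T.
  rewrite INR_expn in lH lH0 *.
  rewrite (_ : INR y * el * (1 + ln (INR u ^ 10)) / INR u ^ 10 =
     (INR y / INR u ^ 10) * (el * (1 + ln (INR u ^ 10)))); last by field; lra.
  rewrite (_ : el ^ 2 * T = T * (el * el)); last by ring.
  by apply: Rmult_le_compat => //; [nra | nra].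
have b3 : 2 * sqrt (2 * INR y) * el ^ 2 <= 2 * (el ^ 2 * T).
  rewrite (_ : 2 * (el ^ 2 * T) = 2 * T * el ^ 2); last by ring.
  by apply: Rmult_le_compat_r; [nra | lra].
have e0 : 0 <= el ^ 2 * T by apply: Rmult_le_pos => //; nra.
lra.
Qed.

(** * Choice of the scale and summation over blocks *)

Lemma exists_scale (n y : nat) : (0 < y)%N ->
  exists u, (2 * u ^ 40 * y <= n < 2 * u.+1 ^ 40 * y)%N.
Proof.
move=> y0; pose P u := (2 * u ^ 40 * y <= n)%N.
have exP : exists u, P u by exists 0%N; rewrite /P exp0n // muln0 mul0n.
have ubP u : P u -> (u <= n)%N.
  move=> Pu; apply: leq_trans Pu; rewrite mulnAC.
  have [->//|u0] := posnP u.
  apply: (@leq_trans (u ^ 40)); first by rewrite -{1}(expn1 u) leq_pexp2l.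
  by rewrite leq_pmull // muln_gt0.
case: (ex_maxnP exP ubP) => u Pu max_u; exists u; rewrite [X in X && _]Pu /= ltnNge.
by apply/negP => /max_u; rewrite ltnn.
Qed.

(** Multiplied by [n] this is [y^(5/4) n^(3/4)], the shape of the final bound. *)
Definition fourth_root_weight (n : nat) (y : R) : R := y * Rpower (y / INR n) (1 / 4).

Lemma Rpower_quarter_pow4 x : 0 < x -> Rpower x (1 / 4) ^ 4 = x.
Proof.
move=> x0; rewrite -Rpower_pow; last exact: exp_pos.
rewrite Rpower_mult (_ : 1 / 4 * INR 4 = 1); first exact: Rpower_1.
by rewrite /=; field.
Qed.

Lemma quarter_lower (n y : nat) (X : R) : (0 < y)%N -> (0 < n)%N -> 0 <= X ->
  INR n <= X ^ 4 * INR y -> 1 <= X * Rpower (INR y / INR n) (1 / 4).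
Proof.
move=> y0 n0 X0 H; have y1 := INR_ge1 y0; have n1 := INR_ge1 n0.
have q0 : 0 < INR y / INR n by apply: Rdiv_lt_0_compat; lra.
have := Rpower_quarter_pow4 q0; set g := Rpower _ _ => g4.
have g0 : 0 < g by exact: exp_pos.
have [//|lt] := Rle_lt_dec 1 (X * g).
have X4 : (X * g) ^ 4 < 1.
  rewrite -(pow1 4); have Xg : 0 <= X * g by apply: Rmult_le_pos; lra.
  move: (X * g) Xg lt => t t0 t1; have : t ^ 2 < 1 by nra.
  by have := pow2_ge_0 t; nra.
have : 1 <= (X * g) ^ 4; last lra.
rewrite Rpow_mult_distr g4 /Rdiv -Rmult_assoc; apply Rle_div_r; lra.
Qed.

(** This eliminates [u]. If [el <= u^4] the regime applies; otherwise [u.+1 ^ 10] is at most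
    [2^10 el^(5/2)], and the trivial bound [y el] is good enough. *)
Lemma block_saw_sum_uniform (n y N : nat) (el : R) :
  (0 < y)%N -> (y < N <= 2 * y)%N -> (N <= n)%N -> INR n ^ 2 <= INR y ^ 3 -> el = 1 + ln (INR n) ->
  Rabs (\rsum_(1 <= p < N.+1) (if (y < p)%N then prime_log p * saw n p else 0)) <=
  7112 * 2 ^ 11 * fourth_root_weight n (INR y) * (el ^ 3 * sqrt el).
Proof.
move=> y0 yN Nn ny elE; have n0 : (0 < n)%N by lia.
have y1 := INR_ge1 y0; have n1 := INR_ge1 n0.
have el1 : 1 <= el by rewrite elE; have := ln_INR_ge0 n; lra.
have trivial : Rabs (\rsum_(1 <= p < N.+1) (if (y < p)%N then prime_log p * saw n p else 0)) <= INR y * el.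
  apply: Rle_trans (sum_abs _ _ _) _.
  apply: (Rle_trans _ (\rsum_(y.+1 <= m < N.+1) el)).
    rewrite (@big_nat_widenl _ _ _ y.+1 1 N.+1) // [X in _ <= X]big_mkcond.
    apply: sum_le => m /andP[m1 m2] /=.
    case: ifP => _; last by rewrite Rabs_R0; lra.
    rewrite Rabs_mult (Rabs_pos_eq (prime_log m)); last exact: prime_log_ge0.
    have := prime_log_le m; have := prime_log_ge0 m; have := saw_abs n m1.
    have : ln (INR m) <= ln (INR n) by apply: ln_INR_le; lia.
    have := Rabs_pos (saw n m); rewrite elE; nra.
  rewrite sum_const; apply: Rmult_le_compat_r; first lra.
  by apply: leq_INR; lia.
have [u /andP[u1 u2]] := exists_scale n y0.
have u1' : 2 * INR u ^ 40 * INR y <= INR n.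
  by have := leq_INR u1; rewrite !(INR_mul (_ * _)) (INR_mul 2) INR_expn (_ : INR 2 = 2).
have u2' : INR n < 2 * INR u.+1 ^ 40 * INR y.
  by have := ltn_INR u2; rewrite (INR_mul (2 * _)) (INR_mul 2) INR_expn (_ : INR 2 = 2).
set v := INR u.+1 in u2'; have v1 : 1 <= v by apply: INR_ge1.
have v10 : 1 <= v ^ 10 by apply: pow_R1_Rle.
(* Maximality of [u] gives [n < 2 v^40 y], so [v^10] is at least of order [(n / y)^(1/4)]. *)
have low : 1 <= 2 * v ^ 10 * Rpower (INR y / INR n) (1 / 4).
  apply: quarter_lower => //; first lra.
  rewrite (_ : (2 * v ^ 10) ^ 4 = 16 * v ^ 40); last by ring.
  have v40 : 0 < v ^ 40 by apply: pow_lt; lra.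
  have : 0 < v ^ 40 * INR y by apply: Rmult_lt_0_compat; lra.
  lra.
rewrite /fourth_root_weight; move: low; set g := Rpower _ _ => low.
have g0 : 0 < g by exact: exp_pos.
have s1 : 1 <= sqrt el by rewrite -sqrt_1; apply: sqrt_le_1_alt.
have E0 : 0 < el ^ 3 * sqrt el by apply: Rmult_lt_0_compat; [apply: pow_lt | ]; lra.
have [small|big] := Rlt_le_dec (INR u ^ 4) el.
  apply: Rle_trans trivial _.
  have v4 : v ^ 4 <= 16 * el.
    have [uz|u0] := posnP u; first by rewrite /v uz (_ : INR 1 = 1) // pow1; lra.
    have : v <= 2 * INR u by rewrite /v S_INR; have := INR_ge1 u0; lra.
    move=> vu; have : v ^ 4 <= (2 * INR u) ^ 4 by apply: pow_incr; lra.
    rewrite Rpow_mult_distr; lra.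
  have v20 : v ^ 10 <= 2 ^ 10 * (el ^ 2 * sqrt el).
    have B0 : 0 <= 2 ^ 10 * (el ^ 2 * sqrt el).
      apply: Rmult_le_pos; first by apply: pow_le; lra.
      by apply: Rmult_le_pos; [exact: pow2_ge_0 | lra].
    apply: Rsqr_incr_0_var => //; rewrite /Rsqr.
    rewrite (_ : v ^ 10 * v ^ 10 = (v ^ 4) ^ 5); last by ring.
    rewrite (_ : 2 ^ 10 * (el ^ 2 * sqrt el) * _ = (16 ^ 5) * (el ^ 4 * (sqrt el * sqrt el))); last by ring.
    rewrite sqrt_sqrt; last lra.
    rewrite (_ : 16 ^ 5 * (el ^ 4 * el) = (16 * el) ^ 5); last by ring.
    by apply: pow_incr; split => //; apply: pow_le; lra.
  apply: (Rle_trans _ (INR y * el * (2 * v ^ 10 * g))).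
    by rewrite -[X in X <= _]Rmult_1_r; apply: Rmult_le_compat_l => //; nra.
  apply: (Rle_trans _ (INR y * el * (2 * (2 ^ 10 * (el ^ 2 * sqrt el)) * g))).
    apply: Rmult_le_compat_l; first by nra.
    by apply: Rmult_le_compat_r; lra.
  rewrite (_ : INR y * el * _ = 2 ^ 11 * (INR y * g * (el ^ 3 * sqrt el))); last by ring.
  have : 0 <= INR y * g * (el ^ 3 * sqrt el) by apply: Rmult_le_pos; nra.
  lra.
have u0 : (0 < u)%N.
  by case: (u) big => // /=; rewrite Rmult_0_l; lra.
have rg : regime n y N u el by split => //; rewrite elE; lra.
have uw := INR_ge1 u0.
apply: Rle_trans (block_saw_sum rg) _; apply: Rmult_le_compat_r; first lra.
have u10 : 0 < INR u ^ 10 by apply: pow_lt; lra.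
(* [v <= 2 u] costs [2^10]; with the [2] in [low] this makes the [2^11]. *)
have vu : v ^ 10 <= 2 ^ 10 * INR u ^ 10.
  by rewrite -Rpow_mult_distr; apply: pow_incr; rewrite /v S_INR; lra.
have H : 1 <= 2 ^ 11 * g * INR u ^ 10.
  apply: Rle_trans low _; rewrite (_ : 2 ^ 11 * g * INR u ^ 10 = 2 * (2 ^ 10 * INR u ^ 10) * g); last by ring.
  by apply: Rmult_le_compat_r; lra.
have iu : / INR u ^ 10 <= 2 ^ 11 * g.
  apply: (Rmult_le_reg_r (INR u ^ 10)) => //; rewrite Rinv_l; lra.
rewrite (_ : 7112 * 2 ^ 11 * (INR y * g) = 7112 * INR y * (2 ^ 11 * g)); last by ring.
by apply: Rmult_le_compat_l; lra.
Qed.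

Lemma fourth_root_weight_mono n y z : 0 < y <= z -> (0 < n)%N ->
  fourth_root_weight n y <= y / z * fourth_root_weight n z.
Proof.
move=> [y0 yz] n0; have n1 := INR_ge1 n0; rewrite /fourth_root_weight.
rewrite (_ : y / z * (z * _) = y * Rpower (z / INR n) (1 / 4)); last by field; lra.
apply: Rmult_le_compat_l; first lra.
apply: Rle_Rpower_l; first lra.
split; first by apply: Rdiv_lt_0_compat; lra.
by apply: Rmult_le_compat_r => //; apply: Rlt_le; apply: Rinv_0_lt_compat; lra.
Qed.

Lemma Rpower_third_pow3 x : 0 < x -> Rpower x (2 / 3) ^ 3 = x ^ 2.
Proof.
move=> x0; rewrite -Rpower_pow; last exact: exp_pos.
rewrite Rpower_mult (_ : 2 / 3 * INR 3 = INR 2); first exact: Rpower_pow.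
by rewrite /=; field.
Qed.

(** Strong induction, halving [N]. The weights of the blocks decay geometrically, growing at least
    linearly in [y]; below [2 n^(2/3)] the trivial bound takes over. *)
Lemma prime_saw_sum (n N : nat) (el : R) : (1 < n)%N -> (N <= n)%N -> el = 1 + ln (INR n) ->
  Rabs (\rsum_(1 <= p < N.+1) (prime_log p * saw n p)) <=
  7112 * 2 ^ 12 * fourth_root_weight n (INR N) * (el ^ 3 * sqrt el) + 2 * Rpower (INR n) (2 / 3) * el.
Proof.
move=> n1 Nn elE; have n0 : (0 < n)%N by lia.
have n1' : 2 <= INR n by have := leq_INR n1.
have el1 : 1 <= el by rewrite elE; have := ln_INR_ge0 n; lra.
have s1 : 1 <= sqrt el by rewrite -sqrt_1; apply: sqrt_le_1_alt.
have E0 : 0 < el ^ 3 * sqrt el by apply: Rmult_lt_0_compat; [apply: pow_lt | ]; lra.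
have q0 : 0 < Rpower (INR n) (2 / 3) by exact: exp_pos.
have q3 := @Rpower_third_pow3 (INR n) ltac:(lra).
set q := Rpower _ _ in q0 q3 *.
have [m] := ubnP N; elim: m N Nn => // m IH N Nn Nm.
have N0' := pos_INR N.
have w0 : 0 <= fourth_root_weight n (INR N).
  by apply: Rmult_le_pos => //; apply: Rlt_le; exact: exp_pos.
(* The factor [8] ensures that in the second case [y >= N / 2] still satisfies [n^2 <= y^3]. *)
have [small|big] := Rle_lt_dec (INR N ^ 3) (8 * INR n ^ 2).
  have Nq : INR N <= 2 * q.
    have [//|lt] := Rle_lt_dec (INR N) (2 * q).
    have : 0 < (INR N - 2 * q) * (INR N ^ 2 + INR N * (2 * q) + (2 * q) ^ 2).
      by apply: Rmult_lt_0_compat; nra.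
    rewrite (_ : _ * _ = INR N ^ 3 - 8 * q ^ 3); last by ring.
    by rewrite q3; lra.
  apply: (Rle_trans _ (INR N * el)).
    apply: Rle_trans (sum_abs _ _ _) _; apply: sum1_le_const => p /andP[p1 p2].
    rewrite Rabs_mult (Rabs_pos_eq (prime_log p)); last exact: prime_log_ge0.
    have := prime_log_le p; have := prime_log_ge0 p; have := saw_abs n p1.
    have : ln (INR p) <= ln (INR n) by apply: ln_INR_le; lia.
    have := Rabs_pos (saw n p); rewrite elE; nra.
  have : 0 <= 7112 * 2 ^ 12 * fourth_root_weight n (INR N) * (el ^ 3 * sqrt el).
    by apply: Rmult_le_pos; [apply: Rmult_le_pos => //; lra | lra].
  have : INR N * el <= 2 * q * el by apply: Rmult_le_compat_r; lra.
  lra.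
have N3 : (3 <= N)%N.
  rewrite leqNgt; apply/negP => N2; have : INR N <= 2 by apply: (leq_INR (k := 2)).
  move=> H; have : INR N ^ 3 <= 2 ^ 3 by apply: pow_incr.
  nra.
(* Rounding up gives [N <= 2 y], and for [N >= 3] one still has [y <= 2 N / 3]. *)
pose y := uphalf N.
have yb : (y < N <= 2 * y)%N by rewrite /y; lia.
have y0 : (0 < y)%N by rewrite /y; lia.
have y32 : (3 * y <= 2 * N)%N by rewrite /y; lia.
have y1 := INR_ge1 y0.
have N1 : 3 <= INR N by have := leq_INR N3; rewrite (_ : INR 3 = 3) //=; lra.
have y32' : 3 * INR y <= 2 * INR N.
  by have := leq_INR y32; rewrite !INR_mul (_ : INR 2 = 2) // (_ : INR 3 = 3) //=; lra.
have yN' : INR N <= 2 * INR y.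
  by have /andP[_ /leq_INR] := yb; rewrite INR_mul.
have ny : INR n ^ 2 <= INR y ^ 3.
  have : INR N ^ 3 <= (2 * INR y) ^ 3 by apply: pow_incr.
  rewrite Rpow_mult_distr; lra.
have yn : (y <= n)%N by lia.
have IHy := IH y yn ltac:(lia).
have B := block_saw_sum_uniform y0 yb Nn ny elE.
have wy : fourth_root_weight n (INR y) <= 2 / 3 * fourth_root_weight n (INR N).
  apply: Rle_trans (@fourth_root_weight_mono n (INR y) (INR N) _ n0) _.
    by split; [lra | apply: leq_INR; lia].
  apply: Rmult_le_compat_r => //; apply: (proj2 (Rle_div_l _ _ _ _)); lra.
have -> : \rsum_(1 <= p < N.+1) (prime_log p * saw n p) =
    \rsum_(1 <= p < y.+1) (prime_log p * saw n p) +
    \rsum_(1 <= p < N.+1) (if (y < p)%N then prime_log p * saw n p else 0).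
  rewrite (@big_cat_nat _ _ _ y.+1) //=; last by lia.
  by congr (_ + _); rewrite -big_mkcond (@big_nat_widenl _ _ _ y.+1 1 N.+1).
apply: Rle_trans (Rabs_triang _ _) _.
move: IHy B; set S1 := \rsum_(_ <= _ < _) _; set S2 := \rsum_(_ <= _ < _) _ => IHy B.
(* The constant reproduces itself: [(2^12 + 2^11) * 2/3 = 2^12]. *)
have wyE : fourth_root_weight n (INR y) * (el ^ 3 * sqrt el) <=
    2 / 3 * (fourth_root_weight n (INR N) * (el ^ 3 * sqrt el)).
  by rewrite -[X in _ <= X]Rmult_assoc; apply: Rmult_le_compat_r; lra.
move: IHy B; rewrite !(Rmult_assoc (7112 * _)); move: wyE.
set a := fourth_root_weight n (INR y) * _; set b := fourth_root_weight n (INR N) * _.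
lra.
Qed.

(** * Digit sums *)

Lemma sumR_filter_seq (f : nat -> R) (P : nat -> bool) (a k : nat) :
  sumR (List.map f (List.filter P (List.seq a k))) = \rsum_(a <= i < a + k) (if P i then f i else 0).
Proof.
elim: k a => [|k IH] a; first by rewrite addn0 big_geq.
rewrite big_ltn; last by lia.
by rewrite /= addnS -addSn -IH; case: (P a) => /=; [|rewrite Rplus_0_l].
Qed.

Lemma sumR_primes_le (f : nat -> R) (x : R) (N : nat) : INR N <= x < INR N + 1 ->
  sumR (List.map f (primes_le x)) = \rsum_(1 <= p < N.+1) (if prime p then f p else 0).
Proof.
move=> [Nx xN]; rewrite /primes_le sumR_filter_seq add0n.
have [up1 up2] := archimed x.
have N0 := pos_INR N.
have NZ : (N.+1 <= Z.to_nat (up x))%N.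
  have : (Z.of_nat N < up x)%Z by apply: lt_IZR; rewrite -INR_IZR_INZ; lra.
  by lia.
rewrite (@big_cat_nat _ _ _ N.+1) //= [X in _ + X](_ : _ = 0); last first.
  rewrite big_nat big1 // => p /andP[p1 _].
  destruct (Rle_dec (INR p) x) as [px|px]; last by rewrite andbF.
  by have := leq_INR p1; rewrite S_INR; lra.
rewrite Rplus_0_r big_ltn //= Rplus_0_l; apply: eq_big_nat => p /andP[_ pN].
destruct (Rle_dec (INR p) x) as [px|px]; first by rewrite andbT.
by case: px; apply: Rle_trans Nx; apply: leq_INR.
Qed.

Lemma modnE_Nat a b : (0 < b)%N -> Nat.modulo a b = (a %% b)%N.
Proof.
move=> b0; symmetry; apply: (@Nat.mod_unique a b (a %/ b)%N).
  by apply/ltP; rewrite ltn_pmod.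
by rewrite {1}(divn_eq a b) mulnC.
Qed.

Lemma divnE_Nat a b : (0 < b)%N -> Nat.div a b = (a %/ b)%N.
Proof.
move=> b0; symmetry; apply: (@Nat.div_unique a b _ (a %% b)%N).
  by apply/ltP; rewrite ltn_pmod.
by rewrite {1}(divn_eq a b) mulnC.
Qed.

Lemma digsum_aux0 f p : (0 < p)%N -> digsum_aux f p 0 = 0%N.
Proof. by move=> p0; elim: f => //= f IH; rewrite modnE_Nat // divnE_Nat // mod0n div0n IH. Qed.

Lemma digsum_large_prime p n : (1 < p)%N -> (n < p * p)%N -> digsum p n = (n %% p + n %/ p)%N.
Proof.
move=> p1 np; have p0 : (0 < p)%N by lia.
have qp : (n %/ p < p)%N by rewrite ltn_divLR.
rewrite /digsum; case: n np qp => [|n] np qp; first by rewrite mod0n div0n.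
rewrite /= modnE_Nat // divnE_Nat //; congr (_ + _)%N.
(* For the number [1] the fuel is used up after one digit, and the second digit [1 %/ p] is indeed
   [0]. *)
case: n np qp => [|n] np qp; first by rewrite divn_small.
by rewrite /= modnE_Nat // divnE_Nat // (modn_small qp) (divn_small qp) digsum_aux0 // addn0.
Qed.

(** Each digit is at most [p - 1], and there are at most [1 + ln m / ln p] of them; the factor
    [ln p] clears the denominator. *)
Lemma digsum_aux_le f p m : (1 < p)%N -> (0 < m)%N ->
  INR (digsum_aux f p m) * ln (INR p) <= INR (p - 1) * (ln (INR p) + ln (INR m)).
Proof.
move=> p1; have p0 : (0 < p)%N by lia.
have lp := ln_INR_ge0 p; have pp := pos_INR (p - 1).
elim: f m => [|f IH] m m0; have lm := ln_INR_ge0 m.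
  by rewrite Rmult_0_l; apply: Rmult_le_pos; lra.
rewrite /= modnE_Nat // divnE_Nat // INR_add Rmult_plus_distr_r.
have mp : INR (m %% p) <= INR (p - 1).
  by apply: leq_INR; have := ltn_pmod m p0; move: (m %% p)%N => r; lia.
have mp' : INR (m %% p) * ln (INR p) <= INR (p - 1) * ln (INR p) by apply: Rmult_le_compat_r.
have [q0|q0] := posnP (m %/ p).
  rewrite q0 digsum_aux0 // Rmult_0_l.
  have : 0 <= INR (p - 1) * ln (INR m) by apply: Rmult_le_pos.
  lra.
have lq : ln (INR (m %/ p)) + ln (INR p) <= ln (INR m).
  rewrite -ln_mult; [|by have := INR_ge1 q0; lra|by have := INR_ge1 p0; lra].
  by rewrite -INR_mul; apply: ln_INR_le; rewrite muln_gt0 q0 p0 leq_divM.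
have := IH _ q0; have : INR (p - 1) * (ln (INR (m %/ p)) + ln (INR p)) <= INR (p - 1) * ln (INR m).
  by apply: Rmult_le_compat_l.
lra.
Qed.

(** * Assembly of the error term *)

Definition prime_term (n p : nat) : R :=
  INR (n - 1) / INR (p - 1) * INR (digsum p n) * ln (INR p) - / 2 * ln (INR p) * INR n.

Lemma prime_term_abs n p : prime p -> (p <= n)%N ->
  Rabs (prime_term n p) <= 3 * INR n * ln (INR n).
Proof.
move=> pp pn; have p1 := prime_gt1 pp; have p0 := prime_gt0 pp.
have n0 : (0 < n)%N by lia.
have lp := ln_INR_ge0 p; have ln' : ln (INR p) <= ln (INR n) by apply: ln_INR_le; rewrite p0.
have P1 : 1 <= INR (p - 1) by apply: INR_ge1; lia.
have n1 := INR_ge1 n0.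
have nn : INR (n - 1) <= INR n by apply: leq_INR; lia.
have n10 := pos_INR (n - 1).
have d := digsum_aux_le n p1 n0; rewrite -/(digsum p n) in d.
have d0 : 0 <= INR (digsum p n) * ln (INR p) by apply: Rmult_le_pos => //; exact: pos_INR.
have B : INR (n - 1) / INR (p - 1) * INR (digsum p n) * ln (INR p) <= 2 * INR n * ln (INR n).
  rewrite (_ : INR (n - 1) / INR (p - 1) * INR (digsum p n) * ln (INR p) =
    INR (n - 1) * (INR (digsum p n) * ln (INR p) / INR (p - 1))); last by field; lra.
  have : INR (digsum p n) * ln (INR p) / INR (p - 1) <= 2 * ln (INR n).
    apply: (proj2 (Rle_div_l _ _ _ _)); first lra.
    by nra.
  have : 0 <= INR (digsum p n) * ln (INR p) / INR (p - 1) by apply: Rdiv_le_0_compat; lra.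
  nra.
have B0 : 0 <= INR (n - 1) / INR (p - 1) * INR (digsum p n) * ln (INR p).
  by rewrite Rmult_assoc; apply: Rmult_le_pos => //; apply: Rdiv_le_0_compat; lra.
have C : / 2 * ln (INR p) * INR n <= INR n * ln (INR n) by nra.
have C0 : 0 <= / 2 * ln (INR p) * INR n by nra.
by rewrite /prime_term; apply: Rabs_le; nra.
Qed.

(* For [p^2 > n] the digits are [n %% p] and [n %/ p], so
   [d_p(n) / (p - 1) = saw n p + 1/2 + n / (p (p - 1))]. *)
Lemma prime_term_saw n p (q : R) : prime p -> (p <= n)%N -> (n < p * p)%N -> 1 <= q ->
  INR n ^ 2 <= INR p ^ 2 * q ->
  Rabs (prime_term n p - INR (n - 1) * (ln (INR p) * saw n p)) <= 3 * q * ln (INR n).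
Proof.
move=> pp pn npp q1 nq; have p1 := prime_gt1 pp; have p0 := prime_gt0 pp.
have n0 : (0 < n)%N by lia.
have lp := ln_INR_ge0 p; have ln' : ln (INR p) <= ln (INR n) by apply: ln_INR_le; rewrite p0.
have P2 : 2 <= INR p by apply: (leq_INR (m := 2)).
have n1 := INR_ge1 n0.
have E : INR n = INR (n %/ p) * INR p + INR (n %% p) by rewrite -INR_mul -INR_add -divn_eq.
have -> : prime_term n p - INR (n - 1) * (ln (INR p) * saw n p) =
   ln (INR p) * ((INR n - 1) * INR n / (INR p * (INR p - 1)) - / 2).
  rewrite /prime_term /saw digsum_large_prime // INR_add !minus_INR; [|exact/leP|exact/leP].
  rewrite (_ : INR 1 = 1) // (_ : INR (n %% p) = INR n - INR (n %/ p) * INR p); last by rewrite E; ring.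
  by field; lra.
have r0 : 0 <= (INR n - 1) * INR n / (INR p * (INR p - 1)).
  by apply: Rdiv_le_0_compat; nra.
have r1 : (INR n - 1) * INR n / (INR p * (INR p - 1)) <= 2 * q.
  by apply: (proj2 (Rle_div_l _ _ _ _)); nra.
rewrite Rabs_mult (Rabs_pos_eq (ln _)) //.
have : Rabs ((INR n - 1) * INR n / (INR p * (INR p - 1)) - / 2) <= 3 * q by apply: Rabs_le; lra.
have := Rabs_pos ((INR n - 1) * INR n / (INR p * (INR p - 1)) - / 2).
nra.
Qed.

Lemma RB_eq n x N : INR N <= x < INR N + 1 ->
  RB n x = \rsum_(1 <= p < N.+1) (if prime p then prime_term n p else 0).
Proof.
move=> HN; rewrite /RB /Bsum /theta !(sumR_primes_le _ HN).
rewrite (_ : / 2 * _ * INR n = \rsum_(1 <= p < N.+1) (if prime p then / 2 * ln (INR p) * INR n else 0)).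
  by rewrite -sum_sub; apply: eq_bigr => p _; rewrite /prime_term; case: ifP => _; ring.
rewrite big_distrr big_distrl; apply: eq_bigr => p _ /=; case: ifP => _; ring.
Qed.

(** The sum is cut at the integer part [Y] of [q = n^(2/3)]. Up to [Y] there are at most [q] terms
    of size [O(n log n)]; beyond, [n < p^2] and at most [n] terms differ from the sawtooth by
    [O(q log n)]. Both errors are [O(n^(5/3) log n)]. *)
Lemma RB_le n x : (1 < n)%N -> 1 <= x -> x <= INR n -> Rpower (INR n) (2 / 3) <= x ->
  Rabs (RB n x) <= 7112 * 2 ^ 12 * 54 *
    (Rpower x (5 / 4) * Rpower (INR n) (3 / 4) * (ln (INR n) ^ 3 * sqrt (ln (INR n))) +
     Rpower (INR n) (5 / 3) * ln (INR n)).
Proof.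
move=> n1 x1 xn qx; have n0 : (0 < n)%N by lia.
have n2 : 2 <= INR n by apply: (leq_INR (m := 2)).
set L := ln (INR n).
have L2n : ln 2 <= L by apply: ln_le; lra.
have L2 : / 2 < L by have := ln_lt_2; lra.
pose el := 1 + L; have elL : el <= 3 * L by rewrite /el; lra.
have el1 : 1 <= el by rewrite /el; lra.
set q := Rpower (INR n) (2 / 3) in qx *.
have q3 : q ^ 3 = INR n ^ 2 by apply: Rpower_third_pow3; lra.
have q0 : 0 < q by exact: exp_pos.
have q1 : 1 <= q.
  have [//|lt] := Rle_lt_dec 1 q; have : q ^ 3 < 1 by nra.
  by rewrite q3; nra.
have nq : INR n * q = Rpower (INR n) (5 / 3).
  rewrite /q -{1}(Rpower_1 (INR n)) -?Rpower_plus; last lra.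
  by congr Rpower; field.
have [N [N1 N2]] := nfloor_ex x ltac:(lra).
have [Y [Y1 Y2]] := nfloor_ex q ltac:(lra).
have Nn : (N <= n)%N by apply/leP; apply: INR_le; lra.
have YN : (Y <= N)%N.
  rewrite leqNgt; apply/negP => NY; have := leq_INR NY; rewrite S_INR; lra.
have N0 : (0 < N)%N.
  by apply/ltP; apply: INR_lt; rewrite /=; lra.
have N1' := INR_ge1 N0.
pose S M := \rsum_(1 <= p < M.+1) (prime_log p * saw n p).
have SN := prime_saw_sum n1 Nn (erefl el); rewrite -/(S N) -/q in SN.
have SY : Rabs (S Y) <= q * L.
  apply: (Rle_trans _ (INR Y * L)); last by apply: Rmult_le_compat_r; lra.
  apply: Rle_trans (sum_abs _ _ _) _; apply: sum1_le_const => p /andP[p1 p2].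
  rewrite Rabs_mult (Rabs_pos_eq (prime_log p)); last exact: prime_log_ge0.
  have := prime_log_le p; have := prime_log_ge0 p; have := saw_abs n p1.
  have : ln (INR p) <= L by apply: ln_INR_le; lia.
  have := Rabs_pos (saw n p); nra.
have SE : \rsum_(Y.+1 <= p < N.+1) (prime_log p * saw n p) = S N - S Y.
  rewrite /S [X in _ = X - _](@big_cat_nat _ _ _ Y.+1) //=.
  by set a := \rsum_(_ <= _ < _) _; set b := \rsum_(_ <= _ < _) _; ring.
have head : Rabs (\rsum_(1 <= p < Y.+1) (if prime p then prime_term n p else 0)) <= 3 * (INR n * q) * L.
  apply: Rle_trans (sum_abs _ _ _) _.
  apply: (Rle_trans _ (INR Y * (3 * INR n * L))).
    apply: sum1_le_const => p /andP[p1 p2]; case: ifP => pp; last by rewrite Rabs_R0; nra.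
    by apply: prime_term_abs => //; lia.
  rewrite (_ : 3 * (INR n * q) * L = q * (3 * INR n * L)); last by ring.
  by apply: Rmult_le_compat_r; nra.
have tail : Rabs (\rsum_(Y.+1 <= p < N.+1) (if prime p then prime_term n p else 0) -
    INR (n - 1) * (S N - S Y)) <= 3 * (INR n * q) * L.
  rewrite -SE big_distrr -sum_sub; apply: Rle_trans (sum_abs _ _ _) _.
  apply: (Rle_trans _ (INR (N.+1 - Y.+1) * (3 * q * L))).
    apply: sum_le_const => p /andP[p1 p2] /=; rewrite /prime_log; case: ifP => pp; last first.
      by rewrite Rmult_0_l Rmult_0_r Rminus_0_r Rabs_R0; nra.
    have pq : q < INR p by have := leq_INR p1; rewrite S_INR; lra.
    have npq : INR n ^ 2 <= INR p ^ 2 * q.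
      rewrite -q3 (_ : q ^ 3 = q ^ 2 * q); last by ring.
      by apply: Rmult_le_compat_r; [lra | apply: pow_incr; lra].
    apply: prime_term_saw => //; first by lia.
    apply/ltP; apply: INR_lt; rewrite INR_mul.
    have H : INR n ^ 2 < (INR p * INR p) ^ 2.
      apply: (Rle_lt_trans _ (INR p ^ 2 * q)) => //.
      rewrite (_ : (INR p * INR p) ^ 2 = INR p ^ 2 * INR p ^ 2); last by ring.
      by apply: Rmult_lt_compat_l; nra.
    by apply: Rsqr_incrst_0; [rewrite /Rsqr; lra | lra | nra].
  rewrite (_ : 3 * (INR n * q) * L = INR n * (3 * q * L)); last by ring.
  apply: Rmult_le_compat_r; first by nra.
  by apply: leq_INR; lia.
rewrite (@RB_eq n x N) // (@big_cat_nat _ _ _ Y.+1) //=.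
move: head tail; set A := \rsum_(_ <= _ < _) _; set B := \rsum_(_ <= _ < _) _ => head tail.
have nn1 : 0 <= INR (n - 1) <= INR n by split; [exact: pos_INR | apply: leq_INR; lia].
have main : INR n * fourth_root_weight n (INR N) <= Rpower x (5 / 4) * Rpower (INR n) (3 / 4).
  rewrite /fourth_root_weight.
  have N54 : Rpower (INR N) (5 / 4) <= Rpower x (5 / 4) by apply: Rle_Rpower_l; lra.
  apply: (Rle_trans _ (Rpower (INR N) (5 / 4) * Rpower (INR n) (3 / 4))); last first.
    by apply: Rmult_le_compat_r => //; apply: Rlt_le; exact: exp_pos.
  apply: Req_le; rewrite /Rpower ln_div; [|lra|lra].
  transitivity (exp (ln (INR n)) * (exp (ln (INR N)) * exp (1 / 4 * (ln (INR N) - ln (INR n))))).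
    by rewrite !exp_ln; [|lra|lra].
  by rewrite -!exp_plus; congr exp; field.
(* [el <= 3 L] since [L > 1/2], and [54 = 3^3 * 2] with [sqrt 3 <= 2]. *)
have eE : el ^ 3 * sqrt el <= 54 * (L ^ 3 * sqrt L).
  have h1 : el ^ 3 <= (3 * L) ^ 3 by apply: pow_incr; lra.
  have h2 : sqrt el <= 2 * sqrt L.
    apply: Rsqr_incr_0_var; last by have := sqrt_pos L; lra.
    rewrite /Rsqr sqrt_sqrt; last lra.
    rewrite (_ : 2 * sqrt L * (2 * sqrt L) = 4 * (sqrt L * sqrt L)); last by ring.
    by rewrite sqrt_sqrt; lra.
  apply: (Rle_trans _ ((3 * L) ^ 3 * (2 * sqrt L))).
    by apply: Rmult_le_compat => //; [apply: pow_le; lra | exact: sqrt_pos].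
  by apply: Req_le; ring.
have E0 : 0 <= el ^ 3 * sqrt el by apply: Rmult_le_pos; [apply: pow_le; lra | exact: sqrt_pos].
have W0 : 0 <= fourth_root_weight n (INR N).
  by apply: Rmult_le_pos; [lra | apply: Rlt_le; exact: exp_pos].
have S1 : INR n * Rabs (S N) <= 7112 * 2 ^ 12 * 54 *
   (Rpower x (5 / 4) * Rpower (INR n) (3 / 4) * (L ^ 3 * sqrt L)) + 6 * (INR n * q) * L.
  apply: (Rle_trans _ (INR n * (7112 * 2 ^ 12 * fourth_root_weight n (INR N) * (el ^ 3 * sqrt el) + 2 * q * el))).
    by apply: Rmult_le_compat_l; lra.
  rewrite Rmult_plus_distr_l; apply: Rplus_le_compat; last first.
    rewrite (_ : INR n * (2 * q * el) = 2 * (INR n * q) * el); last by ring.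
    rewrite (_ : 6 * (INR n * q) * L = 2 * (INR n * q) * (3 * L)); last by ring.
    by apply: Rmult_le_compat_l => //; nra.
  rewrite (_ : INR n * _ = 7112 * 2 ^ 12 * ((INR n * fourth_root_weight n (INR N)) * (el ^ 3 * sqrt el))); last by ring.
  rewrite [X in _ <= X]Rmult_assoc; apply: Rmult_le_compat_l; first lra.
  rewrite (_ : 54 * _ = (Rpower x (5 / 4) * Rpower (INR n) (3 / 4)) * (54 * (L ^ 3 * sqrt L))); last by ring.
  by apply: Rmult_le_compat => //; apply: Rmult_le_pos; lra.
have S2 : INR n * Rabs (S Y) <= INR n * q * L.
  by rewrite Rmult_assoc; apply: Rmult_le_compat_l; lra.
have S3 : Rabs (INR (n - 1) * (S N - S Y)) <= INR n * Rabs (S N) + INR n * Rabs (S Y).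
  rewrite Rabs_mult (Rabs_pos_eq (INR (n - 1))); last lra.
  have := Rabs_triang (S N) (- S Y); rewrite Rabs_Ropp => H.
  have := Rabs_pos (S N - S Y); rewrite /Rminus in H *; nra.
rewrite -nq.
have -> : A + B = A + ((B - INR (n - 1) * (S N - S Y)) + INR (n - 1) * (S N - S Y)) by ring.
apply: Rle_trans (Rabs_triang _ _) _.
have := Rabs_triang (B - INR (n - 1) * (S N - S Y)) (INR (n - 1) * (S N - S Y)).
have nqL : 0 <= INR n * q * L by apply: Rmult_le_pos; nra.
(* Besides [X], the quantity [n q L] occurs [3 + 3 + 6 + 1] times, well within the constant. *)
set X := Rpower x (5 / 4) * _ * _ in S1 *.
nra.
Qed.

(** At [n = 1] the claimed bound is [0], because [ln 1 = 0], so the error term has to vanish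
    exactly; it does, as no prime is at most [1]. *)
Lemma RB_one x : 1 <= x -> x <= 1 -> RB 1 x = 0.
Proof.
by move=> x1 x2; rewrite (@RB_eq 1 x 1) ?big_nat1 // (_ : INR 1 = 1) //; lra.
Qed.

Lemma RB_bound : exists C : R, 0 < C /\
  forall (n : nat) (x : R), (1 <= n)%N -> 1 <= x -> x <= INR n ->
    Rpower (INR n) (2 / 3) <= x ->
    Rabs (RB n x) <=
      C * (Rpower x (5 / 4) * Rpower (INR n) (3 / 4) * (ln (INR n) ^ 3 * sqrt (ln (INR n)))
           + Rpower (INR n) (5 / 3) * ln (INR n)).
Proof.
exists (7112 * 2 ^ 12 * 54); split; first lra.
move=> n x n1 x1 xn nx; have [n2|n2] := leqP 2 n; first exact: RB_le.
have nE : n = 1%N by lia.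
rewrite nE in xn *.
by rewrite RB_one // Rabs_R0 (_ : INR 1 = 1) // ln_1; lra.
Qed.

End Digit_sum_error.

Theorem theoremA1 :
  exists C : R, 0 < C /\
    forall (n : nat) (x : R),
      (1 <= n)%nat -> 1 <= x -> x <= INR n ->
      Rpower (INR n) (2 / 3) <= x ->
      Rabs (RB n x) <=
        C * (Rpower x (5 / 4) * Rpower (INR n) (3 / 4)
               * (ln (INR n) ^ 3 * sqrt (ln (INR n)))
             + Rpower (INR n) (5 / 3) * ln (INR n)).
Proof.
destruct Digit_sum_error.RB_bound as [C [C0 H]].
exists C; split; [exact C0 | intros n x n1].
apply H; destruct n; [inversion n1 | reflexivity].
Qed.
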